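(* Let $n\ge 1$. The generating function (sum of weights) of all arrowed monotone triangles with bottom row $(0,2,\ldots,2n-2)$ is $$\prod_{i=1}^{n} X_i^{n-1} \sum_{T} w^{\binom{n+1}{2}-|\lambda(T)|}\, \mathrm{sp}_{\lambda(T)}(u X_1,\ldots, u X_n, v X_1^{-1},\ldots,v X_n^{-1}),$$ where the sum is over all totally symmetric self-complementary plane partitions $T$ inside a $(2n+2)\times(2n+2)\times(2n+2)$ box.
   Context: $u,v,w,X_1,\ldots,X_n$ are indeterminates. **Monotone triangles.** A monotone triangle with $n$ rows is a triangular array of integers $(m_{i,j})_{1\le j\le i\le n}$ (row $i$ is $m_{i,1},\ldots,m_{i,i}$) with $m_{i+1,j}\le m_{i,j}\le m_{i+1,j+1}$ and $m_{i,j}<m_{i,j+1}$ whenever the entries exist. The $\nwarrow$-neighbor of $m_{i,j}$ is $m_{i-1,j-1}$ and its $\nearrow$-neighbor is $m_{i-1,j}$ (if they exist). The bottom row is row $n$. **Arrowed monotone triangles (AMTs).** An AMT is a monotone triangle in which each entry carries exactly one of three decorations: $\nwarrow$, $\nearrow$, or the double arrow $\nwarrow\!\nearrow$, such that: (i) if an entry $e$ has a $\nwarrow$-neighbor and is equal to it, then $e$ carries $\nearrow$; (ii) if $e$ has a $\nearrow$-neighbor and is equal to it, then $e$ carries $\nwarrow$. The weight of an AMT with $n$ rows is $$u^{\#\nearrow}v^{\#\nwarrow}w^{\#\nwarrow\!\nearrow}\prod_{i=1}^n X_i^{(\text{sum of row }i)-(\text{sum of row }i-1)+(\#\nearrow\text{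 in row }i)-(\#\nwarrow\text{ in row }i)},$$ where the sum of row $0$ is $0$, and $\#\nearrow$, $\#\nwarrow$, $\#\nwarrow\!\nearrow$ count the entries carrying exactly that decoration (double arrows are counted only in $\#\nwarrow\!\nearrow$). **Symplectic characters.** For a partition $\lambda$ with at most $n$ parts, $\mathrm{sp}_\lambda(x_1,\ldots,x_n,y_1,\ldots,y_n)$ denotes the generating function of symplectic tableaux of shape $\lambda$: fillings of the Young diagram of $\lambda$ with letters from $1<\bar 1<2<\bar 2<\cdots<n<\bar n$, weakly increasing along rows, strictly increasing down columns, with all entries in row $r$ at least $r$; the weight is $\prod_i x_i^{\#i}y_i^{\#\bar i}$. Here one substitutes $x_i=uX_i$, $y_i=vX_i^{-1}$. For $x_i=X_i$, $y_i=X_i^{-1}$ one has $$\mathrm{sp}_\lambda(X_1,\ldots,X_n,X_1^{-1},\ldots,X_n^{-1})=\frac{\det_{1\le i,j\le n}\left(X_i^{\lambda_j+n-j+1}-X_i^{-(\lambda_j+n-j+1)}\right)}{\det_{1\le i,j\le n}\left(X_i^{n-j+1}-X_i^{-(n-j+1)}\right)}.$$ **TSSCPPs and $\lambda(T)$.** A plane partition in an $N\times N\times N$ box is a finite order ideal $T\subseteq\{1,\ldots,N\}^3$; it is totally symmetric if invariant under all permutations of coordinates, and self-complementary if $(x,y,z)\in T \iff (N+1-x,N+1-y,N+1-z)\notin T$. Let $N=2n+2$ and write $\pi_{x,y}=\#\{z:(x,y,z)\in T\}$. A totally symmetric self-complementary plane partition (TSSCPP) $T$ corresponds bijectively to the triangular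 array $g_{r,s}=\pi_{n+2+r-s,\,2n+2-s}$ ($1\le s\le r\le n$), which is a Gelfand–Tsetlin pattern ($g_{r+1,s}\le g_{r,s}\le g_{r+1,s+1}$) of non-negative integers with $g_{r,s}\le s$. This pattern encodes a semistandard Young tableau with entries in $\{1,\ldots,n\}$ (the shape formed by the entries $\le r$ is $(g_{r,r},\ldots,g_{r,1})$), and conjugating this tableau and replacing each entry $p$ by $n+1-p$ gives a row-strict plane partition (rows strictly decreasing, columns weakly decreasing, positive integer entries) with at most $n$ rows whose entries in the $i$-th of $n$ rows from the bottom (allowing rows of length zero) are at most $i$. $\lambda(T)$ is the shape of this row-strict plane partition; equivalently, $\lambda(T)$ is the conjugate of the partition $(\pi_{n+2,n+2},\pi_{n+3,n+3},\ldots,\pi_{2n+1,2n+1})$. $|\lambda|$ is the sum of the parts of $\lambda$. *)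

(* Defs.v *)
From HB Require Import structures.
From mathcomp Require Import all_boot all_order all_fingroup all_algebra.
From mathcomp Require Import zify.

Set Implicit Arguments.
Unset Strict Implicit.
Unset Printing Implicit Defensive.

Import Order.TTheory GRing.Theory Num.Theory.
Local Open Scope ring_scope.

(* Positions of a triangle with n rows. Rows and columns are 0-based: the
   entry m_{i,j} (1 <= j <= i <= n) sits at row i-1, column j-1. *)
Definition tri (n : nat) : finType := {i : 'I_n & 'I_i.+1}.
Definition trow n (p : tri n) : nat := tag p.
Definition tcol n (p : tri n) : nat := tagged p.

(* p is the NW- (resp. NE-) neighbour of q *)
Definition nw_of n (q p : tri n) : bool :=
  (trow q == (trow p).+1) && (tcol q == (tcol p).+1).
Definition ne_of n (q p : tri n) : bool :=
  (trow q == (trow p).+1) && (tcol q == tcol p).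

Definition is_monotone_triangle n (m : {ffun tri n -> int}) : bool :=
  [forall q, forall p,
    [&& ne_of q p ==> (m q <= m p),
        nw_of q p ==> (m p <= m q)
      & (trow p == trow q) && (tcol q == (tcol p).+1) ==> (m p < m q)]].

Inductive arrow := NW | NE | NWNE.

Definition arrow_code (a : arrow) : 'I_3 :=
  match a with NW => inord 0 | NE => inord 1 | NWNE => inord 2 end.
Definition arrow_decode (i : 'I_3) : arrow :=
  match val i with 0%N => NW | 1%N => NE | _ => NWNE end.
Lemma arrow_codeK : cancel arrow_code arrow_decode.
Proof. by case; rewrite /arrow_decode /= inordK. Qed.
HB.instance Definition _ := Finite.copy arrow (can_type arrow_codeK).

Definition arrowed (n : nat) : choiceType :=
  ({ffun tri n -> int} * {ffun tri n -> arrow})%type.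

Definition is_amt n (A : arrowed n) : bool :=
  is_monotone_triangle A.1 &&
  [forall q, forall p,
    (nw_of q p && (A.1 p == A.1 q) ==> (A.2 q == NE)) &&
    (ne_of q p && (A.1 p == A.1 q) ==> (A.2 q == NW))].

Definition has_bottom n (k : 'I_n -> int) (A : arrowed n) : bool :=
  [forall p : tri n, forall j : 'I_n,
    ((trow p).+1 == n) && (tcol p == j) ==> (A.1 p == k j)].

Section AMT.
Variables (n : nat) (k : 'I_n -> int).

Definition amt : Type := {A : arrowed n | is_amt A && has_bottom k A}.
HB.instance Definition _ := Choice.on amt.
HB.instance Definition _ :=
  SubType.copy amt {A : arrowed n | is_amt A && has_bottom k A}.

(* There are finitely many arrowed monotone triangles with a given bottom row,
   because the entries are bounded by those of the bottom row. *)
Let B : nat := (\sum_j `|k j|)%N.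

Lemma amt_bound (A : amt) (p : tri n) : (`|(val A).1 p| <= B)%N.
Proof.
case: A => -[m d] /=; rewrite /is_amt /= => /andP[/andP[mt _] bot].
have [c lec] : exists c, (n - trow p <= c)%N by exists (n - trow p)%N.
elim: c p lec => [|c IHc] [i j] lec /=.
  by move: lec; rewrite /trow /= leqn0 subn_eq0 leqNgt ltn_ord.
have [ein|nein] := eqVneq i.+1 n.
  have jn : (j < n)%N by rewrite -{2}ein ltn_ord.
  move: bot => /forallP/(_ (Tagged (fun i : 'I_n => 'I_i.+1) j)).
  move=> /forallP/(_ (Ordinal jn)); rewrite /trow /tcol /= eqxx andbT.
  move/implyP/(_ (introT eqP ein))/eqP => ->; rewrite /B (bigD1 (Ordinal jn)) //=.
  exact: leq_addr.
have i1n : (i.+1 < n)%N by rewrite ltn_neqAle nein ltn_ord.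
pose i' := Ordinal i1n.
have j2 : (j < i'.+1)%N by rewrite /= ltnS ltnW.
have j3 : (j.+1 < i'.+1)%N by rewrite /= ltnS.
pose mk (j' : 'I_i'.+1) : tri n := Tagged (fun i : 'I_n => 'I_i.+1) j'.
have lec' (j' : 'I_i'.+1) : (n - trow (mk j') <= c)%N.
  by move: lec; rewrite /trow /= subnS; case: (n - i)%N.
have b1 := IHc (mk (Ordinal j2)) (lec' _).
have b2 := IHc (mk (Ordinal j3)) (lec' _).
set p := existT _ i j.
move: mt => /forallP mt.
have /forallP/(_ p) := mt (mk (Ordinal j2)).
rewrite /ne_of /trow /tcol /= !eqxx /= => /andP[le1 _].
have /forallP/(_ p) := mt (mk (Ordinal j3)).
rewrite /nw_of /trow /tcol /= !eqxx /= => /and3P[_ le2 _].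
move: b1 b2 le1 le2; rewrite -!lez_nat !abszE !ler_norml.
move=> /andP[b1 _] /andP[_ b2] le1 le2.
by rewrite (le_trans b1 le1) (le_trans le2 b2).
Qed.

Definition amt_code (A : amt) :
    {ffun tri n -> 'I_(B + B).+1} * {ffun tri n -> arrow} :=
  ([ffun p => inord `|((val A).1 p + B%:Z)%R|%N], (val A).2).
Definition amt_decode
    (c : {ffun tri n -> 'I_(B + B).+1} * {ffun tri n -> arrow}) : option amt :=
  insub (([ffun p => (c.1 p)%:Z - B%:Z], c.2) : arrowed n).

Lemma amt_codeK : pcancel amt_code amt_decode.
Proof.
move=> A; rewrite /amt_decode.
set x := (X in insub X); suff -> : x = val A by rewrite valK.
rewrite {}/x /amt_code /= [RHS]surjective_pairing; congr (_, _).
apply/ffunP => p; rewrite !ffunE.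
have := amt_bound A p; rewrite -lez_nat abszE ler_norml => /andP[b1 b2].
have ge0 : 0 <= (val A).1 p + B%:Z by rewrite -lerBlDr sub0r.
rewrite inordK; first by rewrite gez0_abs // addrK.
by rewrite ltnS -lez_nat gez0_abs // PoszD lerD2r.
Qed.

HB.instance Definition _ : isCountable amt :=
  PCanIsCountable amt_codeK.
HB.instance Definition _ : isFinite amt := PCanIsFinite amt_codeK.

End AMT.

Definition row_sum n (m : {ffun tri n -> int}) (i : nat) : int :=
  \sum_(p : tri n | trow p == i) m p.

Definition count_in_row n (d : {ffun tri n -> arrow}) (a : arrow) (i : nat) :=
  #|[set p : tri n | (trow p == i) && (d p == a)]|.

Definition count_arrow n (d : {ffun tri n -> arrow}) (a : arrow) : nat :=
  #|[set p : tri n | d p == a]|.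

Definition prev_row_sum n (m : {ffun tri n -> int}) (i : nat) : int :=
  if i is i'.+1 then row_sum m i' else 0.

Definition amt_weight (R : comUnitRingType) n (u v w : R) (X : 'I_n -> R)
    (A : arrowed n) : R :=
  u ^+ count_arrow A.2 NE * v ^+ count_arrow A.2 NW
    * w ^+ count_arrow A.2 NWNE
    * \prod_(i < n) X i ^ (row_sum A.1 i - prev_row_sum A.1 i
                           + (count_in_row A.2 NE i)%:Z
                           - (count_in_row A.2 NW i)%:Z).

(* A partition is a weakly decreasing sequence of naturals. *)
Definition conj_part (la : seq nat) : seq nat :=
  [seq count (fun m => (i < m)%N) la | i <- iota 0 (\max_(m <- la) m)].

Definition cells (la : seq nat) : finType :=
  {r : 'I_(size la) & 'I_(nth 0%N la r)}.

(* The letter i+1 is (i, false) and its barred version is (i, true); rank is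
   the position of a letter in 1 < 1bar < 2 < 2bar < ... *)
Definition letter (n : nat) : finType := ('I_n * bool)%type.
Definition rank n (l : letter n) : nat := (2 * l.1 + l.2)%N.

(* The entries of the 0-based row r are at least the unbarred letter r+1,
   whose rank is 2 * r. *)
Definition is_symplectic n (la : seq nat) (t : {ffun cells la -> letter n})
    : bool :=
  [forall c : cells la, (2 * tag c <= rank (t c))%N] &&
  [forall c : cells la, forall c' : cells la,
    ((tag c == tag c') && (tagged c < tagged c')%N
       ==> (rank (t c) <= rank (t c'))%N) &&
    ((tag c < tag c')%N && (tagged c == tagged c' :> nat)
       ==> (rank (t c) < rank (t c'))%N)].

Definition sp (R : comUnitRingType) n (la : seq nat) (x y : 'I_n -> R) : R :=
  \sum_(t : {ffun cells la -> letter n} | is_symplectic t)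
    \prod_(i < n) (x i ^+ #|[set c | t c == (i, false)]|
                   * y i ^+ #|[set c | t c == (i, true)]|).

(* The element (x, y, z) of 'I_N ^ 3 stands for (x+1, y+1, z+1) in
   {1, ..., N}^3, so that rev_ord x stands for N + 1 - (x+1). *)
Definition box (N : nat) : finType := ('I_N * 'I_N * 'I_N)%type.

Definition is_plane_partition N (T : {set box N}) : bool :=
  [forall p : box N, forall q : box N,
    [&& p \in T, (q.1.1 <= p.1.1)%N, (q.1.2 <= p.1.2)%N & (q.2 <= p.2)%N]
      ==> (q \in T)].

Definition is_totally_symmetric N (T : {set box N}) : bool :=
  [forall x, forall y, forall z,
    [&& ((y, x, z) \in T) == ((x, y, z) \in T),
        ((x, z, y) \in T) == ((x, y, z) \in T),
        ((z, y, x) \in T) == ((x, y, z) \in T),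
        ((y, z, x) \in T) == ((x, y, z) \in T)
      & ((z, x, y) \in T) == ((x, y, z) \in T)]].

Definition is_self_complementary N (T : {set box N}) : bool :=
  [forall x, forall y, forall z,
    ((x, y, z) \in T) == ((rev_ord x, rev_ord y, rev_ord z) \notin T)].

Definition is_tsscpp N (T : {set box N}) : bool :=
  [&& is_plane_partition T, is_totally_symmetric T & is_self_complementary T].

(* pi_{x,y}, with 1-based x and y *)
Definition height N (T : {set box N}) (x y : nat) : nat :=
  #|[set p in T | ((p.1.1).+1 == x) && ((p.1.2).+1 == y)]|.

(* The Gelfand-Tsetlin pattern g_{r,s}, 1 <= s <= r <= n *)
Definition gt_pattern n (T : {set box (2 * n + 2)}) (r s : nat) : nat :=
  height T (n + 2 + r - s) (2 * n + 2 - s).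

(* The shape (g_{r,r}, ..., g_{r,1}) of the entries <= r in the semistandard
   tableau encoded by the pattern *)
Definition gt_shape n (T : {set box (2 * n + 2)}) (r : nat) : seq nat :=
  [seq gt_pattern T r s | s <- rev (iota 1 r)].

(* The row-strict plane partition is the conjugate of the whole tableau with
   its entries relabelled, which does not affect the shape. *)
Definition lambda n (T : {set box (2 * n + 2)}) : seq nat :=
  conj_part (gt_shape T n).

Lemma gt_shape_diag n (T : {set box (2 * n + 2)}) :
  gt_shape T n = [seq height T i i | i <- iota (n + 2) n].
Proof.
apply: (@eq_from_nth _ 0%N); first by rewrite !size_map size_rev !size_iota.
move=> i; rewrite size_map size_rev size_iota => lin.
rewrite !(nth_map 0%N) ?size_rev ?size_iota // nth_rev ?size_iota //.
rewrite !nth_iota // ?ltn_subrL ?(leq_ltn_trans _ lin) // /gt_pattern.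
by congr (height T _ _); lia.
Qed.

(* The bound on the pattern makes |lambda(T)| <= binomial(n + 1, 2), so that
   natural number subtraction of these two is not truncated. *)
Lemma gt_pattern_bound n (T : {set box (2 * n + 2)}) (s : nat) :
  is_tsscpp T -> (1 <= s <= n)%N -> (gt_pattern T n s <= s)%N.
Proof.
move=> /and3P[/forallP pp /forallP ts /forallP sc] /andP[s_gt0 sn].
rewrite /gt_pattern /height; set D := [set p in T | _].
have small p : p \in D -> (p.2 < s)%N.
  case: p => [[x y] z]; rewrite inE /= => /and3P[xyzT /eqP ex /eqP ey].
  rewrite ltnNge; apply/negP => sz.
  have /forallP/(_ y)/forallP/(_ z)/eqP := sc x; rewrite xyzT => /esym.
  have /forallP/(_ y)/forallP/(_ z)/and5P[_ _ _ _ /eqP zxy] := ts x.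
  have /forallP/(_ (rev_ord x, rev_ord y, rev_ord z))/implyP := pp (z, x, y).
  rewrite zxy xyzT /= => -> //; move: sn sz ex ey.
  case: x y z {zxy xyzT} => [x xN] [y yN] [z zN] /= sn sz ex ey.
  by apply/and3P; split; lia.
pose f (p : box (2 * n + 2)) : 'I_s.-1.+1 := inord p.2.
have inj : {in D &, injective f}.
  move=> p q pD qD /(congr1 val); have := small p pD; have := small q qD.
  move: pD qD; case: p => -[x y] z; case: q => -[x' y'] z'; rewrite !inE /f /=.
  move=> /and3P[_ /eqP ex /eqP ey] /and3P[_ /eqP ex' /eqP ey'] zs' zs.
  rewrite !inordK ?prednK // => ez.
  by congr (_, _, _); apply: val_inj => /=; lia.
rewrite -(card_in_imset inj) (leq_trans (max_card _)) //.
by rewrite card_ord prednK.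
Qed.

(* Main.v *)
From mathcomp Require Import all_boot all_order all_fingroup all_algebra.
From mathcomp Require Import mpoly.
From mathcomp Require Import zify ring.
Require Import Defs.

Set Implicit Arguments.
Unset Strict Implicit.
Unset Printing Implicit Defensive.

Import Order.TTheory GRing.Theory Num.Theory.
Local Open Scope ring_scope.

(** Put x_i = u X_i, y_i = v / X_i and f(t) = t (t + w).  The products
    x_i y_i = u v are all equal, and both sides of the identity are, up to the
    product of the X_i^(n - 1), the quotient of det (f(x_i)^j - f(y_i)^j) by
    the symplectic Weyl denominator det (x_i^j - y_i^j), where 1 <= j <= n.

    Arrowed monotone triangles.  Once the bottom row k and its arrows are
    chosen, the entry l_i of the row above ranges over an interval from k_i to
    k_(i+1), the arrows of k_i and k_(i+1) telling whether the end points are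
    allowed.  By induction the generating function, times the Vandermonde
    product of the X_i, is the alternating sum over the permutations of the
    X_i of
      prod_i (u X_i + w + v / X_i) X_i^(k_i)
        * prod_(i < j) (v + w X_i + u X_i X_j)
    ([amt_gf_asym]): the sums over the l_i are geometric, and among the
    products of their end points those that use an entry k_j twice cancel in
    the alternating sum.  For k = (0, 2, ..., 2n - 2) multiplication by a
    symmetric product turns the summand into the product over i <= j of the
    f(x_j) - f(y_i), and the alternating sum of prod_(i <= j) (A_j - B_i) is
    det (A_i^j - B_i^j) for all A and B ([asym_det]).

    Symplectic tableaux.  Removing the letters of a tableau one at a time
    leaves chains of partitions that differ by horizontal strips.  The sums
    over these strips telescope inside the columns of a determinant, which
    gives the Weyl character formula whenever all x_i y_i are equal
    ([tab_gf_det]).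

    Plane partitions.  In the determinant of the f(x_i)^j - f(y_i)^j, the
    columns come from the polynomials t^j (t + w)^j.  The factors t + w are
    expanded in n rounds, the r-th of which takes one factor from each of the
    r columns of largest degree.  A term survives if no two of its columns
    agree, that is, if the chosen factors t add a vertical strip to a
    partition; the conjugate partitions are the rows of a Gelfand-Tsetlin
    pattern ([stair_det_gt_step], [gt_sum]).  These patterns are the heights
    of the totally symmetric self-complementary plane partitions over one half
    of one quadrant ([sum_tsscpp]), and the shape reached at the end is
    lambda(T).

    This proves the identity in fields where the Weyl denominator is not zero
    ([amt_tsscpp_field]).  Both sides are Laurent polynomials in the X_i with
    coefficients in Z[u, v, w], so that the field of fractions of
    Z[u, v, w, X_1, ..., X_n] decides for all rings ([laurent_transfer]). *)

(** * Sums and products over ordinals *)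

Lemma big_ord_itv (R : Type) (idx : R) (op : Monoid.law idx) M a b (F : nat -> R) :
    (b <= M)%N ->
  \big[op/idx]_(v < M | (a <= v < b)%N) F v = \big[op/idx]_(a <= v < b) F v.
Proof.
move=> bM; rewrite (big_nat_widen a b M) // big_geq_mkord.
by apply: eq_bigl => v; rewrite andbC.
Qed.

Lemma sum_ord_telescope (V : zmodType) M a b (F : nat -> V) : (a <= b <= M)%N ->
  \sum_(v < M | (a <= v < b)%N) (F v - F v.+1) = F a - F b.
Proof.
move=> /andP[ab bM]; rewrite (big_ord_itv _ _ (fun v => F v - F v.+1)) //.
rewrite -[RHS]opprB -telescope_sumr // -sumrN.
by apply: eq_bigr => v _; rewrite opprB.
Qed.

Lemma prod_ord_eq (R : pzSemiRingType) n (a : nat) (g : R) :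
  \prod_(i < n) (if a == i then g else 1) = if (a < n)%N then g else 1.
Proof.
rewrite -big_mkcond; case: ltnP => an.
  rewrite (big_pred1 (Ordinal an)) // => i; rewrite -val_eqE /= eq_sym //.
by rewrite big_pred0 // => i; rewrite gtn_eqF // (leq_trans _ an).
Qed.

Lemma prod_sign_from (R : pzRingType) n p :
  \prod_(i < n) (if (i < p)%N then 1 else -1 : R) = (-1) ^+ (n - p).
Proof.
elim: n => [|n IHn]; first by rewrite big_ord0 sub0n.
rewrite big_ord_recr /= IHn; case: ltnP => np.
  by rewrite mulr1; congr (_ ^+ _); lia.
by rewrite subSn // exprSr.
Qed.

Lemma prod_if_forall (R : pzSemiRingType) (I : finType) (P : pred I) (F : I -> R) :
  \prod_i (if P i then F i else 0) = if [forall i, P i] then \prod_i F i else 0.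
Proof.
case: ifP => [/forallP PT|/negbT]; first by apply: eq_bigr => i _; rewrite PT.
rewrite negb_forall => /existsP[i nPi].
have : i \in index_enum I by rewrite mem_index_enum.
elim: (index_enum I) => // j s IHs; rewrite inE big_cons => /predU1P[<-|/IHs ->].
  by rewrite (negPf nPi) mul0r.
by rewrite mulr0.
Qed.

Lemma sum_ffun_prod (R : comPzSemiRingType) (I J : finType) (P : I -> pred J)
    (F : I -> J -> R) :
  \sum_(l : {ffun I -> J} | [forall i, P i (l i)]) \prod_i F i (l i)
  = \prod_i \sum_(v | P i v) F i v.
Proof.
under [RHS]eq_bigr do rewrite big_mkcond.
rewrite bigA_distr_bigA /= big_mkcond; apply: eq_bigr => l _.
by rewrite (prod_if_forall (fun i => P i (l i)) (fun i => F i (l i))).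
Qed.

Lemma card_ord_lt n m : (m <= n)%N -> #|[pred j : 'I_n | (j < m)%N]| = m.
Proof.
move=> mn; rewrite -sum1_card (big_ord_itv _ 0 (fun=> 1%N) mn).
by rewrite sum_nat_const_nat muln1 subn0.
Qed.

Lemma downset_ord n (P : pred 'I_n) :
  (forall i j : 'I_n, (i <= j)%N -> P j -> P i) ->
  forall i : 'I_n, P i = (i < #|P|)%N.
Proof.
move=> down.
pose Q m := (n <= m)%N || [exists i : 'I_n, (i == m :> nat) && ~~ P i].
have exQ : exists m, Q m by exists n; rewrite /Q leqnn.
case: (ex_minnP exQ) => m Qm minm.
have mn : (m <= n)%N by apply: minm; rewrite /Q leqnn.
have PE i : P i = (i < m)%N.
  case: ltnP => [im|mi].
    apply: contraLR im => nPi; rewrite -leqNgt minm // /Q; apply/orP; right.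
    by apply/existsP; exists i; rewrite eqxx.
  move: Qm; rewrite /Q leqNgt (leq_ltn_trans mi (ltn_ord i)) /=.
  case/existsP => j /andP[/eqP jm nPj]; apply/negbTE; apply: contra nPj.
  by apply: down; rewrite jm.
by move=> i; rewrite PE; congr (_ < _)%N; rewrite (eq_card PE) card_ord_lt.
Qed.

Lemma ord_homo_adjacent n (R : rel nat) (f : 'I_n -> nat) : reflexive R -> transitive R ->
    (forall i j : 'I_n, j = i.+1 :> nat -> R (f i) (f j)) ->
  forall i j : 'I_n, (i <= j)%N -> R (f i) (f j).
Proof.
move=> Rr Rt adj i j; have [d] := ubnP (j - i); elim: d j => // d IHd j.
move=> jid; rewrite leq_eqVlt => /orP[/eqP/val_inj -> //|ij].
have pn : (j.-1 < n)%N by apply: leq_ltn_trans (leq_pred j) _.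
apply: Rt (adj (Ordinal pn) j _); last by rewrite /= prednK // (leq_ltn_trans _ ij).
by apply: IHd => /=; lia.
Qed.

Lemma card_rev_ord n (P : pred 'I_n) : #|[pred s | P (rev_ord s)]| = #|P|.
Proof.
by rewrite -!sum1_card [RHS](reindex_inj rev_ord_inj); apply: eq_bigl => s; rewrite !inE.
Qed.

Section Pairs.
Variables (R : comPzRingType) (n : nat).
Implicit Type F : 'I_n -> 'I_n -> R.

Definition pairprod F := \prod_(p : 'I_n * 'I_n | (p.1 < p.2)%N) F p.1 p.2.

Lemma pairprodE F : pairprod F = \prod_(j < n) \prod_(i < n | (i < j)%N) F i j.
Proof.
rewrite (exchange_big_dep xpredT) //=.
by rewrite /pairprod -(pair_big_dep xpredT (fun a b : 'I_n => (a < b)%N) F).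
Qed.

Lemma pairprod_le F :
  \prod_(j < n) \prod_(i < n | (i <= j)%N) F i j = (\prod_i F i i) * pairprod F.
Proof.
rewrite pairprodE -big_split; apply: eq_bigr => j _ /=.
rewrite (bigD1 j) //=; congr (_ * _); apply: eq_bigl => i.
by rewrite ltn_neqAle andbC.
Qed.

Lemma pairprodM F G : pairprod (fun i j => F i j * G i j) = pairprod F * pairprod G.
Proof. exact: big_split. Qed.

Lemma pairprod_snd (Y : 'I_n -> R) : pairprod (fun _ j => Y j) = \prod_j Y j ^+ j.
Proof.
rewrite pairprodE; apply: eq_bigr => j _; rewrite prodr_const; congr (_ ^+ _).
by apply: card_ord_lt; apply: ltnW.
Qed.

Lemma pairprod_fst (Y : 'I_n -> R) : pairprod (fun i _ => Y i) = \prod_i Y i ^+ (n.-1 - i).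
Proof.
rewrite /pairprod -(pair_big_dep xpredT (fun a b : 'I_n => (a < b)%N) (fun a _ => Y a)) /=.
apply: eq_bigr => i _; rewrite prodr_const; congr (_ ^+ _).
have := cardC [pred j : 'I_n | (j < i.+1)%N]; rewrite card_ord_lt // card_ord => e.
apply: (@addnI i.+1); transitivity n; last by have := ltn_ord i; lia.
apply: etrans e; congr (_ + _)%N.
by apply: eq_card => j; rewrite !inE /= -leqNgt.
Qed.

(** A permutation of the indices permutes the unordered pairs. *)
Lemma pairprod_sym F (s : 'S_n) : (forall i j, F i j = F j i) ->
  pairprod (fun i j => F (s i) (s j)) = pairprod F.
Proof.
move=> symF.
pose h (t : 'S_n) (p : 'I_n * 'I_n) :=
  if (t p.1 < t p.2)%N then (t p.1, t p.2) else (t p.2, t p.1).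
have hlt t p : p.1 != p.2 -> ((h t p).1 < (h t p).2)%N.
  move=> np; rewrite /h; case: (ltngtP (t p.1) (t p.2)) => //= /val_inj/perm_inj e.
  by rewrite e eqxx in np.
have ltne (p : 'I_n * 'I_n) : (p.1 < p.2)%N -> p.1 != p.2.
  by move=> lt; rewrite -val_eqE ltn_eqF.
have hK t (p : 'I_n * 'I_n) : (p.1 < p.2)%N -> h t^-1%g (h t p) = p.
  case: p => a b /= ab; rewrite /h /=; case: (ltnP (t a) (t b)) => _ /=; rewrite !permK.
    by rewrite ab.
  by rewrite ltnNge (ltnW ab).
rewrite [RHS]/pairprod (reindex_onto (h s) (h s^-1%g)) => [|p lt]; last first.
  by rewrite -{1}[s]invgK hK.
apply: eq_big => [p|p _]; last by rewrite /h; case: ifP.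
apply/idP/andP => [lt|[]]; first by rewrite hlt ?ltne // hK.
case: (ltngtP p.1 p.2) => // [lt _ /eqP e|/val_inj e].
  have : ((h s^-1%g (h s p)).1 < (h s^-1%g (h s p)).2)%N.
    by apply/hlt/ltne/hlt; rewrite eq_sym -val_eqE ltn_eqF.
  by rewrite e ltnNge ltnW.
by rewrite /h e ltnn /= ltnn.
Qed.

End Pairs.

(** * Antisymmetrisation and determinants *)

Lemma sum_lift_perm (V : nmodType) n (i0 : 'I_n.+1) (F : 'S_n.+1 -> V) :
  \sum_(s : 'S_n.+1) F s = \sum_j \sum_(s : 'S_n) F (lift_perm i0 j s).
Proof.
pose h (p : 'I_n.+1 * 'S_n) := lift_perm i0 p.1 p.2.
have injh : injective h.
  move=> [j s] [j' s'] /permP eqh.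
  have /= := eqh i0; rewrite !lift_perm_id /= => ej; subst j'; congr (_, _).
  apply/permP => k; have /= := eqh (lift i0 k).
  by rewrite !lift_perm_lift => /lift_inj.
have bijh : bijective h.
  by apply: inj_card_bij => //; rewrite card_prod card_ord !card_Sn factS.
rewrite (reindex h) /=; last exact: onW_bij.
by rewrite pair_bigA.
Qed.

Lemma sum_lift_perm_to (V : nmodType) n (j0 : 'I_n.+1) (F : 'S_n.+1 -> V) :
  \sum_(s : 'S_n.+1) F s = \sum_i \sum_(s : 'S_n) F (lift_perm i j0 s).
Proof.
rewrite (reindex_inj invg_inj) (sum_lift_perm j0) /=.
apply: eq_bigr => i _; rewrite (reindex_inj invg_inj) /=.
by apply: eq_bigr => s _; rewrite lift_permV invgK.
Qed.

(** The terms of [s] and [tperm i j * s] cancel. *)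
Lemma asym_swap_eq0 (R : pzRingType) (T : Type) n (i j : 'I_n)
    (F : ('I_n -> T) -> R) (Y : 'I_n -> T) :
    i != j -> (forall Z Z', Z' =1 Z \o tperm i j -> F Z' = F Z) ->
  \sum_(s : 'S_n) (-1) ^+ s * F (Y \o s) = 0.
Proof.
move=> nij Fsym; pose t := tperm i j.
have oddMt s : (t * s)%g = ~~ s :> bool by rewrite odd_permM odd_tperm nij.
rewrite (bigID (@odd_perm _)) /=.
apply: canLR (subrK _) _; rewrite add0r -sumrN.
rewrite (reindex_inj (mulgI t)); apply: eq_big => //= s.
rewrite oddMt => /negPf->; rewrite mulN1r mul1r; congr (- _).
by apply: Fsym => a /=; rewrite permM.
Qed.

(** Sort the sum by the value m of s at the last index.  The factors for the last
    j are p(A m), where p(t) is the product of all t - B k.  As p is monic and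
    p(B m) = 0, column operations replace the last column of the matrix by
    p(A m) - p(B m) = p(A m), and Laplace expansion along it is the same sum. *)
Lemma asym_det (R : comNzRingType) n (A B : 'I_n -> R) :
  \sum_(s : 'S_n) (-1) ^+ s
     * \prod_(j < n) \prod_(i < n | (i <= j)%N) (A (s j) - B (s i))
  = \det (\matrix_(i, j) (A i ^+ j.+1 - B i ^+ j.+1)).
Proof.
elim: n => [|n IHn] in A B *.
  rewrite det_mx00 (big_pred1 1%g) => [|s]; last first.
    by apply/esym/eqP/permP => -[].
  by rewrite odd_perm1 big_ord0 mulr1.
rewrite (sum_lift_perm ord_max).
set M := \matrix_(i, j) _.
transitivity (\sum_m cofactor M m ord_max * \prod_k (A m - B k)).
  apply: eq_bigr => m _; rewrite /cofactor.
  have -> : row' m (col' ord_max M)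
     = \matrix_(i, j) (A (lift m i) ^+ j.+1 - B (lift m i) ^+ j.+1).
    by apply/matrixP => i j; rewrite !mxE lift_max.
  rewrite -(IHn (A \o lift m) (B \o lift m)) mulr_sumr mulr_suml.
  apply: eq_bigr => s _.
  rewrite big_ord_recr /= lift_perm_id odd_lift_perm /= !signr_addb !signr_odd.
  rewrite exprD.
  have -> : \prod_(i < n.+1 | (i <= n)%N) (A m - B (lift_perm ord_max m s i))
      = \prod_k (A m - B k).
    rewrite [RHS](reindex_perm (lift_perm ord_max m s)) /=.
    by apply: eq_bigl => i; rewrite -ltnS ltn_ord.
  rewrite !mulrA; congr (_ * _); rewrite [(-1) ^+ n * _]mulrC; congr (_ * _).
  apply: eq_bigr => j _; rewrite big_mkcond big_ord_recr /= leqNgt ltn_ord /=.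
  rewrite mulr1 -big_mkcond; apply: eq_bigr => i _.
  have wl k : widen_ord (leqnSn n) k = lift ord_max k.
    by apply: val_inj; rewrite /= /bump leqNgt ltn_ord.
  by rewrite !wl !lift_perm_lift.
pose p : {poly R} := \prod_k ('X - (B k)%:P).
have sp : size p = n.+2 by rewrite size_prod_XsubC /index_enum -enumT size_enum_ord.
have monp : p \is monic by apply: monic_prod_XsubC.
have pE x : p.[x] = \prod_k (x - B k).
  by rewrite horner_prod; apply: eq_bigr => k _; rewrite !hornerE.
transitivity (\sum_m cofactor M m ord_max * (p.[A m] - p.[B m])).
  apply: eq_bigr => m _; rewrite -pE; congr (_ * _).
  by rewrite [p.[B m]]pE (bigD1 m) //= subrr mul0r subr0.
have adjE j : \sum_m cofactor M m ord_max * M m j = \det M *+ (ord_max == j).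
  have /matrixP/(_ ord_max j) := mul_adj_mx M; rewrite !mxE => <-.
  by apply: eq_bigr => m _; rewrite [(\adj M) _ _]mxE.
under eq_bigr do rewrite !horner_coef sp -sumrB mulr_sumr.
rewrite exchange_big /= big_ord_recl big1 ?add0r => [|m _]; last first.
  by rewrite !expr0 subrr mulr0.
rewrite (bigD1 ord_max) //= [X in _ + X]big1 ?addr0 => [|j nj].
  transitivity (\sum_m cofactor M m ord_max * M m ord_max).
    apply: eq_bigr => m _; rewrite !mxE -mulrBr; congr (_ * _).
    have -> : p`_(bump 0 n) = 1 by move/monicP: monp; rewrite lead_coefE sp.
    by rewrite mul1r.
  by rewrite adjE eqxx.
transitivity (p`_(lift ord0 j) * \sum_m cofactor M m ord_max * M m j).
  rewrite mulr_sumr; apply: eq_bigr => m _; rewrite !mxE -mulrBr.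
  by rewrite mulrCA.
by rewrite adjE eq_sym (negPf nj) mulr0.
Qed.

(** Multilinearity in the columns, with a separate sum in each. *)
Lemma sum_det_cols (R : comPzRingType) m (J : finType) (P : 'I_m -> pred J)
    (g : 'I_m -> J -> R) (F : 'I_m -> 'I_m -> J -> R) :
  \sum_(mu : {ffun 'I_m -> J} | [forall j, P j (mu j)])
     (\prod_j g j (mu j)) * \det (\matrix_(i, j) F i j (mu j))
  = \det (\matrix_(i, j) \sum_(v | P j v) g j v * F i j v).
Proof.
have detE (M : 'M[R]_m) : \det M = \sum_(s : 'S_m) (-1) ^+ s * \prod_j M (s j) j.
  by rewrite -det_tr; apply: eq_bigr => s _; under eq_bigr do rewrite mxE.
rewrite detE; under eq_bigr do rewrite detE mulr_sumr.
rewrite exchange_big /=; apply: eq_bigr => s _.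
under [X in _ = _ * X]eq_bigr do rewrite mxE.
rewrite -sum_ffun_prod mulr_sumr; apply: eq_bigr => mu _.
rewrite big_split /= mulrCA; congr (_ * (_ * _)).
by apply: eq_bigr => j _; rewrite mxE.
Qed.

Lemma det_scale_cols (R : comPzRingType) m (g : 'I_m -> R) (F : 'I_m -> 'I_m -> R) :
  \det (\matrix_(i, j) (g j * F i j)) = (\prod_j g j) * \det (\matrix_(i, j) F i j).
Proof.
have := @sum_det_cols R m unit (fun _ _ => true) (fun j _ => g j) (fun i j _ => F i j).
under [X in _ = \det X -> _]eq_mx do rewrite big_const card_unit /= addr0.
move=> <-; rewrite (big_pred1 [ffun=> tt]) // => mu.
apply/forallP/eqP => // _; apply/ffunP => j; by rewrite ffunE; case: (mu j).
Qed.

Lemma det_scale_rows (R : comPzRingType) m (g : 'I_m -> R) (F : 'I_m -> 'I_m -> R) :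
  \det (\matrix_(i, j) (g i * F i j)) = (\prod_j g j) * \det (\matrix_(i, j) F i j).
Proof.
rewrite -det_tr -[X in _ = _ * X]det_tr.
transitivity (\det (\matrix_(i, j) (g j * F j i))).
  by congr (\det _); apply/matrixP => i j; rewrite !mxE.
rewrite (det_scale_cols g (fun i j => F j i)); congr (_ * \det _).
by apply/matrixP => i j; rewrite !mxE.
Qed.

(** Subtracting from every column the next one is multiplication by a
    unitriangular matrix. *)
Lemma det_diff_cols (R : comPzRingType) k (F : 'I_k -> nat -> R) :
    (forall i, F i k = 0) ->
  \det (\matrix_(i < k, j < k) (F i j - F i j.+1)) = \det (\matrix_(i < k, j < k) F i j).
Proof.
move=> Fk0.
pose T : 'M[R]_k := \matrix_(a, b) ((a == b :> nat)%:R - (a == b.+1 :> nat)%:R).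
have detT : \det T = 1.
  rewrite det_trig; last first.
    by apply/is_trig_mxP => a b ab; rewrite mxE !ltn_eqF ?subr0 // ltnW // ltnS.
  by apply: big1 => a _; rewrite mxE eqxx ltn_eqF ?subr0.
rewrite -[RHS]mulr1 -detT -det_mulmx; congr (\det _).
apply/matrixP => i b; rewrite !mxE.
under eq_bigr do rewrite !mxE mulrBr.
rewrite sumrB; congr (_ - _).
  rewrite (bigD1 b) //= eqxx mulr1 big1 ?addr0 // => a ab.
  by rewrite (negPf ab : (a == b :> nat) = false) mulr0.
have [ltb|geb] := ltnP b.+1 k.
  rewrite (bigD1 (Ordinal ltb)) //= eqxx mulr1 big1 ?addr0 // => a ab.
  by rewrite (negPf ab : (a == b.+1 :> nat) = false) mulr0.
have -> : b.+1 = k by apply/eqP; rewrite eqn_leq geb andbT.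
by rewrite Fk0 big1 // => a _; rewrite ltn_eqF // mulr0.
Qed.

(** Differences of neighbouring columns turn the row of ones into the last unit
    vector, and Laplace expansion along it leaves the smaller determinant. *)
Lemma det_diff_cols_bordered (R : comPzRingType) m (C : 'I_m -> nat -> R) :
  \det (\matrix_(i < m, j < m) (C i j - C i j.+1))
  = \det (\matrix_(i < m.+1, j < m.+1) (if unlift ord_max i is Some i' then C i' j else 1)).
Proof.
pose F (i : 'I_m.+1) (j : nat) := if (j <= m)%N then
  if unlift ord_max i is Some i' then C i' j else 1 else 0.
have := @det_diff_cols _ m.+1 F; rewrite {1}/F ltnn => /(_ (fun=> erefl)).
have -> : \matrix_(i < m.+1, j < m.+1) F i j
   = \matrix_(i < m.+1, j < m.+1) (if unlift ord_max i is Some i' then C i' j else 1).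
  by apply/matrixP => i j; rewrite !mxE /F -ltnS ltn_ord.
move=> <-; rewrite (expand_det_row _ ord_max) (bigD1 ord_max) //= big1 ?addr0; last first.
  move=> j nj; rewrite mxE /F unlift_none.
  have -> : (j < m)%N by rewrite ltn_neqAle nj -ltnS ltn_ord.
  by rewrite -ltnS ltn_ord subrr mul0r.
rewrite mxE /F unlift_none leqnn ltnn subr0 mul1r /cofactor -signr_odd addnn odd_double mul1r.
congr (\det _); apply/matrixP => i j; rewrite !mxE liftK.
have jE : lift ord_max j = j :> nat by rewrite /= /bump leqNgt ltn_ord.
by rewrite !jE ltn_ord ltnW.
Qed.

(** Reversing n + 1 letters moves the first one past the n others, which are
    reversed as well. *)
Lemma sign_rev_perm (R : comPzRingType) n :
  (-1) ^+ perm (@rev_ord_inj n) = \prod_(j < n) (-1) ^+ j :> R.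
Proof.
elim: n => [|n IHn].
  have -> : perm (@rev_ord_inj 0) = 1%g by apply/permP => -[].
  by rewrite odd_perm1 big_ord0.
have -> : perm (@rev_ord_inj n.+1) = lift_perm ord0 ord_max (perm (@rev_ord_inj n)).
  apply/permP => i; rewrite permE; case: (unliftP ord0 i) => [k|] ->.
    rewrite lift_perm_lift permE; apply: val_inj => /=.
    by rewrite /bump [(n <= _)%N]leqNgt; have := ltn_ord k; case: ltnP; lia.
  by rewrite lift_perm_id; apply: val_inj; rewrite /= subn1.
rewrite odd_lift_perm big_ord_recr /= -IHn signr_addb signr_odd.
by rewrite mulrC.
Qed.

Lemma det_rev_cols (R : comPzRingType) n (F : 'I_n -> nat -> R) :
  \det (\matrix_(i, j) F i (n - j.+1)%N)
  = (\prod_(j < n) (-1) ^+ j) * \det (\matrix_(i < n, j < n) F i j).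
Proof.
have -> : \matrix_(i, j) F i (n - j.+1)%N
    = col_perm (perm (@rev_ord_inj n)) (\matrix_(i < n, j < n) F i j).
  by apply/matrixP => i j; rewrite !mxE permE.
by rewrite col_permE det_mulmx det_perm odd_permV sign_rev_perm mulrC.
Qed.

(** * Triangular arrays *)

Section Tri.

Definition tpos n (i : 'I_n) (j : 'I_i.+1) : tri n :=
  Tagged (fun i : 'I_n => 'I_i.+1) j.

Definition tup n (p : tri n) : tri n.+1 :=
  @tpos n.+1 (widen_ord (leqnSn n) (tag p)) (tagged p).

Definition tbot n (j : 'I_n.+1) : tri n.+1 := @tpos n.+1 ord_max j.

Definition tsplit n (p : tri n.+1) : tri n + 'I_n.+1 :=
  if insub (trow p) : option 'I_n is Some i then inl (tpos (inord (tcol p) : 'I_i.+1))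
  else inr (inord (tcol p)).

Definition tjoin n (s : tri n + 'I_n.+1) : tri n.+1 :=
  match s with inl p => tup p | inr j => tbot j end.

Lemma tri_inj n (p q : tri n) : trow p = trow q -> tcol p = tcol q -> p = q.
Proof.
case: p q => [i j] [i' j']; rewrite /trow /tcol /= => /val_inj ei; subst i'.
by move=> /val_inj ->.
Qed.

Lemma trow_lt n (p : tri n) : (trow p < n)%N. Proof. exact: ltn_ord. Qed.

Lemma tcol_le n (p : tri n) : (tcol p <= trow p)%N.
Proof. by rewrite -ltnS; exact: ltn_ord. Qed.

Lemma tsplitK n : cancel (@tsplit n) (@tjoin n).
Proof.
move=> p; rewrite /tsplit; have cr := tcol_le p; case: insubP => [i _ ei|].
  by apply: tri_inj => //; rewrite /tcol /= inordK // ltnS ei.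
rewrite -leqNgt => lenp.
have rp : trow p = n by apply/eqP; rewrite eqn_leq lenp -ltnS trow_lt.
apply: tri_inj; first by rewrite rp.
by rewrite /tcol /= inordK // ltnS; exact: leq_trans cr (eq_leq rp).
Qed.

Lemma tjoinK n : cancel (@tjoin n) (@tsplit n).
Proof.
case=> [p|j]; rewrite /tsplit.
  case: insubP => [i _ ei|/negP[]]; last exact: (trow_lt p).
  congr inl; apply: tri_inj; first exact: ei.
  by rewrite /tcol /= inordK // -ltnS ltnS ei /=.
case: insubP => [i|_]; first by rewrite ltnn.
by congr inr; apply: val_inj; rewrite /= inordK // ltn_ord.
Qed.

Lemma tri_ind n (P : tri n.+1 -> Prop) :
  (forall p, P (tup p)) -> (forall j, P (tbot j)) -> forall p, P p.
Proof. by move=> Pup Pbot p; rewrite -(tsplitK p); case: (tsplit p). Qed.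

Lemma big_tri (R : Type) (idx : R) (op : Monoid.com_law idx) n (F : tri n.+1 -> R) :
  \big[op/idx]_p F p
  = op (\big[op/idx]_(p : tri n) F (tup p)) (\big[op/idx]_(j : 'I_n.+1) F (tbot j)).
Proof.
rewrite (reindex (@tjoin n)) /=; last first.
  by exists (@tsplit n) => ? _; [exact: tjoinK | exact: tsplitK].
by rewrite big_sumType.
Qed.
Variable S : finType.

Definition trijoin n (c : {ffun tri n -> S}) (b : {ffun 'I_n.+1 -> S}) :
    {ffun tri n.+1 -> S} :=
  [ffun p => match tsplit p with inl p' => c p' | inr j => b j end].

Lemma trijoin_up n c b (p : tri n) : trijoin c b (tup p) = c p.
Proof. by rewrite ffunE -[tup p]/(tjoin (inl p)) tjoinK. Qed.

Lemma trijoin_bot n (c : {ffun tri n -> S}) b (j : 'I_n.+1) : trijoin c b (tbot j) = b j.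
Proof. by rewrite ffunE -[tbot j]/(tjoin (inr j)) tjoinK. Qed.

(** All recursions on the number of rows start from this splitting. *)
Lemma sum_trijoin (V : nmodType) n (F : {ffun tri n.+1 -> S} -> V) :
  \sum_c F c = \sum_(c : {ffun tri n -> S}) \sum_(b : {ffun 'I_n.+1 -> S}) F (trijoin c b).
Proof.
rewrite pair_bigA (reindex (fun p => trijoin p.1 p.2)) //=.
exists (fun c => ([ffun p => c (tup p)], [ffun j => c (tbot j)])) => [[c b] _|c _] /=.
  by congr (_, _); apply/ffunP => ?; rewrite ffunE ?trijoin_up ?trijoin_bot.
by apply/ffunP; elim/tri_ind => ?; rewrite ?trijoin_up ?trijoin_bot ffunE.
Qed.

Definition tlast n : 'I_n -> tri n :=
  match n return 'I_n -> tri n with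
  | 0 => fun i => match notF (ltn_ord i) return tri 0 with end
  | _.+1 => @tbot _ end.

Lemma trow_tlast n (i : 'I_n) : trow (tlast i) = n.-1.
Proof. by case: n i => [[]|]. Qed.

Lemma tcol_tlast n (i : 'I_n) : tcol (tlast i) = i.
Proof. by case: n i => [[]|]. Qed.

Lemma tlastP n (p : tri n) : (trow p).+1 = n -> exists i, p = tlast i.
Proof.
move=> rp; have lt : (tcol p < n)%N by apply: leq_ltn_trans (tcol_le p) _; exact: trow_lt.
exists (Ordinal lt); apply: tri_inj; first by rewrite trow_tlast -{2}rp.
by rewrite tcol_tlast.
Qed.

Lemma big_tlast (R : Type) (idx : R) (op : Monoid.com_law idx) n (F : tri n -> R) :
  \big[op/idx]_(p | (trow p).+1 == n) F p = \big[op/idx]_(i < n) F (tlast i).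
Proof.
case: n F => [|n] F; first by rewrite !big1 // => -[[]] // [].
rewrite big_mkcond big_tri /= big1 ?Monoid.mul1m => [|p _].
  by apply: eq_bigr => i _; rewrite eqxx.
by rewrite eqSS ltn_eqF // (trow_lt p).
Qed.

End Tri.

Lemma tri_ex n i j : (j <= i < n)%N -> exists p : tri n, trow p = i /\ tcol p = j.
Proof.
move=> /andP[ji ilt]; rewrite -ltnS in ji.
by exists (@tpos n (Ordinal ilt) (Ordinal ji)).
Qed.

Lemma ne_of_bot n (i : 'I_n) : ne_of (tbot (lift ord_max i)) (tup (tlast i)).
Proof.
rewrite /ne_of /= -[trow (tup _)]/(trow (tlast i)) -[tcol (tup _)]/(tcol (tlast i)).
rewrite trow_tlast tcol_tlast /trow /tcol /= /bump leqNgt ltn_ord add0n eqxx andbT.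
by rewrite prednK // (leq_ltn_trans _ (ltn_ord i)).
Qed.

Lemma nw_of_bot n (i : 'I_n) : nw_of (tbot (lift ord0 i)) (tup (tlast i)).
Proof.
rewrite /nw_of /= -[trow (tup _)]/(trow (tlast i)) -[tcol (tup _)]/(tcol (tlast i)).
rewrite trow_tlast tcol_tlast /trow /tcol /= /bump add1n eqxx andbT.
by rewrite prednK // (leq_ltn_trans _ (ltn_ord i)).
Qed.

Lemma ne_of_last n (q p : tri n.+1) : trow q = n -> ne_of q p ->
  exists i : 'I_n, q = tbot (lift ord_max i) /\ p = tup (tlast i).
Proof.
elim/tri_ind: q => q; first by move=> e; have := trow_lt q; rewrite -{2}e ltnn.
move=> _ /andP[/eqP rp /eqP cp]; elim/tri_ind: p rp cp => p rp cp; last first.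
  by have := leqnn n; rewrite -{1}[n]/(trow (tbot q)) rp ltnn.
have [i pi] := tlastP (esym rp : (trow p).+1 = n); exists i; split; last by rewrite pi.
congr tbot; apply: val_inj; rewrite /= /bump leqNgt ltn_ord add0n -(tcol_tlast i) -pi;
  exact: cp.
Qed.

Lemma nw_of_last n (q p : tri n.+1) : trow q = n -> nw_of q p ->
  exists i : 'I_n, q = tbot (lift ord0 i) /\ p = tup (tlast i).
Proof.
elim/tri_ind: q => q; first by move=> e; have := trow_lt q; rewrite -{2}e ltnn.
move=> _ /andP[/eqP rp /eqP cp]; elim/tri_ind: p rp cp => p rp cp; last first.
  by have := leqnn n; rewrite -{1}[n]/(trow (tbot q)) rp ltnn.
have [i pi] := tlastP (esym rp : (trow p).+1 = n); exists i; split; last by rewrite pi.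
congr tbot; apply: val_inj; rewrite /= /bump add1n -(tcol_tlast i) -pi; exact: cp.
Qed.

(** * Alternating sums with one more variable *)

Lemma sum_arrow (V : nmodType) (F : arrow -> V) :
  \sum_a F a = F NW + F NE + F NWNE.
Proof.
rewrite (reindex arrow_decode) /=; last first.
  exists arrow_code => [i _|a _]; last exact: arrow_codeK.
  by apply: val_inj; case: i => -[|[|[]]] //= i; rewrite /arrow_decode /= inordK.
by rewrite !big_ord_recl big_ord0 /= addr0 addrA.
Qed.

Lemma arrow_eqE : (((NW == NE) = false) * ((NE == NW) = false)
  * ((NWNE == NE) = false) * ((NWNE == NW) = false) * ((NW == NWNE) = false)
  * ((NE == NWNE) = false))%type.
Proof. by do !split; apply/eqP. Qed.

(** A sequence of booleans that never passes from false to true is true up to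
    some p and false from there on. *)
Lemma sum_threshold_choices (V : nmodType) n (F : {ffun 'I_n -> bool} -> V) :
  (forall (c : {ffun 'I_n -> bool}) (i j : 'I_n), j = i.+1 :> nat -> ~~ c i -> c j -> F c =
    0) ->
  \sum_c F c = \sum_(p : 'I_n.+1) F [ffun i : 'I_n => (i < p)%N].
Proof.
move=> F0.
pose cp (p : 'I_n.+1) := [ffun i : 'I_n => (i < p)%N].
have cpI : injective cp.
  move=> p p' /ffunP ecp; apply: val_inj; apply/eqP; rewrite eqn_leq.
  apply/andP; split; rewrite leqNgt; apply/negP => ltp.
    have ltn : (p' < n)%N by rewrite (leq_trans ltp) // -ltnS ltn_ord.
    by have := ecp (Ordinal ltn); rewrite !ffunE /= ltp ltnn.
  have ltn : (p < n)%N by rewrite (leq_trans ltp) // -ltnS ltn_ord.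
  by have := ecp (Ordinal ltn); rewrite !ffunE /= ltp ltnn.
rewrite (bigID (mem (codom cp))) /= [X in _ + X]big1 ?addr0 => [|c ncp].
  rewrite -big_uniq /= ?(map_inj_uniq cpI) ?enum_uniq //.
  by rewrite big_map big_enum.
have [/existsP[i /existsP[j /and3P[/eqP ij ci cj]]]|nex] :=
    boolP [exists i : 'I_n, [exists j : 'I_n, [&& j == i.+1 :> nat, ~~ c i & c j]]].
  exact: F0 ij ci cj.
have down (i j : 'I_n) : (i <= j)%N -> c j -> c i.
  suff le : (i <= j)%N -> (c j <= c i)%N by move=> /le; case: (c j); case: (c i).
  apply: (@ord_homo_adjacent n geq (fun i => c i : nat)) => [a|a b d ba db|a b ab].
  - exact: leqnn.
  - exact: leq_trans db ba.
  case ca: (c a); first exact: leq_b1.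
  case cb: (c b) => //; case/existsP: nex; exists a; apply/existsP; exists b.
  by rewrite ab eqxx ca cb.
have cn : (#|[pred i | c i]| < n.+1)%N by rewrite ltnS -[X in (_ <= X)%N]card_ord max_card.
case/negP: ncp; apply/codomP; exists (Ordinal cn).
by apply/ffunP => i; rewrite ffunE /= -(downset_ord (P := [pred i | c i]) down).
Qed.

Section Kernel.
Variables (K : fieldType) (u v w : K).

Definition diag_factor (a : K) := u * a + w + v / a.

Definition pair_factor (a b : K) := v + w * a + u * a * b.

(** The alternating sum of this function times the monomial of exponents k will
    be the generating function of arrowed monotone triangles with bottom row k,
    times a Vandermonde product.  The diagonal factor is the total weight of
    the three arrows of a single entry. *)
Definition kernel n (Y : 'I_n -> K) :=
  (\prod_i diag_factor (Y i)) * \prod_(p : 'I_n * 'I_n | (p.1 < p.2)%N) pair_factor (Y p.1)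
    (Y p.2).

Lemma eq_kernel n (Y Z : 'I_n -> K) : Y =1 Z -> kernel Y = kernel Z.
Proof.
move=> e; congr (_ * _); apply: eq_bigr => i _; by rewrite !e.
Qed.

(** The exchange of i and j permutes all factors but the one at (i, j), and
    mirrors that one. *)
Lemma kernel_swap n (i j : 'I_n) (Y Z : 'I_n -> K) : j = i.+1 :> nat ->
    Z =1 Y \o tperm i j ->
  kernel Z * pair_factor (Z j) (Z i) = kernel Y * pair_factor (Y j) (Y i).
Proof.
move=> eji eZ; rewrite /kernel -!mulrA; congr (_ * _).
  rewrite (reindex_perm (tperm i j)) /=; apply: eq_bigr => a _.
  by rewrite eZ /= tpermK.
have ltij : (i < j)%N by rewrite eji.
rewrite (bigD1 (i, j)) //= [in RHS](bigD1 (i, j)) //= !eZ /= tpermL tpermR.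
rewrite mulrAC [RHS]mulrAC; congr (_ * _); first exact: mulrC.
pose h (p : 'I_n * 'I_n) := (tperm i j p.1, tperm i j p.2).
rewrite (reindex_inj (h := h)) /=; last first.
  by move=> [a b] [c d] [/perm_inj-> /perm_inj->].
apply: eq_big => -[a b] /=; last by rewrite !eZ /= !tpermK.
rewrite /h !xpair_eqE.
rewrite -!val_eqE /=.
case: (tpermP i j a) => [->|->|/eqP + /eqP];
  case: (tpermP i j b) => [->|->|/eqP + /eqP]; rewrite -?val_eqE /=; lia.
Qed.

End Kernel.

Section Insertion.
Variables (K : fieldType) (u v w : K).

Definition arrow_weight (x : K) (a : arrow) : K :=
  match a with NW => v / x | NE => u * x | NWNE => w end.

Definition insert_at (T : Type) n (p : 'I_n.+1) (x : T) (Y : 'I_n -> T) (j : 'I_n.+1) :=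
  if unlift p j is Some i then Y i else x.

(** In the pairs with Y i, the inserted variable comes second for i < p and
    first for p <= i. *)
Lemma kernel_insert n (p : 'I_n.+1) x (Y : 'I_n -> K) :
  kernel u v w (insert_at p x Y) =
    diag_factor u v w x * kernel u v w Y
    * \prod_(i < n) (if (i < p)%N then pair_factor u v w (Y i) x else pair_factor u v w x
      (Y i)).
Proof.
have Yp : insert_at p x Y p = x by rewrite /insert_at unlift_none.
have Yl i : insert_at p x Y (lift p i) = Y i by rewrite /insert_at liftK.
rewrite /kernel (bigD1_ord p) //= Yp -!mulrA; congr (_ * _).
under eq_bigr do rewrite Yl.
congr (_ * _).
rewrite -(pair_big_dep xpredT (fun a b : 'I_n.+1 => (a < b)%N)
  (fun a b => pair_factor u v w (insert_at p x Y a) (insert_at p x Y b))) /=.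
rewrite (bigD1_ord p) //= big_mkcond (bigD1_ord p) //= ltnn mul1r.
rewrite -(pair_big_dep xpredT (fun a b : 'I_n => (a < b)%N)
  (fun a b => pair_factor u v w (Y a) (Y b))) /= mulrC [RHS]mulrC.
have -> : \prod_(i < n) \prod_(b < n.+1 | (lift p i < b)%N)
     pair_factor u v w (insert_at p x Y (lift p i)) (insert_at p x Y b)
  = \prod_(i < n) ((if (i < p)%N then pair_factor u v w (Y i) x else 1)
     * \prod_(b < n | (i < b)%N) pair_factor u v w (Y i) (Y b)).
  apply: eq_bigr => i _; rewrite big_mkcond (bigD1_ord p) //= Yp Yl.
  congr (_ * _).
    by have -> : (bump p i < p)%N = (i < p)%N by rewrite /bump; case: leqP; lia.
  rewrite [RHS]big_mkcond; apply: eq_bigr => b _; rewrite Yl.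
  by have -> : (bump p i < bump p b)%N = (i < b)%N by rewrite /bump; do 2 case: leqP; lia.
rewrite big_split /= mulrAC; congr (_ * _).
rewrite -big_split; apply: eq_bigr => i _ /=; rewrite Yp Yl.
have -> : (p < bump p i)%N = (p <= i)%N by rewrite /bump; case: leqP; lia.
by case: ltnP => _; rewrite ?mulr1 ?mul1r.
Qed.

End Insertion.

Section Step.
Variables (K : fieldType) (u v w : K).

Definition kernel_mon n (k : 'I_n -> nat) (Y : 'I_n -> K) :=
  kernel u v w Y * \prod_i Y i ^+ k i.

Section Choices.
Variables (n : nat) (k : 'I_n.+1 -> nat) (x : K).

(** The geometric sum of the (z / x)^l over the interval between the entries j and
    j' of the bottom row, times x - z, is the lower end for j minus the upper
    end for j'. *)
Definition lower_end (z : K) (j : 'I_n.+1) (a : arrow) := x * (z / x) ^+ (k j + (a != NW)).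

Definition upper_end (z : K) (j : 'I_n.+1) (a : arrow) := x * (z / x) ^+ (k j + (a == NE)).

(** A choice c selects one of the two end points of every interval, [true]
    standing for the lower one.  The i-th interval has its lower end at the
    entry i of the bottom row and its upper end at the entry i + 1.  These two
    functions collect what the choice contributes to the entry j. *)
Definition lower_factor (c : {ffun 'I_n -> bool}) (Y : 'I_n -> K) (j : 'I_n.+1) (a : arrow)
    : K :=
  if unlift ord_max j is Some i then (if c i then lower_end (Y i) j a else 1) else 1.

Definition upper_factor (c : {ffun 'I_n -> bool}) (Y : 'I_n -> K) (j : 'I_n.+1) (a : arrow)
    : K :=
  if unlift ord0 j is Some i then (if c i then 1 else - upper_end (Y i) j a) else 1.

Definition entry_factor c Y j := \sum_a arrow_weight u v w x a * lower_factor c Y j a *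
    upper_factor c Y j a.

(** Once the end points are chosen, the arrows of different entries are
    independent of each other. *)
Lemma expand_choices (Y : 'I_n -> K) :
  \sum_(a : {ffun 'I_n.+1 -> arrow}) (\prod_j arrow_weight u v w x (a j))
    * \prod_i (lower_end (Y i) (lift ord_max i) (a (lift ord_max i))
             - upper_end (Y i) (lift ord0 i) (a (lift ord0 i)))
  = \sum_c \prod_j entry_factor c Y j.
Proof.
have distr (a : {ffun 'I_n.+1 -> arrow}) :
    \prod_i (lower_end (Y i) (lift ord_max i) (a (lift ord_max i))
             - upper_end (Y i) (lift ord0 i) (a (lift ord0 i)))
  = \sum_(c : {ffun 'I_n -> bool}) \prod_j
    (lower_factor c Y j (a j) * upper_factor c Y j (a j)).
  transitivity (\prod_(i < n) \sum_(b : bool)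
     if b then lower_end (Y i) (lift ord_max i) (a (lift ord_max i))
     else - upper_end (Y i) (lift ord0 i) (a (lift ord0 i))).
    by apply: eq_bigr => i _; rewrite big_bool.
  rewrite bigA_distr_bigA /=; apply: eq_bigr => c _.
  rewrite big_split /= (bigD1_ord ord_max) //= /lower_factor unlift_none mul1r.
  rewrite (bigD1_ord ord0) //= /upper_factor unlift_none mul1r -big_split /=.
  by apply: eq_bigr => i _; rewrite !liftK; case: (c i); rewrite ?mulr1 ?mul1r.
under eq_bigr do rewrite distr mulr_sumr.
rewrite exchange_big /=; apply: eq_bigr => c _.
rewrite bigA_distr_bigA /=; apply: eq_bigr => a _.
by rewrite -big_split; apply: eq_bigr => j _ /=; rewrite mulrA.
Qed.
Hypothesis x0 : x != 0.

Lemma entry_factor_lower (c : {ffun 'I_n -> bool}) (Y : 'I_n -> K) (i : 'I_n) : let j :=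
    lift ord_max i in
    c i -> (forall i', j = lift ord0 i' -> c i') ->
  entry_factor c Y j = (Y i / x) ^+ k j * pair_factor u v w (Y i) x.
Proof.
move=> j ci nup; rewrite /entry_factor sum_arrow.
have upE a : upper_factor c Y j a = 1.
  by rewrite /upper_factor; case: unliftP => [i' /nup ->|].
rewrite !upE /lower_factor liftK ci /lower_end /pair_factor !arrow_eqE !eqxx /= !addn0
  !addn1 !exprS; field.
exact: x0.
Qed.

Lemma entry_factor_upper (c : {ffun 'I_n -> bool}) (Y : 'I_n -> K) (i : 'I_n) : let j :=
    lift ord0 i in
    ~~ c i -> (forall i', j = lift ord_max i' -> ~~ c i') ->
  entry_factor c Y j = - ((Y i / x) ^+ k j * pair_factor u v w x (Y i)).
Proof.
move=> j ci nup; rewrite /entry_factor sum_arrow.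
have loE a : lower_factor c Y j a = 1.
  by rewrite /lower_factor; case: unliftP => [i' /nup/negPf ->|].
rewrite !loE /upper_factor liftK (negPf ci) /upper_end /pair_factor !arrow_eqE !eqxx /=
  !addn0 !addn1 !exprS; field.
exact: x0.
Qed.

Lemma entry_factor_none (c : {ffun 'I_n -> bool}) (Y : 'I_n -> K) (j : 'I_n.+1) :
    (forall i', j = lift ord_max i' -> ~~ c i') ->
    (forall i', j = lift ord0 i' -> c i') ->
  entry_factor c Y j = diag_factor u v w x.
Proof.
move=> nl nu; rewrite /entry_factor sum_arrow.
have upE a : upper_factor c Y j a = 1.
  by rewrite /upper_factor; case: unliftP => [i' /nu ->|].
have loE a : lower_factor c Y j a = 1.
  by rewrite /lower_factor; case: unliftP => [i' /nl/negPf ->|].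
by rewrite !upE !loE /diag_factor /= !mulr1; ring.
Qed.

Lemma entry_factor_both (c : {ffun 'I_n -> bool}) (Y : 'I_n -> K) (i i' : 'I_n) (j : 'I_n.+1) :
   j = lift ord_max i -> j = lift ord0 i' -> c i -> ~~ c i' ->
  entry_factor c Y j = - (x * (Y i / x * (Y i' / x)) ^+ k j * pair_factor u v w (Y i) (Y i')).
Proof.
move=> ji ji' ci ci'; rewrite /entry_factor sum_arrow.
have loE a : lower_factor c Y j a = lower_end (Y i) j a by rewrite /lower_factor {1}ji
  liftK ci.
have upE a : upper_factor c Y j a = - upper_end (Y i') j a.
  by rewrite /upper_factor {1}ji' liftK (negPf ci').
rewrite !loE !upE /upper_end /lower_end /pair_factor !arrow_eqE !eqxx /= !addn0 !addn1
  !exprS !exprMn; field.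
exact: x0.
Qed.

(** Two neighbouring intervals that both end at the entry between them produce
    the mirror image of a pair factor of the kernel.  The product is then
    symmetric in their variables. *)
Lemma upper_lower_choice_swap (c : {ffun 'I_n -> bool}) (Y Z : 'I_n -> K) (i i' : 'I_n) : i
    = i'.+1 :> nat -> ~~ c i' -> c i ->
    Z =1 Y \o tperm i' i ->
  kernel u v w Z * \prod_j entry_factor c Z j = kernel u v w Y * \prod_j entry_factor c Y j.
Proof.
move=> ii' ci' ci eZ; pose j := lift ord_max i.
have jE : j = lift ord0 i'.
  by apply: val_inj; rewrite /= /bump leqNgt ltn_ord ii'.
rewrite (bigD1 j) //= [in RHS](bigD1 j) //= !mulrA; congr (_ * _).
  rewrite !(entry_factor_both _ (erefl j) jE ci ci') !mulrN; congr (- _).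
  have := kernel_swap u v w ii' eZ; rewrite !eZ /= tpermL tpermR => swp.
  rewrite mulrCA swp mulrCA [Y i' / x * _]mulrC; congr (_ * _).
apply: eq_bigr => j' nj; apply: eq_bigr => a _; congr (_ * _ * _).
  rewrite /lower_factor; case: unliftP => // l jl; case: ifP => // cl.
  rewrite eZ /= tpermD //; first by apply: contraNneq ci' => ->.
  by apply: contraNneq nj => il; rewrite jl -il.
rewrite /upper_factor; case: unliftP => // l jl; case: ifP => // cl.
rewrite eZ /= tpermD //; last by apply: contraFneq cl => <-.
by apply: contraNneq nj => il; rewrite jl -il jE.
Qed.

(** If no entry is used twice, just one entry p is not used at all, and it takes
    the new variable x: its total arrow weight is the diagonal factor of x, and
    the other entries provide the pair factors with x. *)
Lemma threshold_choice (p : 'I_n.+1) (Y : 'I_n -> K) :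
  kernel u v w Y * x ^+ (\sum_j k j) * \prod_j entry_factor [ffun i : 'I_n => (i < p)%N] Y j
  = (-1) ^+ (n - p) * kernel_mon k (insert_at p x Y).
Proof.
set c := finfun _.
have cE i : c i = (i < p)%N by rewrite ffunE.
have pl i : entry_factor c Y (lift p i) = (if (i < p)%N then 1 else -1)
    * ((Y i / x) ^+ k (lift p i)
       * (if (i < p)%N then pair_factor u v w (Y i) x else pair_factor u v w x (Y i))).
  case: ltnP => [ip|pi].
    have -> : lift p i = lift ord_max i.
      by apply: val_inj; rewrite /= /bump leqNgt ip leqNgt ltn_ord.
    rewrite mul1r entry_factor_lower ?cE // => i' /(congr1 val) /=.
    rewrite cE /bump leqNgt ltn_ord /= => ei; apply: leq_ltn_trans ip.
    by rewrite [nat_of_ord i]ei leq_addl.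
  have -> : lift p i = lift ord0 i by apply: val_inj; rewrite /= /bump pi.
  rewrite mulN1r entry_factor_upper ?cE -?leqNgt // => i' /(congr1 val) /=.
  rewrite cE /bump [(n <= i')%N]leqNgt ltn_ord /= => ei; rewrite -leqNgt.
  by apply: leq_trans pi _; rewrite -[nat_of_ord i']ei leq_addl.
have prodE : \prod_j entry_factor c Y j = diag_factor u v w x * ((-1) ^+ (n - p)
    * (\prod_i (Y i / x) ^+ k (lift p i)
    * \prod_(i < n) (if (i < p)%N then pair_factor u v w (Y i) x else pair_factor u v w x
      (Y i)))).
  rewrite (bigD1_ord p) //= entry_factor_none; last first.
  - by move=> i' /(congr1 val) /= pi; rewrite cE pi.
  - move=> i' /(congr1 val) /=; rewrite /bump leqNgt ltn_ord /= add0n => pi.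
    by rewrite cE pi ltnn.
  under eq_bigr do rewrite pl.
  by rewrite !big_split /= prod_sign_from.
rewrite prodE /kernel_mon kernel_insert [\prod_i insert_at _ _ _ _ ^+ _](bigD1_ord p) //=.
under [X in _ = _ * (_ * (_ * X))]eq_bigr do rewrite /insert_at liftK.
rewrite /insert_at unlift_none.
have -> : x ^+ (\sum_j k j) = x ^+ k p * \prod_i x ^+ k (lift p i).
  by rewrite (bigD1_ord p) //= exprD -prodrXr.
have -> : \prod_i Y i ^+ k (lift p i)
    = \prod_i x ^+ k (lift p i) * \prod_i (Y i / x) ^+ k (lift p i).
  rewrite -big_split; apply: eq_bigr => i _ /=; rewrite -exprMn.
  by rewrite mulrCA mulfV // mulr1.
ring.
Qed.

End Choices.

(** By the two preceding lemmas only the choices with a threshold p contribute;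
    a permutation of n + 1 variables is a place p for the last variable together
    with a permutation of the others. *)
Lemma asym_step n (k : 'I_n.+1 -> nat) (X : 'I_n.+1 -> K) :
    let x := X ord_max in let Y := fun i => X (lift ord_max i) in x != 0 ->
  \sum_(s : 'S_n) (-1) ^+ s * (kernel u v w (Y \o s) * x ^+ (\sum_j k j)
    * \sum_(a : {ffun 'I_n.+1 -> arrow}) (\prod_j arrow_weight u v w x (a j))
      * \prod_i (lower_end k x (Y (s i)) (lift ord_max i) (a (lift ord_max i))
               - upper_end k x (Y (s i)) (lift ord0 i) (a (lift ord0 i))))
  = \sum_(t : 'S_n.+1) (-1) ^+ t * kernel_mon k (X \o t).
Proof.
move=> x Y x0.
under [LHS]eq_bigr => s _ do rewrite (expand_choices k x (fun i => Y (s i))) !mulr_sumr.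
rewrite exchange_big sum_threshold_choices /=; last first.
  move=> c i j ij ci cj.
  pose F Z := kernel u v w Z * x ^+ (\sum_j k j) * \prod_j entry_factor k x c Z j.
  apply: (asym_swap_eq0 (i := i) (j := j) (F := F)); first by rewrite -val_eqE /= ij; lia.
  move=> Z Z' eZ; rewrite /F mulrAC (upper_lower_choice_swap k x0 ij ci cj eZ).
  by rewrite mulrAC.
rewrite (sum_lift_perm_to ord_max); apply: eq_bigr => p _; apply: eq_bigr => s _.
rewrite threshold_choice // mulrA; congr (_ * _).
  rewrite odd_lift_perm /= !signr_addb !signr_odd mulrC; congr (_ * _).
  have lepn : (p <= n)%N by rewrite -ltnS ltn_ord.
  have -> : (-1) ^+ n = (-1) ^+ (n - p) * (-1) ^+ p :> K by rewrite -exprD subnK.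
  by rewrite mulrCA -exprD addnn -[(-1) ^+ _.*2]signr_odd odd_double mulr1.
rewrite /kernel_mon.
have eX j : insert_at p x (Y \o s) j = (X \o lift_perm p ord_max s) j.
  rewrite /insert_at /=; case: unliftP => [i|] ->; last by rewrite lift_perm_id.
  by rewrite lift_perm_lift.
by congr (_ * _); [apply: eq_kernel => j | apply: eq_bigr => j _; congr (_ ^+ _)]; rewrite eX.
Qed.

End Step.

(** * Arrowed monotone triangles *)

Lemma is_amtP n (A : arrowed n) :
  reflect (forall q p,
    [/\ ne_of q p -> A.1 q <= A.1 p,
        nw_of q p -> A.1 p <= A.1 q,
        trow p = trow q -> tcol q = (tcol p).+1 -> A.1 p < A.1 q,
        nw_of q p -> A.1 p = A.1 q -> A.2 q = NE
      & ne_of q p -> A.1 p = A.1 q -> A.2 q = NW]) (is_amt A).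
Proof.
apply: (iffP andP) => [[/forallP mt /forallP ar] q p|H].
  have /forallP/(_ p)/and3P[/implyP h1 /implyP h2 /implyP h3] := mt q.
  have /forallP/(_ p)/andP[/implyP h4 /implyP h5] := ar q.
  split => //.
  - by move=> /eqP e1 /eqP e2; apply: h3; rewrite e1.
  - by move=> nw /eqP e; apply/eqP/h4; rewrite nw.
  - by move=> nw /eqP e; apply/eqP/h5; rewrite nw.
split; apply/forallP => q; apply/forallP => p; have [h1 h2 h3 h4 h5] := H q p.
  apply/and3P; split; apply/implyP => // /andP[/eqP e1 /eqP e2]; exact: h3.
by apply/andP; split; apply/implyP => /andP[nw /eqP e]; apply/eqP; [exact: h4|exact: h5].
Qed.

Lemma has_bottomP n (k : 'I_n -> int) (A : arrowed n) :
  reflect (forall j, A.1 (tlast j) = k j) (has_bottom k A).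
Proof.
apply: (iffP forallP) => [H j|H p].
  have /forallP/(_ j)/implyP := H (tlast j).
  rewrite trow_tlast tcol_tlast eqxx andbT prednK ?eqxx; last by case: n j {H k A} => [[]|].
  by move/(_ isT)/eqP.
apply/forallP => j; apply/implyP => /andP[/eqP rp /eqP cp].
have [i pE] := tlastP rp; rewrite pE H; apply/eqP; congr k.
by apply: val_inj; rewrite /= -cp pE tcol_tlast.
Qed.

(** With bounded entries the triangles form a finite type that is independent of
    the bottom row. *)
Definition amt_code_of (B n : nat) := {ffun tri n -> 'I_B.+1 * arrow}.

Definition decode B n (c : amt_code_of B n) : arrowed n :=
  ([ffun p => (c p).1%:Z], [ffun p => (c p).2]).

(** An entry lies between its two neighbours in the row below, so that a bound
    on the bottom row bounds all entries. *)
Lemma sum_amt (V : nmodType) n (k : 'I_n -> int) B (F : arrowed n -> V) :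
    (forall j, 0 <= k j <= B%:Z) ->
  \sum_(A : amt k) F (val A)
  = \sum_(c : amt_code_of B n | is_amt (decode c) && has_bottom k (decode c)) F (decode c).
Proof.
move=> kB.
have bound (A : amt k) p : 0 <= (val A).1 p <= B%:Z.
  case: A => A /= /andP[/is_amtP amtA /has_bottomP bot].
  have [d] := ubnP (n - trow p); elim: d p => // d IHd p.
  have := trow_lt p; rewrite leq_eqVlt => /orP[/eqP rp _|rp lep].
    by have [i ->] := tlastP rp; rewrite bot.
  have cp := tcol_le p.
  have [|q [rq cq]] := @tri_ex n (trow p).+1 (tcol p); first by rewrite rp andbT leqW.
  have [|q' [rq' cq']] := @tri_ex n (trow p).+1 (tcol p).+1; first by rewrite rp andbT ltnS cp.
  have [+ _ _ _ _] := amtA q p; rewrite /ne_of rq cq !eqxx => /(_ isT) le1.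
  have [_ + _ _ _] := amtA q' p; rewrite /nw_of rq' cq' !eqxx => /(_ isT) le2.
  have /andP[b1 _] : 0 <= A.1 q <= B%:Z by apply: IHd; rewrite rq; lia.
  have /andP[_ b2] : 0 <= A.1 q' <= B%:Z by apply: IHd; rewrite rq'; lia.
  by rewrite (le_trans b1 le1) (le_trans le2 b2).
pose h (A : amt k) : amt_code_of B n := [ffun p => (inord `|(val A).1 p|%N, (val A).2 p)].
have hK A : decode (h A) = val A.
  rewrite [RHS]surjective_pairing; congr (_, _); apply/ffunP => p; rewrite !ffunE //=.
  have /andP[b1 b2] := bound A p.
  by rewrite inordK ?gez0_abs // ltnS -lez_nat gez0_abs.
have decI : injective (@decode B n : _ -> _ * _).
  move=> c c' [/ffunP e1 /ffunP e2]; apply/ffunP => p.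
  have := e1 p; have := e2 p; rewrite !ffunE.
  by case: (c p) (c' p) => [m a] [m' a'] /= -> [] /val_inj ->.
rewrite (reindex_omap h (fun c => insub (decode c))) /=.
  apply: eq_big => [A|A _]; last by rewrite hK.
  by rewrite hK valK eqxx andbT (valP A).
move=> c Pc; rewrite insubT //=; congr Some; apply: decI.
by rewrite hK SubK.
Qed.

Lemma exprz_sum (K : fieldType) (I : finType) (P : pred I) (F : I -> int) (x : K) :
  x != 0 -> x ^ (\sum_(i | P i) F i) = \prod_(i | P i) x ^ F i.
Proof.
move=> x0; apply: (big_morph (fun z => x ^ z)); last by rewrite expr0z.
by move=> a b; rewrite expfzDr.
Qed.

Section Weight.
Variables (K : fieldType) (u v w : K) (B : nat).

(** The exponents given by the row sums are spread over the entries: an entry of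
    row r counts positively for X_r and negatively for X_(r+1). *)
Definition code_weight (X : nat -> K) n (c : amt_code_of B n) : K :=
  \prod_p (arrow_weight u v w (X (trow p)) (c p).2 * X (trow p) ^+ (c p).1
     * (if ((trow p).+1 < n)%N then X (trow p).+1 ^- (c p).1 else 1)).

Lemma amt_weight_code (X : nat -> K) n (c : amt_code_of B n) :
    (forall i, X i != 0) ->
  amt_weight u v w (fun i : 'I_n => X i) (decode c) = code_weight X c.
Proof.
move=> X0; rewrite /amt_weight /=.
have cnt a (y : K) : y ^+ count_arrow (decode c).2 a
    = \prod_p (if (c p).2 == a then y else 1).
  rewrite -big_mkcond -prodr_const; apply: eq_bigl => p.
  by rewrite inE ffunE.
have rows (F : tri n -> K) : \prod_(i < n) \prod_(p | trow p == i) F p = \prod_p F p.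
  by rewrite [RHS](partition_big (fun p => tag p) xpredT).
have cntr a i : X i ^+ count_in_row (decode c).2 a i
    = \prod_(p | trow p == i) (if (c p).2 == a then X (trow p) else 1).
  rewrite -big_mkcondr /= -prodr_const; apply: eq_big => [p|p].
    by rewrite inE ffunE.
  by rewrite inE => /andP[/eqP->].
have prs i : prev_row_sum (decode c).1 i
    = \sum_(p : tri n | (trow p).+1 == i) (c p).1%:Z.
  case: i => [|i]; first by rewrite big_pred0.
  by rewrite /= /row_sum; apply: eq_big => [p|p _]; rewrite ?eqSS ?ffunE.
rewrite !cnt.
have -> : \prod_(i < n) X i ^ (row_sum (decode c).1 i - prev_row_sum (decode c).1 i
      + (count_in_row (decode c).2 NE i)%:Z - (count_in_row (decode c).2 NW i)%:Z)
  = (\prod_p X (trow p) ^+ (c p).1)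
    * (\prod_(p : tri n) (if ((trow p).+1 < n)%N then X (trow p).+1 ^- (c p).1 else 1))
    * (\prod_p (if (c p).2 == NE then X (trow p) else 1))
    * (\prod_p (if (c p).2 == NW then (X (trow p))^-1 else 1)).
  rewrite -[X in X * _ * _ * _]rows -[X in _ * X * _]rows -[X in _ * X]rows.
  have -> : \prod_(p : tri n) (if ((trow p).+1 < n)%N then X (trow p).+1 ^- (c p).1 else 1)
     = \prod_(i < n) \prod_(p : tri n | (trow p).+1 == i) X i ^- (c p).1.
    under [RHS]eq_bigr do rewrite big_mkcond /=.
    rewrite exchange_big /=; apply: eq_bigr => p _.
    rewrite -prod_ord_eq; apply: eq_bigr => i _.
    by case: eqP => // ->.
  rewrite -!big_split /=; apply: eq_bigr => i _.
  rewrite !expfzDr // -!invr_expz; congr (_ * _ * _ * _).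
  - rewrite /row_sum exprz_sum //; apply: eq_bigr => p /eqP ->.
    by rewrite ffunE.
  - by rewrite prs exprz_sum // prodfV.
  - exact: cntr.
  rewrite [_ ^ _]cntr -prodfV; apply: eq_bigr => p _; case: ifP => //.
  by rewrite invr1.
rewrite /code_weight -!big_split; apply: eq_bigr => p _ /=.
rewrite /arrow_weight; case: (c p) => m; case; rewrite /= ?arrow_eqE ?eqxx; ring.
Qed.

(** An entry equal to its neighbour on the lower left forces NW there, an entry
    equal to its neighbour on the lower right forces NE there. *)
Definition interval_ok n (k : 'I_n.+1 -> nat) (a : 'I_n.+1 -> arrow) (l : 'I_n -> nat) :=
  [forall i, (k (lift ord_max i) + (a (lift ord_max i) != NW) <= l i)%N
           && (l i + (a (lift ord0 i) != NE) <= k (lift ord0 i))%N].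

Definition amt_ok n (k : 'I_n -> nat) (c : amt_code_of B n) :=
  is_amt (decode c) && has_bottom (fun j => (k j)%:Z) (decode c).

Lemma amt_ok_join n (k : 'I_n.+1 -> nat) (c : amt_code_of B n) b :
    {homo k : i j / (i < j)%N} ->
  amt_ok k (trijoin c b)
  = [forall j, (b j).1 == k j :> nat]
    && (is_amt (decode c) && interval_ok k (fun j => (b j).2) (fun i => (c (tlast i)).1)).
Proof.
move=> kinc.
have up1 p : (decode (trijoin c b)).1 (tup p) = (c p).1%:Z by rewrite ffunE trijoin_up.
have up2 p : (decode (trijoin c b)).2 (tup p) = (c p).2 by rewrite ffunE trijoin_up.
have bo1 p : (decode (trijoin c b)).1 (tbot p) = (b p).1%:Z by rewrite ffunE trijoin_bot.
have bo2 p : (decode (trijoin c b)).2 (tbot p) = (b p).2 by rewrite ffunE trijoin_bot.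
have dc1 p : (decode c).1 p = (c p).1%:Z by rewrite ffunE.
have dc2 p : (decode c).2 p = (c p).2 by rewrite ffunE.
apply/andP/and3P => [[/is_amtP amtA /has_bottomP bot]|[/forallP bot /is_amtP amtA /forallP
  int]].
  have bk j : (b j).1 = k j :> nat by have := bot j; rewrite /= bo1 => -[].
  split.
  - by apply/forallP => j; rewrite bk.
  - apply/is_amtP => q p; have := amtA (tup q) (tup p).
    by rewrite !up1 !up2 !dc1 !dc2.
  apply/forallP => i; rewrite -!bk.
  have [+ _ _ _ +] := amtA (tbot (lift ord_max i)) (tup (tlast i)).
  rewrite bo1 bo2 up1 => /(_ (ne_of_bot i)) h1 /(_ (ne_of_bot i)) h2.
  have [_ + _ + _] := amtA (tbot (lift ord0 i)) (tup (tlast i)).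
  rewrite bo1 bo2 up1 => /(_ (nw_of_bot i)) h3 /(_ (nw_of_bot i)) h4.
  apply/andP; split.
    case: eqP => [_|na] /=; first by rewrite addn0.
    rewrite addn1 ltn_neqAle -lez_nat h1 andbT.
    by apply: contra_notN na => /eqP e; apply: h2; rewrite e.
  case: eqP => [_|na] /=; first by rewrite addn0.
  rewrite addn1 ltn_neqAle -lez_nat h3 andbT.
  by apply: contra_notN na => /eqP e; apply: h4; rewrite e.
have bk j : (b j).1 = k j :> nat by apply/eqP.
split; last by apply/has_bottomP => j; rewrite /= bo1 bk.
apply/is_amtP; elim/tri_ind => q; elim/tri_ind => p; rewrite ?up1 ?up2 ?bo1 ?bo2.
- by have := amtA q p; rewrite !dc1 !dc2.
- have rq : (trow (tup q) < n)%N by exact: (trow_lt q).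
  rewrite /ne_of /nw_of [trow (tbot p)]/trow /=.
  split=> [/andP[/eqP e _]|/andP[/eqP e _]|e|/andP[/eqP e _]|/andP[/eqP e _]];
    by move: rq; rewrite ?e ?ltnNge ?leqnSn -?e ?leqnn.
- have rp : (trow (tup p) < n)%N by exact: (trow_lt p).
  have pE : n = (trow p).+1 -> exists i, p = tlast i by move=> e; exact: tlastP.
  rewrite /ne_of /nw_of -[tcol (tup p)]/(tcol p) -[trow (tup p)]/(trow p).
  rewrite [trow (tbot q)]/trow [tcol (tbot q)]/tcol /=.
  split=> [/andP[/eqP/pE[i ->]]|/andP[/eqP/pE[i ->]]|e|/andP[/eqP/pE[i ->]]|/andP[/eqP/pE[i
    ->]]].
  + rewrite tcol_tlast => /eqP qi; have -> : q = lift ord_max i.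
      by apply: val_inj; rewrite /= /bump leqNgt ltn_ord.
    have /andP[h _] := int i; rewrite lez_nat bk; exact: leq_trans (leq_addr _ _) h.
  + rewrite tcol_tlast => /eqP qi; have -> : q = lift ord0 i by apply: val_inj.
    have /andP[_ h] := int i; rewrite lez_nat bk; exact: leq_trans (leq_addr _ _) h.
  + by move: rp; rewrite -[trow (tup p)]/(trow p) e ltnn.
  + rewrite tcol_tlast => /eqP qi; have -> : q = lift ord0 i by apply: val_inj.
    have /andP[_ h] := int i => -[]; rewrite bk => e; move: h; rewrite e.
    by case: eqP => //; rewrite addn1 ltnn.
  + rewrite tcol_tlast => /eqP qi; have -> : q = lift ord_max i.
      by apply: val_inj; rewrite /= /bump leqNgt ltn_ord.
    have /andP[h _] := int i => -[]; rewrite bk => e; move: h; rewrite e.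
    by case: eqP => //; rewrite addn1 ltnn.
have nn : (n == n.+1) = false by rewrite ltn_eqF.
rewrite /ne_of /nw_of ![trow (tbot _)]/trow ![tcol (tbot _)]/tcol /= nn /=.
split=> // _ e; rewrite ltz_nat !bk kinc //; exact: (eq_leq (esym e)).
Qed.

End Weight.

Section Recursion.
Variables (K : fieldType) (u v w : K) (B : nat) (X : nat -> K).
Hypothesis X0 : forall i, X i != 0.

Definition amt_gf n (k : 'I_n -> nat) : K :=
  \sum_(c : amt_code_of B n | amt_ok k c) code_weight u v w X c.

Lemma code_weight_join n (c : amt_code_of B n) b :
  code_weight u v w X (trijoin c b)
  = (\prod_j arrow_weight u v w (X n) (b j).2) * X n ^+ (\sum_j (b j).1)
    * (\prod_i X n ^- (c (tlast i)).1) * code_weight u v w X c.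
Proof.
rewrite /code_weight big_tri /= [RHS]mulrC.
have -> : \prod_(j < n.+1) (arrow_weight u v w (X (trow (tbot j))) (trijoin c b (tbot j)).2
     * X (trow (tbot j)) ^+ (trijoin c b (tbot j)).1
     * (if ((trow (tbot j)).+1 < n.+1)%N
        then X (trow (tbot j)).+1 ^- (trijoin c b (tbot j)).1 else 1))
   = (\prod_j arrow_weight u v w (X n) (b j).2) * X n ^+ (\sum_j (b j).1).
  rewrite -prodrXr -big_split; apply: eq_bigr => j _ /=.
  by rewrite trijoin_bot /trow /= ltnn mulr1.
rewrite [RHS]mulrCA mulrC; congr (_ * _).
rewrite -(big_tlast _ (fun p => X n ^- (c p).1)) [X in _ * X]big_mkcond -big_split /=.
apply: eq_bigr => p _; rewrite trijoin_up -[RHS]mulrA; congr (_ * _).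
rewrite -[trow (tup p)]/(trow p) ltnS.
have := trow_lt p; rewrite leq_eqVlt => /orP[/eqP e|lt].
  by rewrite e ltnn eqxx mul1r.
by rewrite lt orbT ltn_eqF // mulr1.
Qed.

Lemma amt_gf_rec n (k : 'I_n.+1 -> nat) :
    {homo k : i j / (i < j)%N} -> (forall j, k j <= B)%N ->
  amt_gf k = \sum_(a : {ffun 'I_n.+1 -> arrow})
    \sum_(l : {ffun 'I_n -> 'I_B.+1} | interval_ok k a (fun i => l i))
      (\prod_j arrow_weight u v w (X n) (a j)) * X n ^+ (\sum_j k j)
      * (\prod_i X n ^- (l i)) * amt_gf (fun i => l i).
Proof.
move=> kinc kB; rewrite /amt_gf big_mkcond sum_trijoin exchange_big /=.
under eq_bigr do under eq_bigr do rewrite amt_ok_join //.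
rewrite (bigID (fun b : {ffun 'I_n.+1 -> 'I_B.+1 * arrow} =>
  [forall j, (b j).1 == k j :> nat])) /=.
rewrite [X in _ + X]big1 ?addr0 => [|b /negPf nb]; last by rewrite big1 // => c _; rewrite nb.
pose h (a : {ffun 'I_n.+1 -> arrow}) : {ffun 'I_n.+1 -> 'I_B.+1 * arrow} :=
  [ffun j => (inord (k j), a j)].
rewrite (reindex_onto h (fun b => [ffun j => (b j).2])) /=; last first.
  move=> b /forallP bk; apply/ffunP => j; rewrite !ffunE [RHS]surjective_pairing.
  by congr (_, _); apply: val_inj; rewrite -(eqP (bk j)) /= inord_val.
apply: eq_big => [a|a _].
  apply/andP; split; last by apply/eqP/ffunP => j; rewrite !ffunE.
  by apply/forallP => j; rewrite ffunE /= inordK // ltnS.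
have -> : [forall j, (h a j).1 == k j :> nat].
  by apply/forallP => j; rewrite ffunE /= inordK // ltnS.
rewrite -big_mkcond /=.
rewrite (partition_big (fun c : amt_code_of B n => [ffun i => (c (tlast i)).1])
   (fun l : {ffun 'I_n -> 'I_B.+1} => interval_ok k a (fun i => l i))) /=; last first.
  move=> c /andP[_]; rewrite /interval_ok => /forallP H; apply/forallP => i.
  by have := H i; rewrite !ffunE.
apply: eq_bigr => l okl; rewrite mulr_sumr.
apply: eq_big => [c|c /andP[_ /eqP lc]].
  rewrite /amt_ok -andbA; congr (_ && _).
  apply/andP/has_bottomP => [[_ /eqP lc] j|bot]; first by rewrite -lc !ffunE.
  have -> : l = [ffun i => (c (tlast i)).1].
    by apply/ffunP => i; apply: val_inj; have := bot i; rewrite !ffunE => -[].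
  split=> //; apply/forallP => i.
  have := forallP okl i; have := bot i; rewrite !ffunE /= => -[] <-.
  by [].
rewrite code_weight_join; congr (_ * _ * _ * _).
- by apply: eq_bigr => j _; rewrite ffunE.
- by congr (_ ^+ _); apply: eq_bigr => j _; rewrite ffunE /= inordK // ltnS.
by rewrite -lc; apply: eq_bigr => i _; rewrite ffunE.
Qed.

Definition vandermonde n := \prod_(j < n) \prod_(i < j) (X j - X i).

(** Induction on n.  The factors X n - X i by which the Vandermonde product grows
    are the denominators of the geometric sums over the row above. *)
Theorem amt_gf_asym n (k : 'I_n -> nat) :
    {homo k : i j / (i < j)%N} -> (forall j, k j <= B)%N ->
  vandermonde n * amt_gf k = \sum_(s : 'S_n) (-1) ^+ s * kernel_mon u v w k (fun i => X (s i)).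
Proof.
elim: n => [|n IHn] in k * => kinc kB.
  rewrite /vandermonde big_ord0 mul1r (big_pred1 1%g) => [|s]; last first.
    by apply/esym/eqP/permP => -[].
  rewrite odd_perm1 /kernel_mon /kernel /amt_gf.
  have no0 (c : amt_code_of B 0) : c = [ffun p => (ord0, NW)] by apply/ffunP => -[[]].
  rewrite (big_pred1 [ffun p => (ord0, NW)]) => [|c]; last first.
    rewrite (no0 c) /= eqxx; apply/andP; split; first by apply/is_amtP => -[[]].
    by apply/has_bottomP => -[].
  by rewrite /code_weight !big1 ?mulr1 // => -[] [] // [].
rewrite amt_gf_rec // -(@asym_step K u v w n k (fun i => X i)) //=.
have -> : vandermonde n.+1 = vandermonde n * \prod_(i < n) (X n - X i) by rewrite
  /vandermonde big_ord_recr.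
under [RHS]eq_bigr do rewrite !mulr_sumr.
rewrite [RHS]exchange_big mulr_sumr /=; apply: eq_bigr => a _.
transitivity (\sum_(l : {ffun 'I_n -> 'I_B.+1} | interval_ok k a (fun i => l i))
   \sum_(s : 'S_n) (-1) ^+ s * (kernel u v w (fun i => X (s i)) * X n ^+ (\sum_j k j)
     * ((\prod_j arrow_weight u v w (X n) (a j))
     * \prod_i ((X n - X (s i)) * (X (s i) / X n) ^+ l i)))).
  rewrite mulr_sumr; apply: eq_bigr => l okl.
  have lok i : (k (lift ord_max i) <= l i <= k (lift ord0 i))%N.
    have /andP[h1 h2] := forallP okl i.
    by rewrite (leq_trans (leq_addr _ _) h1) (leq_trans (leq_addr _ _) h2).
  (* The entry of k between two neighbours of the row above would need two
     different arrows to be equal to both. *)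
  have linc : {homo (fun i => l i : nat) : i j / (i < j)%N}.
    move=> i j ij; have /andP[_ h2] := forallP okl i.
    have /andP[h1 _] := forallP okl j.
    have lE m : lift ord_max m = m :> nat by rewrite /= /bump leqNgt ltn_ord.
    have : (lift ord0 i <= lift ord_max j)%N by rewrite lE.
    rewrite leq_eqVlt => /orP[/eqP/val_inj e|/kinc].
      move: h1 h2; rewrite -e; set y := k _; case: (a (lift ord0 i));
        rewrite ?arrow_eqE ?eqxx /=; lia.
    have := lok i; have := lok j; lia.
  have := IHn (fun i => l i) linc (fun i => leq_trans (proj2 (andP (lok i))) (kB _)).
  rewrite [vandermonde n * \prod_(i < n) _]mulrC [_ * vandermonde n * _]mulrACA => ->.
  rewrite !mulr_sumr; apply: eq_bigr => s _; rewrite /kernel_mon big_split /=.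
  have -> : \prod_(i < n) (X n - X i) = \prod_i (X n - X (s i)).
    by rewrite (reindex_perm s).
  have -> : \prod_i (X (s i) / X n) ^+ l i
     = (\prod_i X (s i) ^+ l i) * (\prod_i X n ^- l i).
    by rewrite -big_split; apply: eq_bigr => i _; rewrite exprMn exprVn.
  move: (\prod_i (X n - X (s i))) (\prod_j arrow_weight u v w (X n) (a j)) (X n ^+ _).
  move: (\prod_i X n ^- l i) (kernel _ _ _ _) (\prod_i X (s i) ^+ l i) ((-1) ^+ s).
  by move=> *; ring.
rewrite exchange_big /=; apply: eq_bigr => s _.
rewrite -!mulr_sumr; congr (_ * _).
have bumpE (i : 'I_n) : bump n i = i by rewrite /bump leqNgt ltn_ord.
rewrite (@eq_kernel _ u v w n _ (fun i => X (s i))) => [|i]; last by rewrite /= bumpE.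
congr (_ * (_ * _)). apply: etrans (sum_ffun_prod (fun (i : 'I_n) (x : 'I_B.+1) =>
  (k (lift ord_max i) + (a (lift ord_max i) != NW) <= x)%N
           && (x + (a (lift ord0 i) != NE) <= k (lift ord0 i))%N)
  (fun (i : 'I_n) (x : 'I_B.+1) => (X n - X (s i)) * (X (s i) / X n) ^+ x)) _.
apply: eq_bigr => i _; rewrite /lower_end /upper_end bumpE.
set y := X (s i); rewrite -(sum_ord_telescope (M := B.+1) (fun e => X n * (y / X n) ^+ e)).
  apply: eq_big => [m|m _].
    by case: (a (lift ord0 i)); rewrite ?arrow_eqE ?eqxx /=; lia.
  rewrite -mulrBr exprS; have := X0 n; set x := X n => x0; by field.
have : (k (lift ord_max i) < k (lift ord0 i))%N.
  by apply: kinc; rewrite /= bumpE.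
have := kB (lift ord0 i); case: (_ != NW); case: (_ == NE) => /=; lia.
Qed.

End Recursion.

Section Shape.
Variables (K : fieldType) (u v w : K) (B : nat) (X : nat -> K) (n : nat).
Hypothesis X0 : forall i, X i != 0.
Let x i := u * X i.
Let y i := v / X i.
Let f t := t * (t + w).

(** If all x_i y_i are equal, this is the symplectic Weyl denominator
    det (x_i^j - y_i^j), 1 <= j <= m, in factored form. *)
Definition spdelta (x y : nat -> K) m :=
  (\prod_(i < m) (x i - y i))
  * pairprod (fun i j : 'I_m => (x j + y j) - (x i + y i)).

(** Here (x - y) (x + w + y) = f(x) - f(y), and
    (u a b - v) (v + w a + u a b) = a^2 (f(u b) - f(v / a)).  Hence the
    symmetric product of the x_i - y_i and of the u X_i X_j - v for i < j turns
    the alternating sum of [amt_gf_asym] into the one of [asym_det]. *)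
Theorem amt_gf_det : (forall j : 'I_n, 2 * j <= B)%N ->
  amt_gf u v w B X (fun j : 'I_n => 2 * j)%N * spdelta x y n
  = (\prod_(i < n) X i ^+ n.-1)
    * \det (\matrix_(i < n, j < n) (f (x i) ^+ j.+1 - f (y i) ^+ j.+1)).
Proof.
move=> kB; rewrite -asym_det /spdelta.
(* X i is in i pairs as the larger and in n - 1 - i as the smaller index. *)
pose XX := \prod_(i < n) X i ^+ n.-1.
have pX (s : 'S_n) : pairprod (fun i j : 'I_n => X (s i) * X (s j)) = XX.
  rewrite (pairprod_sym (F := fun i j => X i * X j)) => [|i j]; last exact: mulrC.
  rewrite pairprodM (pairprod_fst (fun i => X i)) (pairprod_snd (fun i => X i)).
  rewrite -big_split; apply: eq_bigr => i _ /=; rewrite -exprD subnK //.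
  by have := ltn_ord i; lia.
have XX0 : XX != 0 by apply/prodf_neq0 => i _; rewrite expf_neq0.
have delta : pairprod (fun i j : 'I_n => (x j + y j) - (x i + y i)) * XX
   = vandermonde X n * pairprod (fun i j : 'I_n => u * X i * X j - v).
  have -> : vandermonde X n = pairprod (fun i j : 'I_n => X j - X i).
    rewrite pairprodE; apply: eq_bigr => j _.
    by rewrite (big_ord_widen n (fun i => X j - X i)) // ltnW.
  have <- : pairprod (fun i j : 'I_n => X i * X j) = XX.
    by rewrite -(pX 1%g); apply: eq_bigr => p _; rewrite !perm1.
  rewrite -!pairprodM; apply: eq_bigr => p _; rewrite /x /y.
  by field; rewrite !X0.
have kinc : {homo (fun j : 'I_n => 2 * j)%N : i j / (i < j)%N} by move=> i j ij; lia.
have := amt_gf_asym u v w X0 kinc kB.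
set G := amt_gf _ _ _ _ _ _ => GE.
apply: (mulIf XX0); rewrite -[LHS]mulrA -[_ * _ * XX]mulrA delta.
have -> : G * (\prod_(i < n) (x i - y i)
      * (vandermonde X n * pairprod (fun i j : 'I_n => u * X i * X j - v)))
    = (\prod_(i < n) (x i - y i)) * pairprod (fun i j : 'I_n => u * X i * X j - v)
      * (vandermonde X n * G).
  by rewrite mulrC -!mulrA; congr (_ * _); rewrite mulrCA.
rewrite GE [RHS]mulrAC -/XX !mulr_sumr; apply: eq_bigr => s _.
rewrite pairprod_le -{1}(pX s) -(pX s) /kernel_mon /kernel.
have -> : \prod_(i < n) X (s i) ^+ (2 * i)
    = pairprod (fun i j : 'I_n => X (s j)) * pairprod (fun i j : 'I_n => X (s j)).
  rewrite (pairprod_snd (fun j => X (s j))) -big_split; apply: eq_bigr => i _ /=.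
  by rewrite -exprD addnn mul2n.
rewrite -(pairprod_sym (F := fun i j => u * X i * X j - v) s) => [|i j]; last by ring.
rewrite (reindex_perm s) /=.
have -> : \prod_i (f (x (s i)) - f (y (s i)))
   = \prod_i (x (s i) - y (s i)) * \prod_i diag_factor u v w (X (s i)).
  by rewrite -big_split; apply: eq_bigr => i _; rewrite /f /diag_factor /x /y /=; ring.
rewrite -[\prod_(p : 'I_n * 'I_n | (p.1 < p.2)%N) _]/(pairprod
  (fun i j : 'I_n => pair_factor u v w (X (s i)) (X (s j)))).
have : pairprod (fun i j : 'I_n => u * X (s i) * X (s j) - v)
   * pairprod (fun i j : 'I_n => pair_factor u v w (X (s i)) (X (s j)))
   * (pairprod (fun i j : 'I_n => X (s j)) * pairprod (fun i j : 'I_n => X (s j)))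
  = pairprod (fun i j : 'I_n => X (s i) * X (s j)) * pairprod
    (fun i j : 'I_n => X (s i) * X (s j))
    * pairprod (fun i j : 'I_n => f (x (s j)) - f (y (s i))).
  rewrite -!pairprodM; apply: eq_bigr => p _; rewrite /pair_factor /f /x /y.
  by field; rewrite X0.
move: (pairprod (fun i j => u * X (s i) * X (s j) - v)).
move: (pairprod (fun i j => pair_factor u v w (X (s i)) (X (s j)))).
move: (pairprod (fun i j => X (s j))) (pairprod (fun i j => X (s i) * X (s j))).
move: (pairprod (fun i j => f (x (s j)) - f (y (s i)))) ((-1) ^+ s).
move: (\prod_i (x (s i) - y (s i))) (\prod_i diag_factor u v w (X (s i))).
move=> a b c d e g h k E.
transitivity (a * b * d * (k * h * (e * e))); first by ring.
by rewrite E; ring.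
Qed.

End Shape.

(** * Symplectic tableaux *)

Definition zero_ext m L (mu : {ffun 'I_m -> 'I_L.+1}) (i : nat) : nat :=
  if insub i : option 'I_m is Some i' then mu i' else 0%N.

Lemma zero_ext_ord m L (mu : {ffun 'I_m -> 'I_L.+1}) (i : 'I_m) : zero_ext mu i = mu i.
Proof. by rewrite /zero_ext valK. Qed.

Lemma zero_ext_ge m L (mu : {ffun 'I_m -> 'I_L.+1}) i : (m <= i)%N -> zero_ext mu i = 0%N.
Proof. by move=> mi; rewrite /zero_ext insubF // ltnNge mi. Qed.

Lemma zero_ext_le m L (mu : {ffun 'I_m -> 'I_L.+1}) i : (zero_ext mu i <= L)%N.
Proof. by rewrite /zero_ext; case: insub => // j; rewrite -ltnS. Qed.

Section Tableaux.
Variables (K : fieldType) (z : nat -> K) (N L M : nat).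

(** All shapes share this type: cells outside the shape get the value M, which
    is beyond all letters. *)
Definition filling := {ffun 'I_N * 'I_L -> 'I_M.+1}.

Definition is_tab (s : nat) (la : nat -> nat) (f : filling) :=
  [&& [forall c : 'I_N * 'I_L, if (c.2 < la c.1)%N then (2 * c.1 <= f c)%N && (f c < s)%N
                 else f c == M :> nat],
      [forall c : 'I_N * 'I_L, forall c' : 'I_N * 'I_L, (c.1 == c'.1) && (c.2 < c'.2)%N ==>
        (f c <= f c')%N]
    & [forall c : 'I_N * 'I_L, forall c' : 'I_N * 'I_L,
      [&& (c.1 < c'.1)%N, c.2 == c'.2 & (c'.2 < la c'.1)%N]
                  ==> (f c < f c')%N]].

Lemma is_tabP s (la : nat -> nat) (f : filling) : reflect
  [/\ forall (i : 'I_N) (j : 'I_L), (j < la i)%N -> (2 * i <= f (i, j))%N && (f (i, j) < s)%N,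
      forall (i : 'I_N) (j : 'I_L), (la i <= j)%N -> f (i, j) = M :> nat,
      forall (i : 'I_N) (j j' : 'I_L), (j < j')%N -> (f (i, j) <= f (i, j'))%N
    & forall (i i' : 'I_N) (j : 'I_L), (i < i')%N -> (j < la i')%N -> (f (i, j) < f (i', j))%N]
  (is_tab s la f).
Proof.
apply: (iffP and3P) => [[/forallP h1 /forallP h2 /forallP h3]|[h1 h2 h3 h4]].
  split=> [i j lt|i j le|i j j' lt|i i' j ii' lt].
  - by have := h1 (i, j); rewrite /= lt.
  - by have := h1 (i, j); rewrite /= ltnNge le => /eqP.
  - by have /forallP/(_ (i, j')) := h2 (i, j); rewrite eqxx lt.
  - by have /forallP/(_ (i', j)) := h3 (i, j); rewrite /= ii' eqxx lt.
split.
- apply/forallP => -[i j] /=; case: ltnP => [/h1//|/h2 ->]; exact: eqxx.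
- apply/forallP => -[i j]; apply/forallP => -[i' j'] /=.
  by apply/implyP => /andP[/eqP -> lt]; exact: h3.
apply/forallP => -[i j]; apply/forallP => -[i' j'] /=.
by apply/implyP => /and3P[lt /eqP -> lt']; exact: h4.
Qed.

Definition tab_gf s (la : nat -> nat) : K :=
  \sum_(f : filling | is_tab s la f) \prod_(c | (f c < M)%N) z (f c).

Definition horizontal_strip m (la mu : nat -> nat) :=
  [forall i : 'I_m, (la i.+1 <= mu i <= la i)%N].

(** The cells with the letter s form a horizontal strip.  The cells with smaller
    letters lie in the first [uphalf s] rows, because row i starts at the letter
    2 * i. *)
Lemma tab_gf_rec s (la : nat -> nat) : (s < M)%N -> (uphalf s.+1 <= N)%N ->
    {homo la : i j / (i <= j)%N >-> (j <= i)%N} -> (forall i, la i <= L)%N ->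
    (forall i, (uphalf s.+1 <= i)%N -> la i = 0%N) ->
  tab_gf s.+1 la = \sum_(mu : {ffun 'I_(uphalf s) -> 'I_L.+1} | horizontal_strip (uphalf s)
    la (zero_ext mu))
    (\prod_(i < N) z s ^+ (la i - zero_ext mu i)) * tab_gf s (zero_ext mu).
Proof.
move=> sM sN la_dec laL la0; set m := uphalf s.
have mN : (m <= N)%N by apply: leq_trans sN; rewrite uphalf_half /m uphalf_half; lia.
(* h fills the cells of la that f leaves open with the letter s, h' empties
   them, and sh is the shape of the letters below s. *)
pose h (f : filling) : filling :=
  [ffun c => if (f c == M :> nat) && (c.2 < la c.1)%N then inord s else f c].
pose h' (f : filling) : filling := [ffun c => if f c == s :> nat then ord_max else f c].
pose sh (f : filling) : {ffun 'I_m -> 'I_L.+1} :=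
  [ffun i : 'I_m => inord #|[pred j : 'I_L | (f (widen_ord mN i, j) < s)%N]|].
have sE : (inord s : 'I_M.+1) = s :> nat by rewrite inordK // ltnW // ltnS.
rewrite /tab_gf (reindex_onto h h') /=; last first.
  move=> f /is_tabP[h1 h2 _ _]; apply/ffunP => -[i j]; apply: val_inj; rewrite !ffunE /=.
  case: (ltnP j (la i)) => [lt|ge]; last first.
    rewrite andbF; case: eqP => // e; move: sM; by rewrite -e (h2 i j ge) ltnn.
  have /andP[_ lts] := h1 i j lt.
  case: (nat_of_ord (f (i, j)) =P s) => [e|_]; first by rewrite eqxx /= sE e.
  by rewrite ltn_eqF ?(leq_trans lts).
have hE (f : filling) (i : 'I_N) (j : 'I_L) : h f (i, j) =
  (if (f (i, j) == M :> nat) && (j < la i)%N then s else f (i, j)) :> nat.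
  by rewrite ffunE /=; case: ifP.
have fromV (f : filling) : is_tab s.+1 la (h f) -> h' (h f) = f ->
    horizontal_strip m la (zero_ext (sh f)) /\ is_tab s (zero_ext (sh f)) f.
  move=> /is_tabP[h1 h2 h3 h4] /ffunP hK.
  have fE (i : 'I_N) (j : 'I_L) : f (i, j) =
    (if h f (i, j) == s :> nat then M else h f (i, j)) :> nat.
    by rewrite -{1}hK ffunE; case: ifP.
  have key (i : 'I_N) (j : 'I_L) : (f (i, j) < s)%N = (j < zero_ext (sh f) i)%N.
    have lt_hf j' : (f (i, j') < s)%N = (h f (i, j') < s)%N.
      by rewrite fE; case: ifP => // /eqP ->; rewrite ltnn ltnNge ltnW.
    have [im|mi] := ltnP i m; last first.
      rewrite zero_ext_ge // ltn0 lt_hf; apply/negbTE; rewrite -leqNgt.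
      have [lt|le] := ltnP j (la i); last by rewrite h2 // ltnW.
      have /andP[fl _] := h1 i j lt; apply: leq_trans fl.
      by move: mi; rewrite /m uphalf_half; have := odd_double_half s; lia.
    have -> : nat_of_ord i = Ordinal im by [].
    rewrite zero_ext_ord ffunE.
    have -> : widen_ord mN (Ordinal im) = i by apply: val_inj.
    rewrite inordK; last by rewrite ltnS -[X in (_ <= X)%N]card_ord max_card.
    rewrite -(downset_ord (P := [pred j | (f (i, j) < s)%N])) // => a b ab /=.
    rewrite !lt_hf; apply: leq_ltn_trans.
    by move: ab; rewrite leq_eqVlt => /orP[/eqP/val_inj -> //|/h3].
  have sub (i : 'I_N) (j : 'I_L) : (j < zero_ext (sh f) i)%N -> (j < la i)%N.
    rewrite -key => lt; rewrite ltnNge; apply/negP => le.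
    by move: lt; rewrite fE h2 // gtn_eqF // ltnNge ltnW.
  split.
    apply/forallP => i; have iN := leq_trans (ltn_ord i) mN.
    have muL := zero_ext_le (sh f) i.
    apply/andP; split; rewrite leqNgt; apply/negP => lt; last first.
      have ltL : (la i < L)%N by apply: leq_trans lt _.
      by have := sub (Ordinal iN) (Ordinal ltL) lt; rewrite /= ltnn.
    have ltL : (zero_ext (sh f) i < L)%N by apply: leq_trans lt _.
    have [ltN|geN] := ltnP i.+1 N; last by move: lt; rewrite la0 ?(leq_trans sN geN).
    have := h4 (Ordinal iN) (Ordinal ltN) (Ordinal ltL) (leqnn _) lt.
    have /andP[_ hs] := h1 (Ordinal ltN) (Ordinal ltL) lt.
    move=> hlt; have hfs := leq_trans hlt (hs : (_ <= s)%N).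
    by have := key (Ordinal iN) (Ordinal ltL); rewrite ltnn fE ltn_eqF ?hfs.
  apply/is_tabP; split=> [i j lt|i j le|i j j' lt|i i' j ii' lt].
  - have := key i j; rewrite lt => fs; rewrite fs andbT.
    have /andP[+ _] := h1 i j (sub _ _ lt); rewrite hE; case: ifP => // /andP[/eqP e].
    by move: fs; rewrite e ltnNge ltnW.
  - have := key i j; rewrite [X in _ = X]ltnNge le /= fE => /negbT; case: ifP => // ns.
    rewrite -leqNgt; have [jla|/h2 //] := ltnP j (la i).
    have /andP[_ hs] := h1 i j jla; move: ns; lia.
  - have rng : (h f (i, j') <= s)%N || (h f (i, j') == M :> nat).
      apply/orP; have [/h1/andP[_ lts]|/h2 ->] := ltnP j' (la i); by [left|right].
    move: rng; have := h3 i j j' lt; rewrite !fE; case: (nat_of_ord (h f (i, j)) =P s);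
      case: (nat_of_ord (h f (i, j')) =P s); move: (ltn_ord (h f (i, j'))); lia.
  have fs : (f (i', j) < s)%N by rewrite key.
  have := h4 i i' j ii' (sub _ _ lt); move: fs; rewrite !fE.
  case: eqP; case: eqP; lia.
have toV (f : filling) (mu : {ffun 'I_m -> 'I_L.+1}) : horizontal_strip m la (zero_ext mu)
  -> is_tab s (zero_ext mu) f ->
    [/\ is_tab s.+1 la (h f), h' (h f) = f & sh f = mu].
  move=> /forallP strip /is_tabP[g1 g2 g3 g4].
  have mu_la i : (zero_ext mu i <= la i)%N.
    have [im|mi] := ltnP i m; last by rewrite zero_ext_ge.
    by have /andP[] := strip (Ordinal im).
  have la_mu i : (la i.+1 <= zero_ext mu i)%N.
    have [im|mi] := ltnP i m; first by have /andP[] := strip (Ordinal im).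
    by rewrite la0 //; move: mi; rewrite /m !uphalf_half /=; have := odd_double_half s; lia.
  have hEin (i : 'I_N) (j : 'I_L) : (j < zero_ext mu i)%N -> h f (i, j) = f (i, j) :> nat.
    move=> lt; have /andP[_ fs] := g1 i j lt.
    by rewrite hE ltn_eqF // (ltn_trans fs).
  have hEout (i : 'I_N) (j : 'I_L) : (zero_ext mu i <= j)%N ->
      h f (i, j) = (if (j < la i)%N then s else M) :> nat.
    by move=> le; rewrite hE g2 // eqxx.
  split.
  - apply/is_tabP; split=> [i j lt|i j le|i j j' lt|i i' j ii' lt].
    + have [ltm|ge] := ltnP j (zero_ext mu i).
        by rewrite hEin //; have /andP[-> fs] := g1 i j ltm; rewrite ltnW.
      rewrite hEout // lt ltnS leqnn andbT.
      have iu : (i < uphalf s.+1)%N.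
        by rewrite ltnNge; apply/negP => /la0 e; rewrite e in lt.
      by move: iu; rewrite uphalf_half /=; have := odd_double_half s; lia.
    + by rewrite hEout ?(leq_trans (mu_la i)) // ltnNge le.
    + have [ltm|ge] := ltnP j (zero_ext mu i).
        rewrite hEin //; have [ltm'|ge'] := ltnP j' (zero_ext mu i).
          by rewrite hEin // g3.
        have /andP[_ fs] := g1 i j ltm.
        by rewrite hEout //; case: ifP => _; rewrite ltnW // (ltn_trans fs).
      rewrite !hEout ?(leq_trans ge (ltnW lt)) //.
      by case: ifP => h1; case: ifP => h2 //; [rewrite ltnW | move: h1 h2; lia].
    have jmu : (j < zero_ext mu i)%N.
      by apply: leq_trans lt (leq_trans _ (la_mu i)); apply: la_dec.
    rewrite hEin //; have [ltm'|ge'] := ltnP j (zero_ext mu i').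
      by rewrite hEin // g4.
    by rewrite hEout // lt; have /andP[] := g1 i j jmu.
  - apply/ffunP => -[i j]; apply: val_inj; rewrite ffunE.
    have [ltm|ge] := ltnP j (zero_ext mu i).
      rewrite hEin //; have /andP[_ fs] := g1 i j ltm.
      by rewrite ltn_eqF //= hEin.
    case: (nat_of_ord (h f (i, j)) =P s) => /=; first by rewrite g2.
    by rewrite hEout // g2 //; case: ifP.
  apply/ffunP => i; apply: val_inj; rewrite ffunE.
  have -> : #|[pred j : 'I_L | (f (widen_ord mN i, j) < s)%N]| = mu i.
    have muL : (mu i <= L)%N by rewrite -ltnS.
    rewrite -[RHS](card_ord_lt muL); apply: eq_card => j; rewrite !inE.
    rewrite -(zero_ext_ord mu i); have [ltm|ge] := ltnP j (zero_ext mu i).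
      by have /andP[_ ->] := g1 (widen_ord mN i) j ltm.
    by rewrite g2 // ltnNge ltnW.
  by rewrite /= inordK.
rewrite (partition_big sh (fun mu => horizontal_strip m la (zero_ext mu))) /=; last first.
  by move=> f /andP[t1 /eqP t2]; have [] := fromV f t1 t2.
apply: eq_bigr => mu strip; rewrite mulr_sumr.
apply: eq_big => [f|f].
  apply/idP/idP => [/andP[/andP[t1 /eqP t2] /eqP <-]|t]; first by have [] := fromV f t1 t2.
  by have [-> -> ->] := toV f mu strip t; rewrite !eqxx.
move=> /andP[/andP[t1 /eqP t2] /eqP shE]; have [] := fromV f t1 t2.
rewrite shE => _ /is_tabP[g1 g2 _ _].
rewrite big_mkcond [X in _ = _ * X]big_mkcond /=.
have -> : \prod_(i < N) z s ^+ (la i - zero_ext mu i)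
    = \prod_(c : 'I_N * 'I_L) (if (zero_ext mu c.1 <= c.2 < la c.1)%N then z s else 1).
  rewrite -(pair_bigA _ (fun (i : 'I_N) (j : 'I_L) =>
     if (zero_ext mu i <= j < la i)%N then z s else 1)) /=.
  apply: eq_bigr => i _; rewrite -big_mkcond (big_ord_itv _ _ (fun=> z s)) //.
  by rewrite prodr_const_nat.
rewrite -big_split; apply: eq_bigr => -[i j] _ /=.
have [ltm|ge] := ltnP j (zero_ext mu i).
  have /andP[_ fs] := g1 i j ltm.
  by rewrite hE ltn_eqF ?(ltn_trans fs) //= mul1r.
rewrite hE g2 // eqxx ltnn mulr1 /=.
by case: (j < la i)%N; rewrite ?sM ?ltnn ?ge.
Qed.

End Tableaux.

Section Symplectic.
Variables (K : fieldType) (x y : nat -> K) (q : K) (N L M : nat).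
Hypothesis xy : forall i, x i * y i = q.
Hypothesis x0 : forall i, x i != 0.
Hypothesis y0 : forall i, y i != 0.
Let c i m := x i ^+ m - y i ^+ m.
Let t i := x i + y i.
Let z r := if odd r then y r./2 else x r./2.

(** The sign of [spdelta] is changed to suit columns in decreasing order of
    exponents. *)
Definition spdelta_dec m :=
  (\prod_(i < m) (x i - y i)) * pairprod (fun i j : 'I_m => t i - t j).

Lemma spdelta_decS m : spdelta_dec m.+1
  = (x m - y m) * (spdelta_dec m * \prod_(i < m) (t i - t m)).
Proof.
rewrite /spdelta_dec big_ord_recr /= !pairprodE big_ord_recr /=.
have -> : \prod_(i < m.+1 | (i < m)%N) (t i - t m) = \prod_(i < m) (t i - t m).
  by rewrite big_mkcond big_ord_recr /= ltnn mulr1; apply: eq_bigr => i _; rewrite ltn_ord.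
have -> : \prod_(j < m) \prod_(i < m.+1 | (i < j)%N) (t i - t j)
   = \prod_(j < m) \prod_(i < m | (i < j)%N) (t i - t j).
  apply: eq_bigr => j _; rewrite big_mkcond big_ord_recr /= ltnNge ltnW //= mulr1.
  by rewrite -big_mkcond.
by rewrite -mulrA mulrCA !mulrA.
Qed.

Definition sp_even (la : nat -> nat) m : K :=
  \det (\matrix_(i < m, j < m) c i (la j + m - j)).

(** The determinant that takes the role of [sp_even] after the unbarred letter m:
    its last row stems from the row of ones of [det_diff_cols_bordered]. *)
Definition sp_odd (nu : nat -> nat) m : K :=
  \det (\matrix_(i < m.+1, j < m.+1)
     (if unlift ord_max i is Some i' then
        c i' (nu j + m.+1 - j) - y m * c i' (nu j + m - j)
      else x m ^+ (nu j + m - j))).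

(** For z = x_i or z = y_i, t_m - t_i = (x_m - z) (1 - y_m / z).  The first factor
    makes the sum over the cells with letter m telescope, the second one that
    over the cells with its barred version. *)
Lemma three_term i m b : (0 < b)%N ->
  (t i - t m) * c i b =
   (c i b.+1 - y m * c i b) - x m * (c i b - y m * c i b.-1).
Proof.
case: b => // b _; rewrite /t /c /= !exprS.
have := xy i; have := xy m; move: (x i ^+ b) (y i ^+ b) => X Y.
move: (x i) (y i) (x m) (y m) => a a' d d' e e'.
transitivity ((a + a') * (a * X - a' * Y) - (d + d') * (a * X - a' * Y)); first by ring.
have -> : (a + a') * (a * X - a' * Y) = a * (a * X) - a' * (a' * Y) + a * a' * (X - Y) by ring.
by rewrite e' -e; ring.
Qed.

(** The product of the t i - t m is put into the rows; by [three_term] every sum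
    over an interval then becomes the difference of two neighbouring columns. *)
Lemma sp_odd_step m (nu : nat -> nat) : (forall i, nu i <= L)%N ->
    {homo nu : i j / (i <= j)%N >-> (j <= i)%N} -> (m < N)%N ->
    (forall i, (m < i)%N -> nu i = 0%N) ->
  \sum_(mu : {ffun 'I_m -> 'I_L.+1} | horizontal_strip m nu (zero_ext mu))
     (\prod_(i < N) x m ^+ (nu i - zero_ext mu i)) * sp_even (zero_ext mu) m
    * \prod_(i < m) (t i - t m)
  = sp_odd nu m.
Proof.
move=> nuL nu_dec mN nu0.
pose a j := (nu j + m - j)%N.
pose C (i : 'I_m) j := (x m ^- (a j)) * (c i (a j).+1 - y m * c i (a j)).
transitivity ((\prod_(j < m.+1) x m ^+ a j) * \det
  (\matrix_(i < m, j < m) (C i j - C i j.+1))).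
  have cell (mu : {ffun 'I_m -> 'I_L.+1}) : horizontal_strip m nu (zero_ext mu) ->
      \prod_(i < N) x m ^+ (nu i - zero_ext mu i) * sp_even (zero_ext mu) m
         * \prod_(i < m) (t i - t m)
      = (\prod_(j < m.+1) x m ^+ a j) * ((\prod_(j < m) x m ^- (mu j + m - j))
        * \det (\matrix_(i < m, j < m) ((t i - t m) * c i (mu j + m - j)))).
    move=> strip.
    rewrite det_scale_rows -mulrA [sp_even _ _ * _]mulrC !mulrA; congr (_ * _ * _).
      have mu_nu i : (zero_ext mu i <= nu i)%N.
        have [im|mi] := ltnP i m; last by rewrite zero_ext_ge.
        by have /andP[] := forallP strip (Ordinal im).
      transitivity (\prod_(i < m.+1) x m ^+ (nu i - zero_ext mu i)).
        rewrite [RHS](big_ord_widen N (fun i => x m ^+ (nu i - zero_ext mu i))) //.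
        rewrite [RHS]big_mkcond; apply: eq_bigr => i _; case: ltnP => // mi.
        by rewrite nu0.
      rewrite !big_ord_recr /= mulrAC zero_ext_ge // subn0 /a addnK; congr (_ * _).
      rewrite -big_split; apply: eq_bigr => j _ /=; rewrite zero_ext_ord.
      have -> : (nu j + m - j = (nu j - mu j) + (mu j + m - j))%N.
        by have := mu_nu j; rewrite zero_ext_ord; have := ltn_ord j; lia.
      by rewrite exprD mulfK // expf_neq0.
    by congr (\det _); apply/matrixP => i j; rewrite !mxE zero_ext_ord.
  rewrite (eq_bigr _ cell) -mulr_sumr; congr (_ * _).
  transitivity (\det (\matrix_(i < m, j < m) \sum_(v : 'I_L.+1 | (nu j.+1 <= v < (nu j).+1)%N)
      x m ^- (v + m - j) * ((t i - t m) * c i (v + m - j)))).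
    rewrite -(sum_det_cols (fun (j : 'I_m) (v : 'I_L.+1) => (nu j.+1 <= v < (nu j).+1)%N)
      (fun (j : 'I_m) (v : 'I_L.+1) => x m ^- (v + m - j))
      (fun i j (v : 'I_L.+1) => (t i - t m) * c i (v + m - j))).
    by apply: eq_bigl => mu; apply: eq_forallb => j; rewrite zero_ext_ord ltnS.
  congr (\det _); apply/matrixP => i j; rewrite !mxE.
  pose H v := - (x m ^- (v + m - j).-1 * (c i (v + m - j) - y m * c i (v + m - j).-1)).
  have jm := ltn_ord j.
  transitivity (\sum_(v < L.+1 | (nu j.+1 <= v < (nu j).+1)%N) (H v - H v.+1)).
    apply: eq_bigr => v _; rewrite three_term; last by lia.
    rewrite /H; have -> : (v.+1 + m - j = (v + m - j).+1)%N by lia.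
    have -> : (v + m - j = (v + m - j).-1.+1)%N by lia.
    rewrite /= exprS; move: (c i _) (c i _) (c i _) => c1 c2 c3.
    by field; rewrite x0 expf_neq0.
  rewrite sum_ord_telescope ?ltnS ?nuL ?andbT; last by rewrite
    (leq_trans (nu_dec _ _ (leqnSn j))).
  rewrite /H /C /a opprK addrC.
  have -> : ((nu j).+1 + m - j = (nu j + m - j).+1)%N by lia.
  have -> : (nu j.+1 + m - j = (nu j.+1 + m - j.+1).+1)%N by lia.
  by [].
rewrite det_diff_cols_bordered -det_scale_cols; congr (\det _).
apply/matrixP => i j; rewrite !mxE; case: unlift => [i'|]; last by rewrite mulr1.
rewrite /C /a mulrA mulfV ?expf_neq0 // mul1r.
by have -> : (nu j + m.+1 - j = (nu j + m - j).+1)%N by have := ltn_ord j; lia.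
Qed.

(** In the rows i < m the summand is a difference by the shape of [sp_odd]; the
    factor x m - y m does the same for the last row. *)
Lemma sp_even_step m (la : nat -> nat) : (forall i, la i <= L)%N ->
    {homo la : i j / (i <= j)%N >-> (j <= i)%N} -> (m < N)%N ->
    (forall i, (m < i)%N -> la i = 0%N) ->
  \sum_(nu : {ffun 'I_m.+1 -> 'I_L.+1} | horizontal_strip m.+1 la (zero_ext nu))
     (\prod_(i < N) y m ^+ (la i - zero_ext nu i)) * sp_odd (zero_ext nu) m * (x m - y m)
  = sp_even la m.+1.
Proof.
move=> laL la_dec mN la0.
pose l j := (la j + m.+1 - j)%N.
pose V (i e : nat) := y m ^- e * c i e.
transitivity ((\prod_(j < m.+1) y m ^+ l j)
   * \det (\matrix_(i < m.+1, j < m.+1) (V i (l j) - V i (l j.+1)))).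
  have cell (nu : {ffun 'I_m.+1 -> 'I_L.+1}) : horizontal_strip m.+1 la (zero_ext nu) ->
      \prod_(i < N) y m ^+ (la i - zero_ext nu i) * sp_odd (zero_ext nu) m * (x m - y m)
      = (\prod_(j < m.+1) y m ^+ l j) * ((\prod_(j < m.+1) y m ^- (nu j + m.+1 - j))
        * \det (\matrix_(i < m.+1, j < m.+1)
            (c i (nu j + m.+1 - j) - y m * c i (nu j + m - j)))).
    move=> strip; rewrite -mulrA [RHS]mulrA; congr (_ * _).
      transitivity (\prod_(i < m.+1) y m ^+ (la i - zero_ext nu i)).
        rewrite [RHS](big_ord_widen N (fun i => y m ^+ (la i - zero_ext nu i))) //.
        rewrite [RHS]big_mkcond; apply: eq_bigr => i _; case: ltnP => // mi.
        by rewrite la0.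
      rewrite -big_split; apply: eq_bigr => j _ /=; rewrite zero_ext_ord /l.
      have -> : (la j + m.+1 - j = (la j - nu j) + (nu j + m.+1 - j))%N.
        have /andP[_] := forallP strip j.
        by rewrite zero_ext_ord; have := ltn_ord j; lia.
      by rewrite exprD mulfK // expf_neq0.
    rewrite /sp_odd mulrC.
    pose g (i : 'I_m.+1) := if unlift ord_max i is Some _ then 1 else x m - y m.
    have <- : \prod_i g i = x m - y m.
      rewrite (bigD1_ord ord_max) //= {1}/g unlift_none big1 ?mulr1 // => i _.
      by rewrite /g liftK.
    rewrite -det_scale_rows; congr (\det _); apply/matrixP => i j; rewrite !mxE
      !zero_ext_ord /g.
    case: unliftP => [i' ->|->]; first by rewrite mul1r lift_max.
    have -> : (nu j + m.+1 - j = (nu j + m - j).+1)%N by have := ltn_ord j; lia.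
    rewrite /c /= !exprS; ring.
  rewrite (eq_bigr _ cell) -mulr_sumr; congr (_ * _).
  transitivity (\det (\matrix_(i < m.+1, j < m.+1)
      \sum_(v : 'I_L.+1 | (la j.+1 <= v < (la j).+1)%N)
      y m ^- (v + m.+1 - j) * (c i (v + m.+1 - j) - y m * c i (v + m - j)))).
    rewrite -(sum_det_cols (fun (j : 'I_m.+1) (v : 'I_L.+1) => (la j.+1 <= v < (la j).+1)%N)
      (fun (j : 'I_m.+1) (v : 'I_L.+1) => y m ^- (v + m.+1 - j))
      (fun i j (v : 'I_L.+1) => c i (v + m.+1 - j) - y m * c i (v + m - j))).
    by apply: eq_bigl => mu; apply: eq_forallb => j; rewrite zero_ext_ord ltnS.
  congr (\det _); apply/matrixP => i j; rewrite !mxE.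
  pose H v := - V i (v + m - j)%N.
  have jm := ltn_ord j.
  transitivity (\sum_(v < L.+1 | (la j.+1 <= v < (la j).+1)%N) (H v - H v.+1)).
    apply: eq_bigr => v _; rewrite /H /V.
    have -> : (v + m.+1 - j = (v + m - j).+1)%N by lia.
    have -> : (v.+1 + m - j = (v + m - j).+1)%N by lia.
    rewrite exprS; move: (c i _) (c i _) => c1 c2.
    by field; rewrite y0 expf_neq0.
  rewrite sum_ord_telescope ?ltnS ?laL ?andbT; last by rewrite
    (leq_trans (la_dec _ _ (leqnSn j))).
  rewrite /H opprK addrC /l.
  have -> : ((la j).+1 + m - j = la j + m.+1 - j)%N by lia.
  by have -> : (la j.+1 + m - j = la j.+1 + m.+1 - j.+1)%N by lia.
rewrite (det_diff_cols (F := fun i j => V i (l j))); last first.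
  by move=> i; rewrite /l la0 // add0n subnn /V /c !expr0 subrr mulr0.
rewrite -det_scale_cols; congr (\det _); apply/matrixP => i j; rewrite !mxE /V.
by rewrite mulrA mulfV ?expf_neq0 // mul1r.
Qed.

(** The Weyl character formula, by induction on the number of pairs of letters. *)
Theorem tab_gf_det m (la : nat -> nat) : (m <= N)%N -> (2 * m <= M)%N ->
    (forall i, la i <= L)%N -> {homo la : i j / (i <= j)%N >-> (j <= i)%N} ->
    (forall i, (m <= i)%N -> la i = 0%N) ->
  tab_gf z N L M (2 * m) la * spdelta_dec m = sp_even la m.
Proof.
elim: m la => [|m IHm] la mN mM laL la_dec la0.
  rewrite /sp_even det_mx00 /spdelta_dec big_ord0 /pairprod big1 => [|[[]] //].
  rewrite !mulr1 /tab_gf (big_pred1 [ffun=> ord_max]) => [|f].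
    by rewrite big1 // => c0; rewrite ffunE ltnn.
  apply/is_tabP/eqP => [[_ h _ _]|-> ].
    by apply/ffunP => -[i j]; apply: val_inj; rewrite ffunE /= h ?la0.
  by split=> [i j|i j _|i j j' _|i i' j _]; rewrite ?la0 // !ffunE.
have um : uphalf (2 * m) = m by rewrite mul2n uphalf_double.
have um1 : uphalf (2 * m).+1 = m.+1 by rewrite mul2n /= doubleK.
have um2 : uphalf (2 * m).+2 = m.+1 by rewrite mul2n /= uphalf_double.
have -> : (2 * m.+1 = (2 * m).+2)%N by lia.
have recE s k la' : uphalf s = k -> (s < M)%N -> (uphalf s.+1 <= N)%N ->
    {homo la' : i j / (i <= j)%N >-> (j <= i)%N} -> (forall i, la' i <= L)%N ->
    (forall i, (uphalf s.+1 <= i)%N -> la' i = 0%N) ->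
  tab_gf z N L M s.+1 la' = \sum_(mu : {ffun 'I_k -> 'I_L.+1} | horizontal_strip k la'
    (zero_ext mu))
    (\prod_(i < N) z s ^+ (la' i - zero_ext mu i)) * tab_gf z N L M s (zero_ext mu).
  by move=> <-; exact: tab_gf_rec.
have z1 : z (2 * m).+1 = y m by rewrite /z mul2n /= odd_double /= uphalf_double.
have z0 : z (2 * m) = x m by rewrite /z mul2n odd_double doubleK.
rewrite (recE _ _ _ um1) ?um2 //; last by lia.
rewrite -(sp_even_step laL la_dec mN) // spdelta_decS mulr_suml z1.
have ext_dec k (la' : nat -> nat) (mu : {ffun 'I_k -> 'I_L.+1}) :
    {homo la' : i j / (i <= j)%N >-> (j <= i)%N} -> horizontal_strip k la' (zero_ext mu) ->
    {homo zero_ext mu : i j / (i <= j)%N >-> (j <= i)%N}.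
  move=> dec strip i j; rewrite leq_eqVlt => /orP[/eqP -> //|ij].
  have [jk|kj] := ltnP j k; last by rewrite zero_ext_ge.
  have /andP[_ h2] := forallP strip (Ordinal jk).
  have /andP[h1 _] := forallP strip (Ordinal (ltn_trans ij jk)).
  by apply: leq_trans h2 (leq_trans _ h1); apply: dec.
apply: eq_bigr => nu strip.
have nu_dec := ext_dec _ _ _ la_dec strip.
have nuL i := zero_ext_le nu i.
have nu0 i : (m < i)%N -> zero_ext nu i = 0%N by apply: zero_ext_ge.
rewrite -(sp_odd_step nuL nu_dec mN nu0) (recE _ _ _ um) ?um1 //; last by lia.
rewrite z0 -!mulrA; congr (_ * _).
rewrite !mulr_suml; apply: eq_bigr => mu strip'.
rewrite -(IHm (zero_ext mu)) //.
- by rewrite -!mulrA; congr (_ * (_ * _)); rewrite mulrC -!mulrA.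
- exact: ltnW.
- by lia.
- exact: zero_ext_le.
- exact: ext_dec nu_dec strip'.
by move=> i; exact: zero_ext_ge.
Qed.

End Symplectic.

Section Cells.
Variable la : seq nat.

Definition cell_at (i j : nat) : option (cells la) :=
  if insub i : option 'I_(size la) is Some r then
    if insub j : option 'I_(nth 0%N la r) is Some c
    then Some (Tagged (fun r : 'I_(size la) => 'I_(nth 0%N la r)) c) else None
  else None.

Lemma cell_atK (c : cells la) : cell_at (tag c) (tagged c) = Some c.
Proof. by case: c => r c; rewrite /cell_at /= valK valK. Qed.

Lemma cell_at_some i j : (j < nth 0%N la i)%N ->
  exists c : cells la, [/\ tag c = i :> nat, tagged c = j :> nat & cell_at i j = Some c].
Proof.
move=> lt; have isz : (i < size la)%N.
  by rewrite ltnNge; apply/negP => le; rewrite nth_default in lt.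
exists (Tagged (fun r : 'I_(size la) => 'I_(nth 0%N la r))
  (Ordinal lt : 'I_(nth 0%N la (Ordinal isz)))); split=> //.
exact: (cell_atK (Tagged (fun r : 'I_(size la) => 'I_(nth 0%N la r))
  (Ordinal lt : 'I_(nth 0%N la (Ordinal isz))))).
Qed.

Lemma cell_at_none i j : (nth 0%N la i <= j)%N -> cell_at i j = None.
Proof.
by move=> le; rewrite /cell_at; case: insubP => // r _ ri; rewrite insubF // ri ltnNge le.
Qed.

Lemma tag_lt (c : cells la) : (tagged c < nth 0%N la (tag c))%N.
Proof. exact: ltn_ord. Qed.

End Cells.

Section SpTab.
Variables (K : fieldType) (n' : nat) (x y : nat -> K) (la : seq nat) (L : nat).
Let n := n'.+1.
Let z r := if odd r then y r./2 else x r./2.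
Hypothesis la_size : (size la <= n)%N.
Hypothesis laL : forall i, (nth 0%N la i <= L)%N.
Hypothesis la_dec : {homo nth 0%N la : i j / (i <= j)%N >-> (j <= i)%N}.

Lemma rank_lt (l : letter n) : (rank l < 2 * n)%N.
Proof. by case: l => i b; rewrite /rank /=; have := ltn_ord i; case: b => /=; lia. Qed.

Lemma rank_inj : injective (@rank n).
Proof.
move=> [i b] [i' b']; rewrite /rank /= => e.
have eb : b = b' by case: b b' e => -[] //=; lia.
by congr (_, _) => //; apply: val_inj; move: e; rewrite eb /=; lia.
Qed.

Lemma rank_ex r : (r < 2 * n)%N -> exists l : letter n, rank l = r.
Proof.
move=> rn; have rh : (r./2 < n)%N by have := odd_double_half r; lia.
exists (Ordinal rh, odd r); rewrite /rank /=.
by rewrite -[RHS]odd_double_half addnC mul2n.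
Qed.

Lemma sp_cells : sp la (fun i : 'I_n => x i) (fun i : 'I_n => y i)
  = \sum_(t : {ffun cells la -> letter n} | is_symplectic t) \prod_c z (rank (t c)).
Proof.
apply: eq_bigr => t _; rewrite (partition_big t xpredT) //=.
rewrite -(pair_bigA _ (fun (i : 'I_n) (b : bool) => \prod_(c | t c == (i, b)) z
  (rank (t c)))) /=.
have cnt (i : 'I_n) b : \prod_(c | t c == (i, b)) z (rank (t c))
    = z (2 * i + b)%N ^+ #|[set c | t c == (i, b)]|.
  rewrite -prodr_const; apply: eq_big => [c|c /eqP ->] //; by rewrite inE.
apply: eq_bigr => i _; rewrite big_bool mulrC !cnt /z.
by rewrite mul2n addn0 addn1 /= odd_double uphalf_double doubleK.
Qed.

Theorem sp_tab_gf : sp la (fun i : 'I_n => x i) (fun i : 'I_n => y i)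
  = tab_gf z n L (2 * n) (2 * n) (nth 0%N la).
Proof.
rewrite sp_cells /tab_gf.
pose h (t : {ffun cells la -> letter n}) : filling n L (2 * n) :=
  [ffun p : 'I_n * 'I_L => if cell_at la p.1 p.2 is Some c then inord (rank (t c)) else
    ord_max].
have rowlt (c : cells la) : (tag c < n)%N by apply: leq_trans la_size.
have collt (c : cells la) : (tagged c < L)%N by apply: leq_trans (tag_lt c) (laL _).
pose pc (c : cells la) : 'I_n * 'I_L := (Ordinal (rowlt c), Ordinal (collt c)).
pose h' (f : filling n L (2 * n)) : {ffun cells la -> letter n} :=
  [ffun c => odflt (ord0, false) [pick l | rank l == f (pc c) :> nat]].
have hin (t : {ffun cells la -> letter n}) c : h t (pc c) = rank (t c) :> nat.
  by rewrite ffunE /= cell_atK inordK // ltnS ltnW // rank_lt.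
have hout (t : {ffun cells la -> letter n}) (i : 'I_n) (j : 'I_L) :
   (nth 0%N la i <= j)%N -> h t (i, j) = (2 * n)%N :> nat.
  by move=> le; rewrite ffunE /= cell_at_none.
have inP (i : 'I_n) (j : 'I_L) : (j < nth 0%N la i)%N -> exists c, (i, j) = pc c.
  move=> /cell_at_some[c [ci cj _]]; exists c.
  by congr (_, _); apply: val_inj.
rewrite [RHS](reindex_onto h h') /=; last first.
  move=> f /is_tabP[h1 h2 _ _]; apply/ffunP => -[i j]; apply: val_inj => /=.
  have [lt|ge] := ltnP j (nth 0%N la i); last by rewrite hout // h2.
  have [c ijc] := inP i j lt; rewrite ijc hin ffunE; case: pickP => [l /eqP //|none].
  have /andP[_ /rank_ex[l rl]] := h1 i j lt.
  by have := none l; rewrite -ijc rl eqxx.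
apply: eq_big => [t|t st].
  have -> : h' (h t) == t.
    apply/eqP/ffunP => c; rewrite ffunE; case: pickP => [l /eqP|none].
      by rewrite hin => /rank_inj.
    by have := none (t c); rewrite hin eqxx.
  rewrite andbT; apply/andP/is_tabP => [[/forallP h1 /forallP h2]|[h1 h2 h3 h4]].
    split=> [i j lt|i j ge|i j j' lt|i i' j ii' lt].
    + have [c e] := inP i j lt; rewrite e hin rank_lt andbT.
      by move: e => [-> _]; exact: h1.
    + exact: hout.
    + have [ltj|gej] := ltnP j' (nth 0%N la i); last by rewrite (hout _ _ _ gej) -ltnS.
      have [c e] := inP i j' ltj; have [c' e'] := inP i j (ltn_trans lt ltj).
      rewrite e e' !hin; have /forallP/(_ c)/andP[/implyP + _] := h2 c'; apply.
      move: e e' => [ei ej] [ei' ej']; rewrite -(inj_eq val_inj) /=.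
      have := congr1 val ei; have := congr1 val ei'; have := congr1 val ej; have := congr1
        val ej'.
      by rewrite /= => <- <- <- <-; rewrite eqxx.
    have [c e] := inP i' j lt.
    have [c' e'] := inP i j (leq_trans lt (la_dec (ltnW ii'))).
    rewrite e e' !hin; have /forallP/(_ c)/andP[_ /implyP +] := h2 c'; apply.
    move: e e' => [ei ej] [ei' ej'].
    have := congr1 val ei; have := congr1 val ei'; have := congr1 val ej; have := congr1
      val ej'.
    by rewrite /= => <- <- <- <-; rewrite ii' eqxx.
  split; apply/forallP => c.
    by have /andP[+ _] := h1 (pc c).1 (pc c).2 (tag_lt c); rewrite hin.
  apply/forallP => c'; apply/andP; split; apply/implyP => /andP[h5 h6].
    have e : pc c' = ((pc c).1, (pc c').2).
      by congr (_, _); apply: val_inj; rewrite /= (eqP h5).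
    by rewrite -!hin e; apply: (h3 (pc c).1 (pc c).2 (pc c').2).
  have e : pc c = ((pc c).1, (pc c').2).
    by congr (_, _); apply: val_inj; rewrite /= (eqP h6).
  by rewrite -!hin e; apply: (h4 (pc c).1 (pc c').1 (pc c').2 h5 (tag_lt c')).
rewrite [RHS](reindex_omap pc (fun p => cell_at la p.1 p.2)) /=.
  by apply: eq_big => [c|c _]; rewrite ?cell_atK ?eqxx hin ?rank_lt.
move=> [i j] /= lt; have [ltj|ge] := ltnP j (nth 0%N la i).
  have [c [ci cj ->]] := cell_at_some ltj; rewrite /=; congr Some.
  by congr (_, _); apply: val_inj.
by move: lt; rewrite hout // ltnn.
Qed.

End SpTab.

(** * The staircase determinant and Gelfand-Tsetlin patterns *)

Definition conj_count r (ka : 'I_r -> nat) (j : nat) : nat :=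
    #|[pred s : 'I_r | (j < ka s)%N]|.

(** The usual equivalence between a partition and its conjugate; as [ka] is in
    increasing order, s counts parts from the smallest. *)
Lemma conj_count_galois r (ka : 'I_r -> nat) j (s : 'I_r) :
  {homo ka : a b / (a <= b)%N} -> (j < ka s)%N = (r - s.+1 < conj_count ka j)%N.
Proof.
move=> inc; pose P := [pred s : 'I_r | (j < ka (rev_ord s))%N].
have := @downset_ord r P _ (rev_ord s); rewrite /= rev_ordK => ->; last first.
  by move=> a b ab /=; move/leq_trans; apply; apply: inc => /=; lia.
by congr (_ < _)%N; rewrite /conj_count -[RHS]card_rev_ord; apply: eq_card => a.
Qed.

Lemma conj_count_le r (ka : 'I_r -> nat) j : (conj_count ka j <= r)%N.
Proof. by rewrite -[X in (_ <= X)%N]card_ord max_card. Qed.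

Lemma conj_count_dec r (ka : 'I_r -> nat) :
    {homo conj_count ka : i j / (i <= j)%N >-> (j <= i)%N}.
Proof.
move=> i j ij; apply: subset_leq_card; apply/subsetP => s; rewrite !inE.
exact: leq_ltn_trans.
Qed.

Lemma sum_conj_count n r (ka : 'I_r -> nat) : (forall s, ka s <= n)%N ->
  (\sum_(j < n) conj_count ka j = \sum_s ka s)%N.
Proof.
move=> kan; transitivity (\sum_(j < n) \sum_s (if (j < ka s)%N then 1 else 0))%N.
  by apply: eq_bigr => j _; rewrite -big_mkcond sum1_card.
rewrite exchange_big /=; apply: eq_bigr => s _.
rewrite -big_mkcond; apply: etrans (big_ord_itv _ 0 (fun=> 1%N) (kan s)) _.
by rewrite sum_nat_const_nat muln1 subn0.
Qed.

Lemma card_rev_lt r m : (m <= r.+1)%N -> #|[pred s : 'I_r.+1 | (r - s < m)%N]| = m.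
Proof.
move=> mr; rewrite -[RHS](card_ord_lt mr) -[RHS]card_rev_ord.
by apply: eq_card => a; rewrite !inE /= ?subSS.
Qed.

Lemma conj_count_lift r (b : 'I_r.+1 -> nat) (p : 'I_r.+1) j :
  conj_count b j = ((j < b p) + conj_count (fun s => b (lift p s)) j)%N.
Proof.
rewrite /conj_count -!sum1_card big_mkcond (bigD1_ord p) //= [in RHS]big_mkcond.
by congr (_ + _)%N; rewrite inE; case: ltnP.
Qed.

Lemma conj_count_mono r (a b : 'I_r -> nat) j : (forall s, a s <= b s)%N ->
    (conj_count a j <= conj_count b j)%N.
Proof.
by move=> ab; apply: subset_leq_card; apply/subsetP => s; rewrite !inE => /leq_trans; apply.
Qed.

Section Expansion.
Variables (K : fieldType) (w : K) (x y : nat -> K) (n : nat).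

(** The image of t^e (t + w)^k under p |-> p(x_i) - p(y_i). *)
Definition stair_entry i e k := x i ^+ e * (x i + w) ^+ k - y i ^+ e * (y i + w) ^+ k.

(** Column j comes from a polynomial of which min (n - j, k) factors t + w remain
    to be expanded.  For k = n and [la] = 0 the columns are
    f(x_i)^(n - j) - f(y_i)^(n - j); for k = 0 this is [sp_even]. *)
Definition stair_det k (la : 'I_n -> nat) :=
  \det (\matrix_(i < n, j < n) stair_entry i (la j + n - j) (minn (n - j) k)).

Lemma stair_det_collide k (la : 'I_n -> nat) (j j' : 'I_n) : j' = j.+1 :> nat -> la j' =
    (la j).+1 ->
    (k <= n - j')%N -> stair_det k la = 0.
Proof.
move=> jj' laj kn; rewrite /stair_det -det_tr.
apply: (determinant_alternate (i1 := j) (i2 := j')); first by rewrite -val_eqE /= jj'; lia.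
move=> i; rewrite !mxE laj jj'; congr (stair_entry _ _ _); move: kn; rewrite jj'; lia.
Qed.

(** One factor t + w is expanded in each of the columns up to r; [ep j] records
    that its term t was taken. *)
Lemma stair_det_expand r (la : 'I_n -> nat) : (r < n)%N ->
  stair_det (n - r) la =
  \sum_(ep : {ffun 'I_n -> bool} | [forall j, ep j ==> (j <= r)%N])
    (\prod_(j < n) w ^+ ((j <= r) - ep j))
    * stair_det (n - r.+1) (fun j => la j + ep j)%N.
Proof.
move=> rn.
rewrite (sum_det_cols (fun (j : 'I_n) v => v ==> (j <= r)%N)
    (fun (j : 'I_n) (v : bool) => w ^+ ((j <= r) - v))
    (fun i j (v : bool) => stair_entry i (la j + v + n - j) (minn (n - j) (n - r.+1)))).
congr (\det _); apply/matrixP => i j; rewrite !mxE.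
have jn := ltn_ord j.
rewrite big_mkcond big_bool /=; case: leqP => jr /=.
    have -> : minn (n - j) (n - r) = (n - r.+1).+1 by lia.
    have -> : minn (n - j) (n - r.+1) = (n - r.+1)%N by lia.
    have -> : (la j + 1 + n - j = (la j + n - j).+1)%N by lia.
    rewrite addn0 /stair_entry !exprS; ring.
have -> : minn (n - j) (n - r) = (n - j)%N by lia.
have -> : minn (n - j) (n - r.+1) = (n - j)%N by lia.
by rewrite addn0 add0r mul1r.
Qed.

Definition gt_step r (ka : 'I_r -> nat) (b : 'I_r.+1 -> nat) :=
  [forall s, (b (lift ord_max s) <= ka s <= b (lift ord0 s))%N] && (b ord_max <= r.+1)%N.
Hypothesis w0 : w != 0.

(** If [ep] added to the conjugate of [ka] does not give a partition, two columns
    agree and the term vanishes.  Otherwise a vertical strip is added to the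
    conjugate, and a horizontal strip to [ka], which is interlacing with [b]. *)
Lemma stair_det_gt_step r (ka : 'I_r -> nat) : (r < n)%N ->
    {homo ka : a b / (a <= b)%N} -> (forall s, ka s <= r)%N ->
  stair_det (n - r) (fun j => conj_count ka j) =
  \sum_(b : {ffun 'I_r.+1 -> 'I_n.+1} | gt_step ka (fun s => b s))
    w ^+ r.+1 * w ^+ (\sum_s ka s) * w ^- (\sum_s b s)
    * stair_det (n - r.+1) (fun j => conj_count (fun s => b s : nat) j).
Proof.
move=> rn inc kar; rewrite stair_det_expand //.
pose la' (ep : {ffun 'I_n -> bool}) (j : 'I_n) := (conj_count ka j + ep j)%N.
pose dec ep := [forall i : 'I_n, forall j : 'I_n, (i <= j)%N ==> (la' ep j <= la' ep i)%N].
rewrite (bigID dec) /= [X in _ + X]big1 ?addr0; last first.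
  move=> ep /andP[/forallP supp ndec].
  have [i [j [ij lt]]] : exists i j : 'I_n, j = i.+1 :> nat /\ (la' ep i < la' ep j)%N.
    have [/existsP[i /existsP[j /andP[/eqP ij lt]]]|nex] := boolP [exists i : 'I_n,
        [exists j : 'I_n, (j == i.+1 :> nat) && (la' ep i < la' ep j)%N]].
      by exists i, j.
    case/negP: ndec; apply/forallP => i; apply/forallP => j; apply/implyP.
    apply: (@ord_homo_adjacent n geq (la' ep)) => [a|a b c ba ac|a b ab].
    - exact: leqnn.
    - exact: leq_trans ac ba.
    rewrite /geq /= leqNgt; apply: contra nex => lt.
    by apply/existsP; exists a; apply/existsP; exists b; rewrite ab eqxx lt.
  have := conj_count_dec ka (_ : (i <= j)%N); rewrite ij => /(_ (leqnSn i)) cd.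
  have epj : ep j.
    by move: lt cd; rewrite /la' ij; case: (ep i); case: (ep j) => //=; lia.
  have jr := implyP (supp j) epj.
  rewrite (@stair_det_collide _ _ i j) ?mulr0 //; last by lia.
  by move: lt cd; rewrite /la' ij epj; case: (ep i) => /=; lia.
(* In terms of la' ep, the partition that ep leads to, h' ep is its conjugate. *)
pose h (b : {ffun 'I_r.+1 -> 'I_n.+1}) : {ffun 'I_n -> bool} :=
  [ffun j : 'I_n => (conj_count ka j < conj_count (fun s => b s : nat) j)%N].
pose h' (ep : {ffun 'I_n -> bool}) : {ffun 'I_r.+1 -> 'I_n.+1} :=
  [ffun s : 'I_r.+1 => inord #|[pred j : 'I_n | (r - s < la' ep j)%N]|].
have h'E ep (s : 'I_r.+1) (j : 'I_n) : dec ep -> (j < h' ep s)%N = (r - s < la' ep j)%N.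
  move=> /forallP de; rewrite ffunE inordK; last first.
    by rewrite ltnS -[X in (_ <= X)%N]card_ord max_card.
  rewrite -(downset_ord (P := [pred j : 'I_n | (r - s < la' ep j)%N])) // => a b ab /=.
  by have /forallP/(_ b)/implyP/(_ ab) := de a => le lt; apply: leq_trans lt le.
have conj_h' ep (j : 'I_n) : dec ep -> conj_count (fun s => h' ep s : nat) j = la' ep j.
  move=> de; rewrite /conj_count -[RHS](@card_rev_lt r); last first.
    by rewrite /la'; have := conj_count_le ka j; case: (ep j); lia.
  by apply: eq_card => s; rewrite !inE h'E.
rewrite (reindex_onto h h') /=; last first.
  move=> ep /andP[_ de]; apply/ffunP => j; rewrite ffunE conj_h' // /la'.
  by case: (ep j); rewrite ?addn0 ?ltnn // addn1 ltnS leqnn.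
have step_facts (b : {ffun 'I_r.+1 -> 'I_n.+1}) : gt_step ka (fun s => b s) ->
   {homo (fun s => b s : nat) : a c / (a <= c)%N}
   /\ (forall j : 'I_n, la' (h b) j = conj_count (fun s => b s : nat) j).
  move=> /andP[/forallP il _]; split.
    apply: (@ord_homo_adjacent _ leq) => [a|a c d|a c ac]; [exact: leqnn|exact: leq_trans|].
    have ar : (a < r)%N by rewrite -ltnS -ac ltn_ord.
    have /andP[] := il (Ordinal ar).
    have -> : lift ord_max (Ordinal ar) = a by apply: val_inj; rewrite /= /bump leqNgt ar.
    have -> : lift ord0 (Ordinal ar) = c by apply: val_inj; rewrite /= ac.
    exact: leq_trans.
  move=> j; rewrite /la' ffunE.
  have lo : (conj_count ka j <= conj_count (fun s => b s : nat) j)%N.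
    rewrite [leqRHS](conj_count_lift _ ord0); apply: leq_trans (leq_addl _ _).
    by apply: conj_count_mono => s; have /andP[] := il s.
  have up : (conj_count (fun s => b s : nat) j <= (conj_count ka j).+1)%N.
    rewrite (conj_count_lift _ ord_max).
    have le : (conj_count (fun s => b (lift ord_max s) : nat) j <= conj_count ka j)%N.
      by apply: conj_count_mono => s; have /andP[] := il s.
    by case: (j < b ord_max)%N; [rewrite add1n ltnS | rewrite add0n ltnW].
  by case: ltnP => /=; move: lo up; lia.
apply: eq_big => [b|b].
  apply/andP/idP => [[/andP[/forallP supp de] /eqP bE]|gt].
    have bj (s : 'I_r.+1) (j : 'I_n) : (j < b s)%N = (r - s < la' (h b) j)%N by rewrite
      -{1}bE h'E.
    have le_b (m1 m2 : nat) : (m1 <= n)%N -> (forall j : 'I_n, (j < m1)%N -> (j < m2)%N) ->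
      (m1 <= m2)%N.
      move=> m1n H; rewrite leqNgt; apply/negP => lt.
      by have := H (Ordinal (leq_trans lt m1n)) lt; rewrite /= ltnn.
    have bn s : (b s <= n)%N by rewrite -ltnS.
    apply/andP; split; last first.
      apply: le_b => // j; rewrite bj /la' subnn.
      case hj: (h b j); first by rewrite ltnS; have := supp j; rewrite hj.
      rewrite addn0 ltnS => /card_gt0P[s]; rewrite inE => lt.
      exact: leq_trans (ltnW lt) (kar s).
    apply/forallP => s; have sr := ltn_ord s; apply/andP; split.
      apply: le_b => // j; rewrite bj lift_max (conj_count_galois j s inc) /la'.
      by move: sr; case: (h b j); rewrite /= ?addn1 ?addn0; lia.
    apply: le_b => [|j]; first by apply: leq_trans (kar s) (ltnW rn).
    by rewrite bj (conj_count_galois j s inc) /la' /= /bump add1n; move: sr; case: (h b j);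
      rewrite /= ?addn1 ?addn0; lia.
  have [binc laE] := step_facts b gt; have /andP[_ br] := gt.
  have de : dec (h b).
    by apply/forallP => i; apply/forallP => j; apply/implyP => ij; rewrite !laE; apply:
      conj_count_dec.
  split; last first.
    apply/eqP/ffunP => s; apply: val_inj; rewrite ffunE /=.
    have -> : #|[pred j : 'I_n | (r - s < la' (h b) j)%N]| = b s.
      have bn : (b s <= n)%N by rewrite -ltnS.
      rewrite -[RHS](card_ord_lt bn); apply: eq_card => j; rewrite !inE laE.
      by rewrite (conj_count_galois j s binc) subSS.
    by rewrite inordK.
  rewrite de andbT; apply/forallP => j; apply/implyP; rewrite ffunE => lt.
  have /card_gt0P[s] : (0 < conj_count (fun s => b s : nat) j)%N by apply: leq_ltn_trans lt.
  rewrite inE => js; rewrite -ltnS; apply: leq_trans js (leq_trans _ br).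
  by apply: binc; rewrite -ltnS.
move=> /andP[/andP[/forallP supp de] /eqP bE].
have laE j : la' (h b) j = conj_count (fun s => b s : nat) j by rewrite -conj_h' // bE.
congr (_ * _); last by rewrite /stair_det; congr (\det _); apply/matrixP => i j; rewrite
  !mxE -laE.
have -> : \prod_(j < n) w ^+ ((j <= r) - h b j) = w ^+ r.+1 * w ^- (\sum_(j < n) h b j).
  have rE : \prod_(j < n) w ^+ (j <= r)%N = w ^+ r.+1.
    have := card_ord_lt rn; rewrite -sum1_card => <-.
    rewrite -prodrXr [RHS]big_mkcond; apply: eq_bigr => j _.
    by rewrite inE ltnS; case: leqP.
  apply: (mulIf (_ : w ^+ (\sum_(j < n) h b j) != 0)); first by rewrite expf_neq0.
  rewrite mulfVK ?expf_neq0 // -rE -prodrXr -big_split; apply: eq_bigr => j _ /=.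
  rewrite -exprD subnK //; have := supp j; by case: (h b j) => //= ->.
have sumE : (\sum_s b s = \sum_s ka s + \sum_(j < n) h b j)%N.
  rewrite -(@sum_conj_count n _ (fun s => b s : nat)) => [|s]; last by rewrite -ltnS.
  rewrite -(@sum_conj_count n _ ka) => [|s]; last by apply: leq_trans (kar s) (ltnW rn).
  by rewrite -big_split; apply: eq_bigr => j _; rewrite -laE.
by rewrite sumE exprD invfM -!mulrA; congr (_ * _); rewrite mulrA mulfV ?expf_neq0 // mul1r.
Qed.

End Expansion.

Section GT.
Variable n : nat.

Definition gt_ok r (c : {ffun tri r -> 'I_n.+1}) :=
  [forall q, forall p, (ne_of q p ==> (c q <= c p)%N) && (nw_of q p ==> (c p <= c q)%N)]
  && [forall p, (c p <= (tcol p).+1)%N].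

Lemma gt_okP r (c : {ffun tri r -> 'I_n.+1}) : reflect
  [/\ forall q p, ne_of q p -> (c q <= c p)%N,
      forall q p, nw_of q p -> (c p <= c q)%N & forall p, (c p <= (tcol p).+1)%N]
  (gt_ok c).
Proof.
apply: (iffP andP) => [[/forallP h1 /forallP h2]|[h1 h2 h3]].
  by split=> // q p; have /forallP/(_ p)/andP[/implyP a /implyP b] := h1 q.
split; last exact/forallP.
by apply/forallP => q; apply/forallP => p; apply/andP; split; apply/implyP;
  [apply: h1|apply: h2].
Qed.

Lemma gt_ok_join r (c : {ffun tri r -> 'I_n.+1}) (b : {ffun 'I_r.+1 -> 'I_n.+1}) :
  gt_ok (trijoin c b) = gt_ok c && gt_step (fun s => c (tlast s)) (fun s => b s).
Proof.
apply/gt_okP/andP => [[h1 h2 h3]|[/gt_okP[h1 h2 h3] /andP[/forallP h4 h5]]].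
  split.
    apply/gt_okP; split=> [q p|q p|p]; [have := h1 (tup q) (tup p)|have := h2 (tup q) (tup p)|
      have := h3 (tup p)]; by rewrite ?trijoin_up.
  apply/andP; split; last by have := h3 (tbot ord_max); rewrite trijoin_bot.
  apply/forallP => s; have := h1 _ _ (ne_of_bot s); have := h2 _ _ (nw_of_bot s).
  by rewrite !trijoin_bot !trijoin_up => -> ->.
have split_row (q : tri r.+1) : (exists q', q = tup q') \/ trow q = r.
  by elim/tri_ind: q => q; [left; exists q | right].
have row_up (q' : tri r) (p : tri r.+1) : trow (tup q') = (trow p).+1 -> exists p', p = tup p'.
  elim/tri_ind: p => p e; first by exists p.
  by have := trow_lt q'; rewrite -[trow q']/(trow (tup q')) e ltnNge ltnW // ltnS.
split=> [q p|q p|p].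
- case: (split_row q) => [[q' ->]|e].
    move=> ne; have [p' pE] := row_up q' p (eqP (proj1 (andP ne))); move: ne.
    by rewrite pE !trijoin_up; apply: h1.
  move=> /(ne_of_last e)[i [-> ->]]; rewrite trijoin_bot trijoin_up.
  by have /andP[] := h4 i.
- case: (split_row q) => [[q' ->]|e].
    move=> ne; have [p' pE] := row_up q' p (eqP (proj1 (andP ne))); move: ne.
    by rewrite pE !trijoin_up; apply: h2.
  move=> /(nw_of_last e)[i [-> ->]]; rewrite trijoin_bot trijoin_up.
  by have /andP[] := h4 i.
elim/tri_ind: p => p; first by rewrite trijoin_up.
rewrite trijoin_bot -[tcol (tbot p)]/(val p); case: (unliftP ord_max p) => [s|] -> //.
have /andP[le _] := h4 s; apply: leq_trans le _.
by have := h3 (tlast s); rewrite tcol_tlast /= /bump [(r <= s)%N]leqNgt ltn_ord.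
Qed.

Lemma gt_last_homo r (c : {ffun tri r -> 'I_n.+1}) : gt_ok c ->
  {homo (fun s => c (tlast s) : nat) : a b / (a <= b)%N} /\ (forall s, (c (tlast s) <= r)%N).
Proof.
move=> /gt_okP[h1 h2 h3]; split; last first.
  by move=> s; apply: leq_trans (h3 _) _; rewrite tcol_tlast.
apply: (@ord_homo_adjacent _ leq) => [a|a b d|a b ab]; [exact: leqnn|exact: leq_trans|].
case: r c h1 h2 h3 a b ab => [|r] c h1 h2 h3 a b ab; first by case: a ab.
have ar : (a < r)%N by rewrite -ltnS -ab ltn_ord.
have := leq_trans (h1 _ _ (ne_of_bot (Ordinal ar))) (h2 _ _ (nw_of_bot (Ordinal ar))).
have -> : lift ord_max (Ordinal ar) = a by apply: val_inj; rewrite /= /bump leqNgt ar.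
by have -> : lift ord0 (Ordinal ar) = b by apply: val_inj; rewrite /= ab.
Qed.
Variables (K : fieldType) (w : K) (x y : nat -> K).
Hypothesis w0 : w != 0.

(** The terms after r rounds of expansion are indexed by patterns with r rows. *)
Theorem gt_sum r : (r <= n)%N ->
  \sum_(c : {ffun tri r -> 'I_n.+1} | gt_ok c)
    w ^+ 'C(r.+1, 2) * w ^- (\sum_s c (tlast s))
    * stair_det w x y (n - r) (fun j : 'I_n => conj_count (fun s => c (tlast s) : nat) j)
  = stair_det w x y n (fun _ : 'I_n => 0%N).
Proof.
elim: r => [|r IHr] rn.
  have no0 (c : {ffun tri 0 -> 'I_n.+1}) : c = [ffun=> ord0] by apply/ffunP => -[[]].
  rewrite (big_pred1 [ffun=> ord0]) => [|c]; last first.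
    rewrite (no0 c) /= eqxx; apply/gt_okP.
    by split=> [[[]]|[[]]|[[]]].
  rewrite big_ord0 !expr0 invr1 !mul1r subn0 /stair_det; congr (\det _).
  apply/matrixP => i j; rewrite !mxE; congr (stair_entry _ _ _ _ (_ + n - j) _).
  by apply/eqP; rewrite -leqn0 conj_count_le.
rewrite -(IHr (ltnW rn)) big_mkcond sum_trijoin [RHS]big_mkcond.
apply: eq_bigr => c _; under [LHS]eq_bigr do rewrite gt_ok_join.
case: ifP => [okc|/negbT nc]; last first.
  by rewrite big1 // => b _; rewrite (negPf nc).
have [inc le] := gt_last_homo okc.
rewrite (stair_det_gt_step _ _ w0 rn inc le) -big_mkcond mulr_sumr.
apply: eq_bigr => b _ /=.
under eq_bigr do rewrite trijoin_bot.
have -> : stair_det w x y (n - r.+1)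
  (fun j : 'I_n => conj_count (fun s => trijoin c b (tbot s) : nat) j)
   = stair_det w x y (n - r.+1) (fun j : 'I_n => conj_count (fun s => b s : nat) j).
  rewrite /stair_det; congr (\det _); apply/matrixP => i j; rewrite !mxE.
  congr (stair_entry _ _ _ _ (_ + n - j) _); apply: eq_card => s; by rewrite !inE trijoin_bot.
rewrite mulrA; congr (_ * _); rewrite binS bin1 exprD !mulrA; congr (_ * _).
by rewrite [RHS]mulrAC mulfVK ?expf_neq0.
Qed.

End GT.

(** * Totally symmetric self-complementary plane partitions *)

Section Membership.
Variables (n : nat) (H : nat -> nat -> nat).
Hypothesis Hsym : forall i j, H i j = H j i.
Hypothesis Hdec : forall i i' j, (i <= i')%N -> (H i' j <= H i j)%N.
Hypothesis Hbound : forall i j, (H i j <= n - i)%N.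

(** Coordinates start from 0, and those beyond n are called large.  In a totally
    symmetric self-complementary plane partition the points with two large
    coordinates are given by their heights H, those with one large coordinate
    are the complements of these, and the remaining points are forced. *)
Definition mem_tsscpp (x y z : nat) : bool :=
  match (n < x)%N, (n < y)%N, (n < z)%N with
  | false, false, false => true
  | true, true, true => false
  | true, true, false => (z < H (x - n.+1) (y - n.+1))%N
  | true, false, true => (y < H (x - n.+1) (z - n.+1))%N
  | false, true, true => (x < H (y - n.+1) (z - n.+1))%N
  | true, false, false => (H (n - y) (n - z) <= (2 * n).+1 - x)%N
  | false, true, false => (H (n - x) (n - z) <= (2 * n).+1 - y)%N
  | false, false, true => (H (n - x) (n - y) <= (2 * n).+1 - z)%N
  end.

Lemma mem_tsscpp_swap x y z : mem_tsscpp y x z = mem_tsscpp x y z.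
Proof.
by rewrite /mem_tsscpp; case: ifP => _; case: ifP => _; case: ifP => _; rewrite
  ?[H (y - _) (x - _)]Hsym
  ?[H (n - y) (n - x)]Hsym.
Qed.

Lemma mem_tsscpp_rot x y z : mem_tsscpp y z x = mem_tsscpp x y z.
Proof.
rewrite /mem_tsscpp; case: ifP => _; case: ifP => _; case: ifP => _ //;
  by rewrite Hsym.
Qed.

Lemma mem_tsscpp_compl x y z : (x < 2 * n + 2)%N -> (y < 2 * n + 2)%N -> (z < 2 * n + 2)%N ->
  mem_tsscpp x y z = ~~ mem_tsscpp (2 * n + 2 - x.+1) (2 * n + 2 - y.+1) (2 * n + 2 - z.+1).
Proof.
move=> xN yN zN.
have flip t : (t < 2 * n + 2)%N -> (n < 2 * n + 2 - t.+1)%N = ~~ (n < t)%N by lia.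
have lo t : (t < 2 * n + 2)%N -> (n < t)%N -> (n - (2 * n + 2 - t.+1) = t - n.+1)%N by lia.
have hi t : (t < 2 * n + 2)%N -> (n < t)%N = false -> (2 * n + 2 - t.+1 - n.+1 = n - t)%N
  by lia.
rewrite /mem_tsscpp !flip //.
case xn: (n < x)%N; case yn: (n < y)%N; case zn: (n < z)%N => //=;
  rewrite ?(lo x) ?(lo y) ?(lo z) ?(hi x) ?(hi y) ?(hi z) //; lia.
Qed.

(** On each side of the middle this is the monotonicity of H; across the middle
    it follows from the bound on H. *)
Lemma mem_tsscpp_le1 x x' y z : (x <= 2 * n + 1)%N -> (y <= 2 * n + 1)%N ->
    (z <= 2 * n + 1)%N ->
  (x' <= x)%N -> mem_tsscpp x y z -> mem_tsscpp x' y z.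
Proof.
move=> xN yN zN x'x; rewrite /mem_tsscpp.
have d1 t : (H (x - n.+1) t <= H (x' - n.+1) t)%N by apply: Hdec; lia.
have d2 t : (H (n - x') t <= H (n - x) t)%N by apply: Hdec; lia.
have b1 t : (H (x - n.+1) t <= n - t)%N by rewrite Hsym.
have b2 t : (H (n - x') t <= n - t)%N by rewrite Hsym.
have := (d1 (y - n.+1), d1 (z - n.+1), d2 (n - y), d2 (n - z))%N.
have := (b1 (y - n.+1), b1 (z - n.+1), b2 (n - y), b2 (n - z))%N.
move=> [[[c1 c2] c3] c4] [[[c5 c6] c7] c8].
case xn: (n < x)%N; case xn': (n < x')%N; case yn: (n < y)%N; case zn: (n < z)%N => //=; lia.
Qed.

Lemma mem_tsscpp_le x x' y y' z z' :
    (x <= 2 * n + 1)%N -> (y <= 2 * n + 1)%N -> (z <= 2 * n + 1)%N ->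
    (x' <= x)%N -> (y' <= y)%N -> (z' <= z)%N -> mem_tsscpp x y z -> mem_tsscpp x' y' z'.
Proof.
move=> xN yN zN xx yy zz m.
have {}m : mem_tsscpp x' y z by apply: mem_tsscpp_le1 m.
have {}m : mem_tsscpp x' y' z.
  by rewrite mem_tsscpp_swap; rewrite mem_tsscpp_swap in m; apply: mem_tsscpp_le1 m => //;
    apply: leq_trans xN.
rewrite mem_tsscpp_rot; rewrite mem_tsscpp_rot in m; apply: mem_tsscpp_le1 m => //.
  exact: leq_trans xN.
exact: leq_trans yN.
Qed.

(** Of a point and its complement, one has zero or two large coordinates. *)
Lemma mem_tsscpp_unique (Q : nat -> nat -> nat -> bool) :
    (forall x y z, Q y x z = Q x y z) -> (forall x y z, Q y z x = Q x y z) ->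
    (forall x y z, (x < 2 * n + 2)%N -> (y < 2 * n + 2)%N -> (z < 2 * n + 2)%N ->
      Q x y z = ~~ Q (2 * n + 2 - x.+1)%N (2 * n + 2 - y.+1)%N (2 * n + 2 - z.+1)%N) ->
    (forall x y z, (x <= n)%N -> (y <= n)%N -> (z <= n)%N -> Q x y z) ->
    (forall x y z, (n < x < 2 * n + 2)%N -> (n < y < 2 * n + 2)%N -> (z <= n)%N ->
       Q x y z = (z < H (x - n.+1) (y - n.+1))%N) ->
  forall x y z, (x < 2 * n + 2)%N -> (y < 2 * n + 2)%N -> (z < 2 * n + 2)%N ->
  Q x y z = mem_tsscpp x y z.
Proof.
move=> Qs Qr Qc Q0 Q2.
have two x y z : (n < x < 2 * n + 2)%N -> (n < y < 2 * n + 2)%N -> (z <= n)%N ->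
    Q x y z = mem_tsscpp x y z.
  by move=> xn yn zn; rewrite Q2 // /mem_tsscpp; case/andP: xn => -> _; case/andP: yn => -> _;
    move: zn; rewrite leqNgt => /negbTE ->.
have most x y z : (x < 2 * n + 2)%N -> (y < 2 * n + 2)%N -> (z < 2 * n + 2)%N ->
    ((n < x) + (n < y) + (n < z) != 1)%N -> Q x y z = mem_tsscpp x y z.
  move=> xN yN zN.
  case xn: (n < x)%N; case yn: (n < y)%N; case zn: (n < z)%N => //= _.
  - by rewrite Qc // Q0; [rewrite /mem_tsscpp xn yn zn | lia | lia | lia].
  - by apply: two; lia.
  - by rewrite Qr [RHS]mem_tsscpp_rot; apply: two; lia.
  - by rewrite -Qr -[RHS]mem_tsscpp_rot; apply: two; lia.
  by rewrite /mem_tsscpp xn yn zn Q0 //; lia.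
move=> x y z xN yN zN.
have [e|ne] := eqVneq ((n < x) + (n < y) + (n < z))%N 1%N; last exact: most.
by rewrite Qc // mem_tsscpp_compl // most //; lia.
Qed.

End Membership.

Section Bijection.
Variable n : nat.
Let N := (2 * n + 2)%N.
Let NE : N = (2 * n + 2)%N := erefl.

Definition tri_entry (c : {ffun tri n -> 'I_n.+1}) (r s : nat) : nat :=
  if [pick p : tri n | (trow p == r) && (tcol p == s)] is Some p then c p else 0%N.

Lemma tri_entryE c (p : tri n) : tri_entry c (trow p) (tcol p) = c p.
Proof.
rewrite /tri_entry; case: pickP => [q /andP[/eqP rq /eqP cq]|/(_ p)]; last by rewrite !eqxx.
by rewrite (tri_inj rq cq).
Qed.

(** The heights form a symmetric array, of which the pattern is the part
    i <= j < n; all other heights are zero. *)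
Definition quadrant (c : {ffun tri n -> 'I_n.+1}) (i j : nat) : nat :=
  if (maxn i j < n)%N then tri_entry c (n.-1 - maxn i j + minn i j) (n.-1 - maxn i j) else 0%N.

Lemma quadrant_sym c i j : quadrant c i j = quadrant c j i.
Proof. by rewrite /quadrant maxnC minnC. Qed.

Lemma quadrant_tri c i j : (maxn i j < n)%N -> exists p : tri n,
  [/\ trow p = (n.-1 - maxn i j + minn i j)%N, tcol p = (n.-1 - maxn i j)%N
    & quadrant c i j = c p].
Proof.
move=> mn; have [|p [rp cp]] := @tri_ex n (n.-1 - maxn i j + minn i j) (n.-1 - maxn i j).
  by lia.
by exists p; split=> //; rewrite /quadrant mn -rp -cp tri_entryE.
Qed.

Lemma quadrant_bound c i j : gt_ok c -> (quadrant c i j <= n - i)%N.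
Proof.
move=> /gt_okP[_ _ h]; have [mn|mn] := ltnP (maxn i j) n; last by rewrite /quadrant ltnNge mn.
have [p [rp cp ->]] := quadrant_tri c mn.
by apply: leq_trans (h p) _; rewrite cp; lia.
Qed.

Lemma quadrant_dec c i i' j : gt_ok c -> (i <= i')%N -> (quadrant c i' j <= quadrant c i j)%N.
Proof.
move=> /gt_okP[h1 h2 _] /subnKC <-; elim: (i' - i)%N => [|d IHd]; first by rewrite addn0.
apply: leq_trans IHd; rewrite addnS; move: (i + d)%N => {}i.
have [mn|mn] := ltnP (maxn i.+1 j) n; last by rewrite /quadrant ltnNge mn.
have mn' : (maxn i j < n)%N by lia.
have [p [rp cp ->]] := quadrant_tri c mn; have [q [rq cq ->]] := quadrant_tri c mn'.
have [lt|ge] := ltnP i j.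
  by apply: h1; rewrite /ne_of rp rq cp cq; apply/andP; split; apply/eqP; lia.
by apply: h2; rewrite /nw_of rp rq cp cq; apply/andP; split; apply/eqP; lia.
Qed.

Definition tsscpp_of (c : {ffun tri n -> 'I_n.+1}) : {set box N} :=
  [set p : box N | mem_tsscpp n (quadrant c) p.1.1 p.1.2 p.2].

Definition gt_of (T : {set box N}) : {ffun tri n -> 'I_n.+1} :=
  [ffun p : tri n => inord (gt_pattern T (trow p).+1 (tcol p).+1)].

Lemma tsscpp_ofP c : gt_ok c -> is_tsscpp (tsscpp_of c).
Proof.
move=> ok.
have Hs := quadrant_sym c; have Hd i i' j := @quadrant_dec c i i' j ok.
have Hb i j := quadrant_bound i j ok.
apply/and3P; split.
- apply/forallP => -[[x y] z]; apply/forallP => -[[x' y'] z'] /=; rewrite !inE /=.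
  apply/implyP => /and4P[m xx yy zz].
  by apply: (mem_tsscpp_le Hs Hd Hb) m; rewrite // -ltnS -addn2 ?addn1; move: (ltn_ord x)
    (ltn_ord y) (ltn_ord z); have := NE; lia.
- apply/forallP => x; apply/forallP => y; apply/forallP => z; rewrite !inE /=.
  have sw a b d := mem_tsscpp_swap n Hs a b d; have ro a b d := mem_tsscpp_rot n Hs a b d.
  by rewrite (sw z x y) (sw y z x) (ro y z x) (ro x y z) (sw x y z) !eqxx.
apply/forallP => x; apply/forallP => y; apply/forallP => z; rewrite !inE /=.
by rewrite mem_tsscpp_compl ?eqxx ?ltn_ord.
Qed.

Lemma mem_height (T : {set box N}) (x y z : 'I_N) : is_plane_partition T ->
  ((x, y, z) \in T) = (z < height T x.+1 y.+1)%N.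
Proof.
move=> /forallP pp.
transitivity (z < #|[pred z : 'I_N | (x, y, z) \in T]|)%N.
  apply: (@downset_ord _ [pred z | (x, y, z) \in T]) => a b ab /= m.
  have /forallP/(_ (x, y, a))/implyP := pp (x, y, b).
  by apply; rewrite m /= !leqnn ab.
congr (_ < _)%N; rewrite /height -(card_imset _ (_ : injective (fun z : 'I_N => (x, y, z)))).
  apply: eq_card => -[[x' y'] z']; rewrite !inE /= !eqSS; apply/imsetP/andP.
    by move=> [a]; rewrite inE => m [-> -> ->]; rewrite m !eqxx.
  move=> [m /andP[/eqP/val_inj ex /eqP/val_inj ey]]; exists z'; last by rewrite ex ey.
  by rewrite inE -ex -ey.
by move=> a b [].
Qed.

Lemma height_le (T : {set box N}) x y : (height T x y <= N)%N.
Proof.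
apply: leq_trans (_ : #|'I_N| <= _)%N; last by rewrite card_ord.
rewrite /height -(@card_in_imset _ _ (fun p : box N => p.2)) ?max_card //.
move=> [[a b] d] [[a' b'] d']; rewrite !inE /= => /and3P[_ /eqP xa /eqP yb].
move=> /and3P[_ /eqP xa' /eqP yb'] ->; congr (_, _, _); apply: val_inj;
  by apply: succn_inj; rewrite ?xa ?xa' ?yb ?yb'.
Qed.

Lemma eq_from_ltn h1 h2 : (h1 <= N)%N -> (h2 <= N)%N ->
  (forall z : 'I_N, (z < h1)%N = (z < h2)%N) -> h1 = h2.
Proof.
move=> l1 l2 e; case: (ltngtP h1 h2) => // lt.
  by have := e (Ordinal (leq_trans lt l2)); rewrite /= lt ltnn.
by have := e (Ordinal (leq_trans lt l1)); rewrite /= lt ltnn.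
Qed.

Lemma gt_of_tsscpp_of c : gt_ok c -> gt_of (tsscpp_of c) = c.
Proof.
move=> ok; apply/ffunP => p; apply: val_inj; rewrite ffunE.
have := tcol_le p; have := trow_lt p; set r := trow p; set s := tcol p => rn sr.
suff -> : gt_pattern (tsscpp_of c) r.+1 s.+1 = c p by rewrite /= inordK.
have xN : (n.+1 + (r - s) < N)%N by have := NE; lia.
have yN : (2 * n - s < N)%N by have := NE; lia.
have /and3P[pp _ _] := tsscpp_ofP ok.
rewrite /gt_pattern.
have -> : (n + 2 + r.+1 - s.+1 = (Ordinal xN).+1)%N by rewrite /=; lia.
have -> : (2 * n + 2 - s.+1 = (Ordinal yN).+1)%N by rewrite /=; lia.
have cn : (c p <= n)%N by rewrite -ltnS.
apply: eq_from_ltn => [||z]; first exact: height_le.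
  by apply: leq_trans cn _; have := NE; lia.
rewrite -mem_height // inE /= /mem_tsscpp.
have -> : (n < n.+1 + (r - s))%N by lia.
have -> : (n < 2 * n - s)%N by lia.
have -> : (quadrant c (n.+1 + (r - s) - n.+1) (2 * n - s - n.+1) = c p)%N.
  have mn : (maxn (n.+1 + (r - s) - n.+1) (2 * n - s - n.+1) < n)%N by lia.
  have [q [rq cq ->]] := quadrant_tri c mn; congr (nat_of_ord (c _)).
  by apply: tri_inj; rewrite ?rq ?cq -?/r -?/s; lia.
by case: ltnP => // nz; rewrite ltnNge (leq_trans cn) // ltnW.
Qed.

Section FromTsscpp.
Variable T : {set box N}.
Hypothesis Tok : is_tsscpp T.

Lemma tsscpp_swap x y z : ((y, x, z) \in T) = ((x, y, z) \in T).
Proof.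
have /and3P[_ /forallP/(_ x)/forallP/(_ y)/forallP/(_ z) ts _] := Tok.
by have /and5P[/eqP -> _ _ _ _] := ts.
Qed.

Lemma tsscpp_rot x y z : ((y, z, x) \in T) = ((x, y, z) \in T).
Proof.
have /and3P[_ /forallP/(_ x)/forallP/(_ y)/forallP/(_ z) ts _] := Tok.
by have /and5P[_ _ _ /eqP -> _] := ts.
Qed.

Lemma tsscpp_compl x y z :
  ((x, y, z) \in T) = ((rev_ord x, rev_ord y, rev_ord z) \notin T).
Proof.
by have /and3P[_ _ /forallP/(_ x)/forallP/(_ y)/forallP/(_ z)/eqP] := Tok.
Qed.

Lemma tsscpp_down (x y z x' y' z' : 'I_N) : (x', y', z') \in T ->
  (x <= x')%N -> (y <= y')%N -> (z <= z')%N -> (x, y, z) \in T.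
Proof.
move=> m xx yy zz; have /and3P[/forallP/(_ (x', y', z'))/forallP/(_ (x, y, z)) pp _ _] := Tok.
by apply: (implyP pp); rewrite m /= xx yy zz.
Qed.

(** Otherwise the complement of (x, y, z) would lie below (z, y, x), which is in T
    by symmetry. *)
Lemma tsscpp_bound (x y z : 'I_N) : (x, y, z) \in T -> (n < y)%N -> (x + z <= 2 * n)%N.
Proof.
move=> m ny; rewrite leqNgt; apply/negP => lt.
have := m; rewrite tsscpp_compl => /negP[].
have m' : (z, y, x) \in T by rewrite -tsscpp_swap tsscpp_rot.
by apply: tsscpp_down m' _ _ _ => /=; have := NE; lia.
Qed.

(** Otherwise its complement would be in T, and lies above it. *)
Lemma tsscpp_small (x y z : 'I_N) : (x <= n)%N -> (y <= n)%N -> (z <= n)%N -> (x, y, z) \in T.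
Proof.
move=> xn yn zn; apply/negPn/negP => m; have := m.
rewrite tsscpp_compl negbK => m'; case/negP: m.
by apply: tsscpp_down m' _ _ _ => /=; have := NE; lia.
Qed.

Lemma height_gt_pattern r s : (s <= r < n)%N -> exists x y : 'I_N,
  [/\ x = (n.+1 + (r - s))%N :> nat, y = (2 * n - s)%N :> nat
    & gt_pattern T r.+1 s.+1 = height T x.+1 y.+1].
Proof.
move=> srn.
have xN : (n.+1 + (r - s) < N)%N by have := NE; lia.
have yN : (2 * n - s < N)%N by have := NE; lia.
exists (Ordinal xN), (Ordinal yN); split=> //.
by rewrite /gt_pattern; congr (height T _ _); rewrite /=; lia.
Qed.

Lemma height_bound (x y : 'I_N) : (n < x)%N -> (height T x.+1 y.+1 <= (2 * n).+1 - y)%N.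
Proof.
move=> nx; rewrite leqNgt; apply/negP => lt.
have zN : ((2 * n).+1 - y < N)%N by have := NE; lia.
have /and3P[pp _ _] := Tok.
have : (y, x, Ordinal zN) \in T by rewrite tsscpp_swap mem_height.
move=> /tsscpp_bound/(_ nx) /=; have := ltn_ord y; have := NE; lia.
Qed.

Lemma gt_ofE (p : tri n) : gt_of T p = gt_pattern T (trow p).+1 (tcol p).+1 :> nat.
Proof.
rewrite ffunE inordK // ltnS.
have srn : (tcol p <= trow p < n)%N by rewrite tcol_le trow_lt.
have [x [y [xE yE ->]]] := height_gt_pattern srn.
by apply: leq_trans (height_bound _ _) _; rewrite ?xE ?yE; lia.
Qed.

Lemma height_dec (x y x' y' : 'I_N) : (x <= x')%N -> (y <= y')%N ->
  (height T x'.+1 y'.+1 <= height T x.+1 y.+1)%N.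
Proof.
move=> xx yy; rewrite leqNgt; apply/negP => lt.
have /and3P[pp _ _] := Tok.
have zN := leq_trans lt (height_le T x'.+1 y'.+1).
have : (x', y', Ordinal zN) \in T by rewrite mem_height.
move=> m; have : (x, y, Ordinal zN) \in T by apply: tsscpp_down m _ _ _.
by rewrite mem_height //= ltnn.
Qed.

Lemma gt_ok_gt_of : gt_ok (gt_of T).
Proof.
have E p : exists x y : 'I_N, [/\ x = (n.+1 + (trow p - tcol p))%N :> nat,
    y = (2 * n - tcol p)%N :> nat & gt_of T p = height T x.+1 y.+1 :> nat].
  rewrite gt_ofE; apply: height_gt_pattern; by rewrite tcol_le trow_lt.
apply/gt_okP; split=> [q p /andP[/eqP rq /eqP cq]|q p /andP[/eqP rq /eqP cq]|p].
- have [x [y [xE yE ->]]] := E q; have [x' [y' [xE' yE' ->]]] := E p.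
  by apply: height_dec; rewrite ?xE ?yE ?xE' ?yE' ?rq ?cq; have := tcol_le p; lia.
- have [x [y [xE yE ->]]] := E q; have [x' [y' [xE' yE' ->]]] := E p.
  by apply: height_dec; rewrite ?xE ?yE ?xE' ?yE' ?rq ?cq; have := tcol_le p; lia.
have [x [y [xE yE ->]]] := E p; have := tcol_le p; have := trow_lt p => rn sr.
by apply: leq_trans (height_bound _ _) _; rewrite ?xE ?yE; lia.
Qed.

Lemma tsscpp_of_gt_of : tsscpp_of (gt_of T) = T.
Proof.
have Hs := quadrant_sym (gt_of T).
pose Q a b d := [exists p in T, [&& p.1.1 == a :> nat, p.1.2 == b :> nat & p.2 == d :> nat]].
have QE (x y z : 'I_N) : Q x y z = ((x, y, z) \in T).
  apply/exists_inP/idP => [[[[x' y'] z'] /= m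
    /and3P[/eqP/val_inj ex /eqP/val_inj ey /eqP/val_inj ez]]|m].
    by rewrite -ex -ey -ez.
  by exists (x, y, z); rewrite //= !eqxx.
apply/setP => -[[x y] z]; rewrite inE /= -QE; apply/esym.
apply: (@mem_tsscpp_unique n (quadrant (gt_of T)) Hs Q _ _ _ _ _ x y z); rewrite ?ltn_ord //.
- move=> {}x {}y {}z; apply/exists_inP/exists_inP => -[[[a b] d] /= m /and3P[e1 e2 e3]];
  by exists (b, a, d); [rewrite tsscpp_swap | rewrite /= e1 e2 e3].
- move=> {}x {}y {}z; apply/exists_inP/exists_inP => -[[[a b] d] /= m /and3P[e1 e2 e3]].
    by exists (d, a, b); [rewrite -tsscpp_rot | rewrite /= e1 e2 e3].
  by exists (b, d, a); [rewrite tsscpp_rot | rewrite /= e1 e2 e3].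
- move=> {}x {}y {}z xN yN zN.
  rewrite -[x]/(nat_of_ord (Ordinal xN)) -[y]/(nat_of_ord (Ordinal yN)).
  rewrite -[z]/(nat_of_ord (Ordinal zN)) QE tsscpp_compl -QE //.
- move=> {}x {}y {}z xn yn zn.
  have lt t : (t <= n)%N -> (t < N)%N by have := NE; lia.
  rewrite -[x]/(nat_of_ord (Ordinal (lt x xn))) -[y]/(nat_of_ord (Ordinal (lt y yn))).
  by rewrite -[z]/(nat_of_ord (Ordinal (lt z zn))) QE tsscpp_small.
move=> {}x {}y {}z /andP[xn xN] /andP[yn yN] zn.
have zN : (z < N)%N by have := NE; lia.
pose x' := Ordinal xN; pose y' := Ordinal yN; pose z' := Ordinal zN.
rewrite -[LHS]/(Q x' y' z') QE.
have /and3P[pp _ _] := Tok.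
have [mn|mn] := ltnP (maxn (x - n.+1) (y - n.+1)) n; last first.
  have -> : quadrant (gt_of T) (x - n.+1) (y - n.+1) = 0%N by rewrite /quadrant ltnNge mn.
  rewrite ltn0; apply/negbTE/negP => m.
  have := tsscpp_bound m yn; rewrite -tsscpp_swap in m; have := tsscpp_bound m xn.
  by rewrite /=; lia.
have [p [rp cp ->]] := quadrant_tri (gt_of T) mn; rewrite gt_ofE rp cp.
have [xy|yx] := leqP x y.
  rewrite mem_height // /gt_pattern; congr (_ < height T _ _)%N; rewrite /=; lia.
rewrite -tsscpp_swap mem_height // /gt_pattern; congr (_ < height T _ _)%N; rewrite /=; lia.
Qed.

End FromTsscpp.

Theorem sum_tsscpp (V : nmodType) (F : {ffun tri n -> 'I_n.+1} -> V) :
  \sum_(T : {set box N} | is_tsscpp T) F (gt_of T) = \sum_(c | gt_ok c) F c.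
Proof.
rewrite (reindex_onto tsscpp_of gt_of) /=; last exact: tsscpp_of_gt_of.
apply: eq_big => [c|c /andP[ok /eqP ->] //].
apply/andP/idP => [[ok /eqP <-]|ok]; first exact: gt_ok_gt_of.
by rewrite tsscpp_ofP // gt_of_tsscpp_of.
Qed.

End Bijection.

Lemma nth_conj_part la i : nth 0%N (conj_part la) i = count (fun m => i < m)%N la.
Proof.
rewrite /conj_part; have [lt|ge] := ltnP i (\max_(m <- la) m).
  by rewrite (nth_map 0%N) ?size_iota // nth_iota.
rewrite nth_default ?size_map ?size_iota //; apply/esym/eqP.
rewrite -leqn0 leqNgt -has_count; apply/hasPn => m mla; rewrite -leqNgt.
by apply: leq_trans ge; apply: (@leq_bigmax_seq _ la xpredT id).
Qed.

Section Lambda.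
Variables (n : nat) (T : {set box (2 * n + 2)}).
Hypothesis Tok : is_tsscpp T.

Lemma nth_lambda i : nth 0%N (lambda T) i = conj_count (fun s => gt_of T (tlast s) : nat) i.
Proof.
rewrite nth_conj_part /gt_shape count_map count_rev -sum1_count /conj_count -sum1_card.
have -> : iota 1 n = map (addn 1) (iota 0 n) by rewrite -iotaDl.
rewrite big_map big_mkcond -[n in iota 0 n]subn0 -/(index_iota 0 n) big_mkord.
rewrite [RHS]big_mkcond; apply: eq_bigr => s _; rewrite [s \in _]inE.
rewrite (gt_ofE Tok (tlast s)) trow_tlast tcol_tlast /=.
by rewrite add1n prednK // (leq_ltn_trans _ (ltn_ord s)).
Qed.

Lemma size_lambda : (size (lambda T) <= n)%N.
Proof.
rewrite /lambda size_map size_iota; apply/bigmax_leqP_seq => m /mapP[s].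
rewrite mem_rev mem_iota add1n ltnS => sn -> _.
by apply: leq_trans (gt_pattern_bound Tok sn) _; case/andP: sn.
Qed.

Lemma sumn_lambda : sumn (lambda T) = (\sum_s gt_of T (tlast s))%N.
Proof.
have [_ le] := gt_last_homo (gt_ok_gt_of Tok).
rewrite -(sum_conj_count le) sumnE (big_nth 0%N) big_mkord.
under [RHS]eq_bigr do rewrite -nth_lambda.
rewrite (big_ord_widen n (nth 0%N (lambda T)) size_lambda) big_mkcond.
apply: eq_bigr => i _; case: ltnP => // ge; by rewrite nth_default.
Qed.

Lemma sumn_lambda_le : (sumn (lambda T) <= 'C(n.+1, 2))%N.
Proof.
rewrite sumn_lambda -bin2_sum big_mkord big_ord_recl add0n; apply: leq_sum => s _.
have /gt_okP[_ _ h] := gt_ok_gt_of Tok.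
by apply: leq_trans (h _) _; rewrite tcol_tlast.
Qed.

End Lambda.

(** * The identity over a field *)

(** Both sides are multiplied by the Weyl denominator.  The two determinants have
    their columns in opposite orders, which costs numerator and denominator the
    same sign. *)
Theorem amt_tsscpp_field (K : fieldType) n (u v w : K) (X : nat -> K) :
    (0 < n)%N -> (forall i, X i != 0) -> u != 0 -> v != 0 -> w != 0 ->
    spdelta (fun i => u * X i) (fun i => v / X i) n != 0 ->
  \sum_(A : amt (fun j : 'I_n => (2 * j)%N%:Z)) amt_weight u v w (fun i : 'I_n => X i) (val A)
  = (\prod_(i < n) X i ^+ n.-1)
    * \sum_(T : {set box (2 * n + 2)} | is_tsscpp T)
        w ^+ ('C(n.+1, 2) - sumn (lambda T))
        * sp (lambda T) (fun i : 'I_n => u * X i) (fun i : 'I_n => v * (X i)^-1).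
Proof.
case: n => // n' _; set n := n'.+1 => X0 u0 v0 w0 del0.
pose x i := u * X i; pose y i := v / X i.
have x0 i : x i != 0 by rewrite mulf_neq0.
have y0 i : y i != 0 by rewrite mulf_neq0 // invr_eq0.
have xy i : x i * y i = u * v by rewrite /x /y; field.
pose sg : K := \prod_(j < n) (-1) ^+ j.
have sg0 : sg != 0 by apply/prodf_neq0 => j _; rewrite signr_eq0.
have delE : spdelta_dec x y n = sg * spdelta x y n.
  rewrite /spdelta_dec /spdelta mulrCA; congr (_ * _).
  rewrite /sg -(pairprod_snd (fun=> -1)) -pairprodM; apply: eq_bigr => p _.
  by rewrite mulN1r opprB.
have del0' : spdelta_dec x y n != 0 by rewrite delE mulf_neq0.
have kB (j : 'I_n) : (2 * j <= 2 * n)%N by rewrite leq_mul2l ltnW.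
rewrite (@sum_amt _ n _ (2 * n) (amt_weight u v w (fun i : 'I_n => X i))); last first.
  by move=> j /=; rewrite lez_nat kB.
transitivity (amt_gf u v w (2 * n) X (fun j : 'I_n => 2 * j)%N).
  by apply: eq_bigr => c _; rewrite (amt_weight_code u v w _ X0).
apply: (mulIf del0'); rewrite delE mulrCA (amt_gf_det u v w X0 kB) mulrCA -delE -mulrA.
congr (_ * _).
rewrite mulr_suml.
transitivity (\sum_(T : {set box (2 * n + 2)} | is_tsscpp T)
   w ^+ 'C(n.+1, 2) * w ^- (\sum_s gt_of T (tlast s))
   * stair_det w x y (n - n) (fun j : 'I_n => conj_count (fun s => gt_of T (tlast s) : nat)
     j)).
  rewrite (sum_tsscpp (fun c => w ^+ 'C(n.+1, 2) * w ^- (\sum_s c (tlast s))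
     * stair_det w x y (n - n) (fun j : 'I_n => conj_count (fun s => c (tlast s) : nat) j))).
  rewrite (gt_sum x y w0 (leqnn n)) /sg.
  rewrite -(det_rev_cols (fun i j => (x i * (x i + w)) ^+ j.+1 - (y i * (y i + w)) ^+ j.+1)).
  rewrite /stair_det; congr (\det _); apply/matrixP => i j; rewrite !mxE /stair_entry.
  by rewrite add0n !exprMn subnSK // (minn_idPl (leq_subr _ _)).
apply: eq_bigr => T Tok; apply/esym; rewrite -[LHS]mulrA; congr (_ * _).
  rewrite -(sumn_lambda Tok); apply: (mulIf (expf_neq0 (sumn (lambda T)) w0)).
  by rewrite mulfVK ?expf_neq0 // -exprD subnK // sumn_lambda_le.
have [_ le] := gt_last_homo (gt_ok_gt_of Tok).
have laL i : (nth 0%N (lambda T) i <= n)%N by rewrite (nth_lambda Tok) conj_count_le.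
have la_dec : {homo nth 0%N (lambda T) : i j / (i <= j)%N >-> (j <= i)%N}.
  by move=> i j ij; rewrite !(nth_lambda Tok) conj_count_dec.
have la0 i : (n <= i)%N -> nth 0%N (lambda T) i = 0%N.
  by move=> ni; rewrite nth_default // (leq_trans (size_lambda Tok)).
rewrite (sp_tab_gf x y (size_lambda Tok) laL la_dec).
rewrite (tab_gf_det xy x0 y0) //.
rewrite /sp_even /stair_det; congr (\det _); apply/matrixP => i j; rewrite !mxE.
by rewrite (nth_lambda Tok) /stair_entry subnn minn0 !expr0 !mulr1.
Qed.

(** * From a field of fractions to commutative rings *)

Section Laurent.
Variable n : nat.

Definition laurent_fun := forall R : comUnitRingType, R -> R -> R -> ('I_n -> R) -> R.

Definition assignment (R : comUnitRingType) (u v w : R) (X : 'I_n -> R) (i : 'I_(3 + n)) : R :=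
  match split i with inl k => [:: u; v; w]`_k | inr j => X j end.

Definition evalZ (R : comUnitRingType) (u v w : R) (X : 'I_n -> R) (p : {mpoly int[3 + n]})
    : R :=
  mmap intr (assignment u v w X) p.

(** The power of the product of the X_i clears the denominators of a Laurent
    polynomial.  One p with integer coefficients serves all rings. *)
Definition laurent (F : laurent_fun) := exists M (p : {mpoly int[3 + n]}),
  forall (R : comUnitRingType) (u v w : R) (X : 'I_n -> R), (forall i, X i \is a GRing.unit) ->
    (\prod_i X i) ^+ M * F R u v w X = evalZ u v w X p.

Definition prod_vars : {mpoly int[3 + n]} := \prod_(i < n) 'X_(rshift 3 i).

Lemma evalZX (R : comUnitRingType) (u v w : R) X i : evalZ u v w X 'X_i = assignment u v w X i.
Proof. by rewrite /evalZ mmapX mmap1U. Qed.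

Lemma assignment_X (R : comUnitRingType) (u v w : R) X i : assignment u v w X (rshift 3 i)
    = X i.
Proof. by rewrite /assignment -[rshift 3 i]/(unsplit (inr i)) unsplitK. Qed.

Lemma evalZ_prod_vars (R : comUnitRingType) (u v w : R) X : evalZ u v w X prod_vars =
    \prod_i X i.
Proof.
rewrite /evalZ /prod_vars rmorph_prod; apply: eq_bigr => i _.
by rewrite -[LHS]/(evalZ u v w X _) evalZX assignment_X.
Qed.

Lemma evalZM (R : comUnitRingType) (u v w : R) X p q :
  evalZ u v w X (p * q) = evalZ u v w X p * evalZ u v w X q.
Proof. by rewrite /evalZ rmorphM. Qed.

Lemma evalZD (R : comUnitRingType) (u v w : R) X p q :
  evalZ u v w X (p + q) = evalZ u v w X p + evalZ u v w X q.
Proof. by rewrite /evalZ rmorphD. Qed.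

Lemma evalZXn (R : comUnitRingType) (u v w : R) X p k :
  evalZ u v w X (p ^+ k) = evalZ u v w X p ^+ k.
Proof. by rewrite /evalZ rmorphXn. Qed.

Lemma eq_laurent (F G : laurent_fun) :
    (forall (R : comUnitRingType) u v w X, (forall i, X i \is a GRing.unit) -> F R u v w X
      = G R u v w X) ->
  laurent G -> laurent F.
Proof. by move=> e [M [p H]]; exists M, p => R u v w X uX; rewrite e // H. Qed.

Lemma laurent0 : laurent (fun R u v w X => 0).
Proof. by exists 0%N, 0 => R u v w X _; rewrite /evalZ rmorph0 mulr0. Qed.

Lemma laurent1 : laurent (fun R u v w X => 1).
Proof. by exists 0%N, 1 => R u v w X _; rewrite /evalZ rmorph1 mul1r. Qed.

Lemma laurent_u : laurent (fun R u v w X => u).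
Proof.
exists 0%N, 'X_(lshift n (inord 0 : 'I_3)) => R u v w X _.
by rewrite evalZX mul1r /assignment -[lshift n _]/(unsplit (inl _)) unsplitK /= inordK.
Qed.

Lemma laurent_v : laurent (fun R u v w X => v).
Proof.
exists 0%N, 'X_(lshift n (inord 1 : 'I_3)) => R u v w X _.
by rewrite evalZX mul1r /assignment -[lshift n _]/(unsplit (inl _)) unsplitK /= inordK.
Qed.

Lemma laurent_w : laurent (fun R u v w X => w).
Proof.
exists 0%N, 'X_(lshift n (inord 2 : 'I_3)) => R u v w X _.
by rewrite evalZX mul1r /assignment -[lshift n _]/(unsplit (inl _)) unsplitK /= inordK.
Qed.

Lemma laurent_X i : laurent (fun R u v w X => X i).
Proof. by exists 0%N, 'X_(rshift 3 i) => R u v w X _; rewrite evalZX mul1r assignment_X. Qed.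

Lemma laurent_Xinv i : laurent (fun R u v w X => (X i)^-1).
Proof.
exists 1%N, (\prod_(j < n | j != i) 'X_(rshift 3 j)) => R u v w X uX.
rewrite expr1 (bigD1 i) //= mulrC mulKr // /evalZ rmorph_prod; apply: eq_bigr => j _.
by rewrite -[RHS]/(evalZ u v w X _) evalZX assignment_X.
Qed.

Lemma laurentD F G : laurent F -> laurent G ->
  laurent (fun R u v w X => F R u v w X + G R u v w X).
Proof.
move=> [M [p HF]] [M' [q HG]]; exists (M + M')%N, (prod_vars ^+ M' * p + prod_vars ^+ M * q).
move=> R u v w X uX; rewrite evalZD !evalZM !evalZXn evalZ_prod_vars -HF // -HG //.
by rewrite mulrDr exprD !mulrA [_ ^+ M' * _ ^+ M]mulrC.
Qed.

Lemma laurentM F G : laurent F -> laurent G ->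
  laurent (fun R u v w X => F R u v w X * G R u v w X).
Proof.
move=> [M [p HF]] [M' [q HG]]; exists (M + M')%N, (p * q).
by move=> R u v w X uX; rewrite evalZM -HF // -HG // exprD mulrACA.
Qed.

Lemma laurent_sum I (r : seq I) (P : pred I) (F : I -> laurent_fun) :
  (forall i, P i -> laurent (F i)) -> laurent
    (fun R u v w X => \sum_(i <- r | P i) F i R u v w X).
Proof.
move=> LF; elim: r => [|i r IHr].
  by apply: eq_laurent laurent0 => R u v w X _; rewrite big_nil.
case Pi: (P i); last by apply: eq_laurent IHr => R u v w X _; rewrite big_cons Pi.
by apply: eq_laurent (laurentD (LF i Pi) IHr) => R u v w X _; rewrite big_cons Pi.
Qed.

Lemma laurent_prod I (r : seq I) (P : pred I) (F : I -> laurent_fun) :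
  (forall i, P i -> laurent (F i)) -> laurent
    (fun R u v w X => \prod_(i <- r | P i) F i R u v w X).
Proof.
move=> LF; elim: r => [|i r IHr].
  by apply: eq_laurent laurent1 => R u v w X _; rewrite big_nil.
case Pi: (P i); last by apply: eq_laurent IHr => R u v w X _; rewrite big_cons Pi.
by apply: eq_laurent (laurentM (LF i Pi) IHr) => R u v w X _; rewrite big_cons Pi.
Qed.

Lemma laurent_exp F k : laurent F -> laurent (fun R u v w X => F R u v w X ^+ k).
Proof.
move=> LF; elim: k => [|k IHk]; first exact: laurent1.
by apply: eq_laurent (laurentM LF IHk) => R u v w X _; rewrite exprS.
Qed.

Lemma laurent_Xz i (z : int) : laurent (fun R u v w X => X i ^ z).
Proof.
case: z => k; first exact: laurent_exp (laurent_X i).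
apply: eq_laurent (laurent_exp k.+1 (laurent_Xinv i)) => R u v w X _.
by rewrite NegzE -exprnN exprVn.
Qed.

Definition genfield : fieldType := {fraction {mpoly int[3 + n]}}.

Definition gen_u : genfield := tofrac 'X_(lshift n (inord 0 : 'I_3)).

Definition gen_v : genfield := tofrac 'X_(lshift n (inord 1 : 'I_3)).

Definition gen_w : genfield := tofrac 'X_(lshift n (inord 2 : 'I_3)).

Definition gen_X (j : nat) : genfield :=
  tofrac (if insub j is Some i then 'X_(rshift 3 i) else 1).

Lemma gen_X_ord (i : 'I_n) : gen_X i = tofrac 'X_(rshift 3 i).
Proof. by rewrite /gen_X valK. Qed.

Lemma evalZ_gen p : evalZ gen_u gen_v gen_w (fun i : 'I_n => gen_X i) p = tofrac p :> genfield.
Proof.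
rewrite {2}[p]mpolyE rmorph_sum /= /evalZ /mmap; apply: eq_bigr => m _.
rewrite -mul_mpolyC rmorphM /=; congr (_ * _).
  by rewrite -[p@_m in RHS]intz rmorph_int /= rmorph_int.
rewrite mpolyXE_id rmorph_prod; apply: eq_bigr => i _; rewrite rmorphXn /=; congr (_ ^+ _).
rewrite /assignment; case: split_ordP => k ->; last exact: gen_X_ord.
case: k => -[|[|[|//]]] lt /=; rewrite /gen_u /gen_v /gen_w; congr (tofrac 'X_(lshift n _));
  by apply: val_inj; rewrite /= inordK.
Qed.

(** In the field of fractions equal values mean equal polynomials, and these have
    equal values in every ring. *)
Theorem laurent_transfer (F G : laurent_fun) : laurent F -> laurent G ->
    F genfield gen_u gen_v gen_w (fun i : 'I_n => gen_X i)
    = G genfield gen_u gen_v gen_w (fun i : 'I_n => gen_X i) ->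
  forall (R : comUnitRingType) u v w X, (forall i, X i \is a GRing.unit) ->
    F R u v w X = G R u v w X.
Proof.
move=> [M [p HF]] [M' [q HG]] FG R u v w X uX.
have gX (i : 'I_n) : gen_X i \is a GRing.unit.
  rewrite unitfE gen_X_ord tofrac_eq0; apply/eqP => /(congr1 (mcoeff U_(rshift 3 i))).
  by rewrite mcoeffX eqxx mcoeff0.
have pq : prod_vars ^+ M' * p = prod_vars ^+ M * q.
  apply/eqP; rewrite -tofrac_eq -!evalZ_gen !evalZM !evalZXn evalZ_prod_vars -HF // -HG // FG.
  by rewrite mulrCA.
have := congr1 (evalZ u v w X) pq; rewrite !evalZM !evalZXn evalZ_prod_vars -HF // -HG //.
rewrite mulrCA => /mulrI H1; apply: (mulrI (x := (\prod_i X i) ^+ M')).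
  by apply: unitrX; rewrite unitr_prod_in // => i _.
by apply: H1 => //; apply: unitrX; rewrite unitr_prod_in // => i _.
Qed.

End Laurent.

Lemma spdelta_neq0 (K : fieldType) n (u v : K) (X : nat -> K) :
    (forall i, X i != 0) -> (forall i j : 'I_n, u * X i * X j - v != 0) ->
    (forall i j : 'I_n, i != j -> X i - X j != 0) ->
  spdelta (fun i => u * X i) (fun i => v / X i) n != 0.
Proof.
move=> X0 prod0 sub0.
rewrite /spdelta mulf_neq0 //.
  apply/prodf_neq0 => i _.
  have -> : u * X i - v / X i = (u * X i * X i - v) / X i by field; exact: X0.
  by rewrite mulf_neq0 ?prod0 ?invr_eq0 ?X0.
apply/prodf_neq0 => -[i j] /= ij.
have -> : u * X j + v / X j - (u * X i + v / X i)
    = (X j - X i) * (u * X i * X j - v) / (X i * X j).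
  by field; rewrite !X0.
rewrite !mulf_neq0 ?prod0 ?invr_eq0 ?mulf_neq0 ?X0 //.
by apply: sub0; rewrite -val_eqE /= gtn_eqF.
Qed.

Section Generic.
Variable n : nat.
Let u := gen_u n.
Let v := gen_v n.
Let X := gen_X n.

(** At this point neither X_i X_j - 1 nor, for distinct i and j, X_i - X_j is zero. *)
Lemma tofrac_neq0_rat (p : {mpoly int[3 + n]}) :
  evalZ (1 : rat) 1 1 (fun i : 'I_n => i.+2%:R) p != 0 -> (tofrac p : genfield n) != 0.
Proof. by rewrite tofrac_eq0; apply: contraNneq => ->; rewrite /evalZ rmorph0. Qed.

Lemma assignment_lshift (R : comUnitRingType) (a b c : R) (Y : 'I_n -> R) (k : 'I_3) :
  assignment a b c Y (lshift n k) = [:: a; b; c]`_k.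
Proof. by rewrite /assignment -[lshift n _]/(unsplit (inl _)) unsplitK. Qed.

Lemma gen_var_neq0 i : (tofrac 'X_i : genfield n) != 0.
Proof.
rewrite tofrac_eq0; apply/eqP => /(congr1 (mcoeff U_(i))).
by rewrite mcoeffX eqxx mcoeff0.
Qed.

Lemma gen_X_neq0 j : X j != 0.
Proof.
rewrite /X /gen_X; case: insub => [i|]; first exact: gen_var_neq0.
by rewrite tofrac1 oner_eq0.
Qed.

Lemma gen_prod_neq0 (i j : 'I_n) : u * X i * X j - v != 0.
Proof.
rewrite /u /v /X /gen_u /gen_v !gen_X_ord -!tofracM -tofracB tofrac_neq0_rat //.
rewrite /evalZ rmorphB !rmorphM /= !mmapX !mmap1U.
rewrite !(assignment_X, assignment_lshift) !inordK //= mul1r -natrM subr_eq0 -[1]/(1%:R)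
  eqr_nat.
by apply/eqP; lia.
Qed.

Lemma gen_sub_neq0 (i j : 'I_n) : i != j -> X i - X j != 0.
Proof.
move=> ij; rewrite /X !gen_X_ord -tofracB tofrac_neq0_rat //.
rewrite /evalZ rmorphB /= !mmapX !mmap1U !assignment_X subr_eq0 eqr_nat !eqSS.
by rewrite -val_eqE in ij.
Qed.

Lemma gen_spdelta_neq0 : spdelta (fun i => u * X i) (fun i => v / X i) n != 0.
Proof. exact: spdelta_neq0 gen_X_neq0 gen_prod_neq0 gen_sub_neq0. Qed.

End Generic.

Theorem corollary2p3 (R : comUnitRingType) (n : nat) (hn : (1 <= n)%N)
    (u v w : R) (X : 'I_n -> R) (hX : forall i, X i \is a GRing.unit) :
  \sum_(A : amt (fun j : 'I_n => (2 * j)%N%:Z)) amt_weight u v w X (val A)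
  = (\prod_(i < n) X i ^+ n.-1)
    * \sum_(T : {set box (2 * n + 2)} | is_tsscpp T)
        w ^+ ('C(n.+1, 2) - sumn (lambda T))
        * sp (lambda T) (fun i => u * X i) (fun i => v * (X i)^-1).
Proof.
pose F : laurent_fun n := fun R u v w X =>
  \sum_(A : amt (fun j : 'I_n => (2 * j)%N%:Z)) amt_weight u v w X (val A).
pose G : laurent_fun n := fun R u v w X =>
  (\prod_(i < n) X i ^+ n.-1)
    * \sum_(T : {set box (2 * n + 2)} | is_tsscpp T)
        w ^+ ('C(n.+1, 2) - sumn (lambda T))
        * sp (lambda T) (fun i => u * X i) (fun i => v * (X i)^-1).
have LF : laurent F.
  apply: laurent_sum => A _; rewrite /amt_weight.
  apply: laurentM; last by apply: laurent_prod => i _; apply: laurent_Xz.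
  apply: laurentM; last exact: laurent_exp (laurent_w n).
  by apply: laurentM; apply: laurent_exp; [exact: laurent_u | exact: laurent_v].
have LG : laurent G.
  apply: laurentM; first by apply: laurent_prod => i _; apply/laurent_exp/laurent_X.
  apply: laurent_sum => T _; apply: laurentM; first exact: laurent_exp (laurent_w n).
  apply: laurent_sum => t _; apply: laurent_prod => i _.
  apply: laurentM; apply: laurent_exp; apply: laurentM;
    [exact: laurent_u | exact: laurent_X | exact: laurent_v | exact: laurent_Xinv].
apply: (laurent_transfer LF LG _ u v w hX).
apply: amt_tsscpp_field => //; try exact: gen_var_neq0; first exact: gen_X_neq0.
exact: gen_spdelta_neq0.
Qed.
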